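(* The problem $R|r_j,d_j|k\text{-sched},C_{\max}$ is fixed-parameter tractable in $k$ and can be solved in $\mathcal{O}^*((2e)^k k^{\mathcal{O}(\log k)})$ time.
   Context: Problem $R|r_j,d_j|k\text{-sched},C_{\max}$: the input consists of $m$ unrelated parallel machines, $n$ jobs where job $j$ has processing time $p_{ij}$ on machine $i$, an integer release date $r_j$ and an integer deadline $d_j$, an integer $k$, and a bound $C_{\max}$. There are no precedence constraints. A (partial) schedule selects a subset of jobs and processes each non-preemptively on one machine $i$ (taking time $p_{ij}$), each machine processing at most one job at a time, each job starting no earlier than $r_j$ and completing no later than $d_j$. The question is whether a schedule processing at least $k$ jobs with makespan (maximum completion time) at most $C_{\max}$ exists. The notation $\mathcal{O}^*$ suppresses factors polynomial in the input size. *)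

(* Defs.v *)
From HB Require Import structures.
From mathcomp Require Import all_boot all_order all_algebra.
From mathcomp Require Import all_classical all_reals all_analysis.
Set Implicit Arguments.
Unset Strict Implicit.
Unset Printing Implicit Defensive.
Import Order.TTheory GRing.Theory Num.Theory.
Import numFieldNormedType.Exports.
Local Open Scope ring_scope.

(** * Random access machine with logarithmic cost

  The machine is the integer RAM of Cook-Reckhow and Aho-Hopcroft-Ullman with
  indirect addressing; control flow is structured instead of given by jumps.
  Every cell holds an arbitrary integer, and every operation is charged the
  bit lengths of the operands and addresses it touches (the product of these
  lengths for multiplication and division). *)

Definition bitlen (z : int) : nat := (trunc_log 2 `|z|%N).+1.

Inductive expr : Type :=
| Const of int
| Fetch of expr
| Add of expr & expr
| Sub of expr & expr
| Mul of expr & expr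
| Div of expr & expr.

Inductive prog : Type :=
| Skip
| Store of expr & expr
| Seq of prog & prog
| If of expr & prog & prog
| While of expr & prog.

(** Cells are addressed by all integers; the input only occupies nonnegative
    addresses, so negative ones may serve as registers. *)
Definition memory := int -> int.

Fixpoint eval (M : memory) (e : expr) : int :=
  match e with
  | Const z => z
  | Fetch e1 => M (eval M e1)
  | Add e1 e2 => eval M e1 + eval M e2
  | Sub e1 e2 => eval M e1 - eval M e2
  | Mul e1 e2 => eval M e1 * eval M e2
  | Div e1 e2 => (eval M e1 %/ eval M e2)%Z
  end.

Fixpoint eval_cost (M : memory) (e : expr) : nat :=
  match e with
  | Const z => bitlen z
  | Fetch e1 => eval_cost M e1 + bitlen (eval M e1) + bitlen (M (eval M e1))
  | Add e1 e2 | Sub e1 e2 =>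
      eval_cost M e1 + eval_cost M e2 + bitlen (eval M e1) + bitlen (eval M e2)
  | Mul e1 e2 | Div e1 e2 =>
      eval_cost M e1 + eval_cost M e2 + bitlen (eval M e1) * bitlen (eval M e2)
  end%N.

Definition update (M : memory) (a v : int) : memory :=
  fun b => if b == a then v else M b.

(** [exec c M t M']: started in memory [M], program [c] halts at cost [t] with
    memory [M'].  Tests succeed on strictly positive values. *)
Inductive exec : prog -> memory -> nat -> memory -> Prop :=
| exec_skip M : exec Skip M 1 M
| exec_store M a e :
    exec (Store a e) M
      (eval_cost M a + eval_cost M e + bitlen (eval M a) + bitlen (eval M e))%N
      (update M (eval M a) (eval M e))
| exec_seq c1 c2 M1 M2 M3 t1 t2 :
    exec c1 M1 t1 M2 -> exec c2 M2 t2 M3 ->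
    exec (Seq c1 c2) M1 (t1 + t2)%N M3
| exec_if_true b c1 c2 M M' t :
    0 < eval M b -> exec c1 M t M' ->
    exec (If b c1 c2) M (eval_cost M b + t).+1 M'
| exec_if_false b c1 c2 M M' t :
    eval M b <= 0 -> exec c2 M t M' ->
    exec (If b c1 c2) M (eval_cost M b + t).+1 M'
| exec_while_true b c M1 M2 M3 t1 t2 :
    0 < eval M1 b -> exec c M1 t1 M2 -> exec (While b c) M2 t2 M3 ->
    exec (While b c) M1 (eval_cost M1 b + t1 + t2).+1 M3
| exec_while_false b c M :
    eval M b <= 0 -> exec (While b c) M (eval_cost M b).+1 M.

Lemma exec_det c M t1 M1 t2 M2 :
  exec c M t1 M1 -> exec c M t2 M2 -> t1 = t2 /\ M1 = M2.
Proof.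
move=> H; elim: H t2 M2 => {c M t1 M1}.
- by move=> M t2 M2 H; inversion H.
- by move=> M a e t2 M2 H; inversion H.
- move=> c1 c2 Ma Mb Mc s1 s2 _ IH1 _ IH2 t2 M2 H; inversion H; subst.
  by have [] := IH1 _ _ H2 => *; subst; have [] := IH2 _ _ H6 => *; subst.
- move=> b c1 c2 M M' t bT _ IH t2 M2 H; inversion H; subst.
    by have [-> ->] := IH _ _ H7.
  by move: H6; rewrite leNgt bT.
- move=> b c1 c2 M M' t bF _ IH t2 M2 H; inversion H; subst.
    by move: H6; rewrite ltNge bF.
  by have [-> ->] := IH _ _ H7.
- move=> b c Ma Mb Mc s1 s2 bT _ IH1 _ IH2 t2 M2 H; inversion H; subst.
    by do 2![match goal with h : exec _ _ _ _ |- _ =>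
      first [case: (IH1 _ _ h) | case: (IH2 _ _ h)] => *; subst; clear h end].
  by match goal with h : is_true (eval _ b <= 0) |- _ =>
    move: h; rewrite leNgt bT end.
- move=> b c M bF t2 M2 H; inversion H; subst => //.
  by match goal with h : is_true (0 < eval _ b) |- _ =>
    move: h; rewrite ltNge bF end.
Qed.

(** Input words are stored at addresses 0, 1, 2, ...; all other cells are 0. *)
Definition init (w : seq int) : memory :=
  fun a => if a is Posz i then w`_i else 0.

(** The result is read in cell 0. *)
Definition output (M : memory) : int := M 0.

Definition computable (f : nat -> nat) : Prop :=
  exists c : prog, forall x : nat, exists (t : nat) (M : memory),
    exec c (init [:: Posz x]) t M /\ output M = Posz (f x).

(** * Parameterized problems *)

Record param_problem : Type := ParamProblem {
  inst : Type;
  encode : inst -> seq int;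
  param : inst -> nat;
  yes : inst -> Prop
}.

Definition input_size (P : param_problem) (I : inst P) : nat :=
  (\sum_(z <- encode I) bitlen z)%N.

Definition solves_in_time (R : realType) (P : param_problem) (c : prog)
    (T : inst P -> R) : Prop :=
  forall I : inst P, exists (t : nat) (M : memory),
    [/\ exec c (init (encode I)) t M,
        t%:R <= T I &
        (yes I /\ output M = 1) \/ (~ yes I /\ output M = 0)].

(** Solvable in time O^*(g(parameter)). *)
Definition solvable_Ostar (R : realType) (P : param_problem) (g : nat -> R)
    : Prop :=
  exists (c : prog) (q : {poly nat}),
    solves_in_time c
      (fun I : inst P => g (param I) * (q.[input_size I])%:R).

Definition fixed_parameter_tractable (R : realType) (P : param_problem) : Prop :=
  exists f : nat -> nat,
    computable f /\ solvable_Ostar P (fun k => (f k)%:R : R).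

(** * The problem R | r_j, d_j | k-sched, C_max *)

Record sched_instance : Type := SchedInstance {
  machines : nat;
  jobs : nat;
  ptime : 'I_machines -> 'I_jobs -> nat;
  release : 'I_jobs -> int;
  deadline : 'I_jobs -> int;
  target : nat;
  cmax : int
}.

(** [s j = Some (i, x)]: job [j] is processed on machine [i] from time [x] on;
    [s j = None]: job [j] is not selected. *)
Definition schedule (R : realType) (I : sched_instance) : Type :=
  'I_(jobs I) -> option ('I_(machines I) * R).

Definition selected (R : realType) (I : sched_instance) (s : schedule R I)
    : {set 'I_(jobs I)} := [set j | isSome (s j)].

Definition valid_schedule (R : realType) (I : sched_instance)
    (s : schedule R I) : Prop :=
  (forall j i x, s j = Some (i, x) ->
     (release j)%:~R <= x /\ x + (ptime i j)%:R <= (deadline j)%:~R) /\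
  (forall j j' i x x', j != j' -> s j = Some (i, x) -> s j' = Some (i, x') ->
     x + (ptime i j)%:R <= x' \/ x' + (ptime i j')%:R <= x).

Definition makespan_le (R : realType) (I : sched_instance)
    (s : schedule R I) (C : R) : Prop :=
  forall j i x, s j = Some (i, x) -> x + (ptime i j)%:R <= C.

Definition sched_yes (R : realType) (I : sched_instance) : Prop :=
  exists s : schedule R I,
    [/\ valid_schedule s,
        (target I <= #|selected s|)%N &
        makespan_le s (cmax I)%:~R].

(** Numbers of machines and jobs, [k], [C_max], release dates, deadlines, then
    the matrix of processing times, machine by machine. *)
Definition sched_encode (I : sched_instance) : seq int :=
  [:: Posz (machines I); Posz (jobs I); Posz (target I); cmax I]
  ++ [seq release j | j <- enum 'I_(jobs I)]
  ++ [seq deadline j | j <- enum 'I_(jobs I)]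
  ++ [seq Posz (ptime i j) | i <- enum 'I_(machines I), j <- enum 'I_(jobs I)].

Definition sched_problem (R : realType) : param_problem :=
  @ParamProblem sched_instance sched_encode target (@sched_yes R).

(* Main.v *)
Require Import Defs.
From mathcomp Require Import all_boot all_order all_algebra.
From mathcomp Require Import all_classical all_reals all_analysis.
From mathcomp Require Import zify ring lra.
Import Order.TTheory GRing.Theory Num.Theory.
Import numFieldNormedType.Exports.
Local Open Scope ring_scope.

Set Implicit Arguments.
Unset Strict Implicit.
Unset Printing Implicit Defensive.

(** Derandomised colour coding.  Colour the jobs with [K = k + O(log)] colours;
    a dynamic program over pairs (number of machines used, set of colours)
    then finds in [2^K] steps the earliest time at which the current machine
    can be free again when exactly one job of each colour of the set is
    processed.  It detects a solution as soon as its [k] jobs receive distinct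
    colours.

    Such a colouring is found among [e^k k^O(log k)] candidates, up to factors
    polynomial in the number [n] of jobs.  Some modulus of size
    [O(k^2 log n)] is injective on the [k] jobs, because the product of their
    differences is smaller than the least common multiple of all these moduli.
    The residues are cut into [B = O(log k + log log n)] intervals of
    [kk = K / B] residues of the solution each, and each interval is coloured
    by one of [L] functions forming a perfect hash family.  Choosing these
    functions greedily, with the method of conditional expectations, gives
    [L = e^kk * O(K)], and [L^B = e^k 2^O(B^2)].  The term [(log log n)^2] in
    [B^2] is at most logarithmic in [n], so that it only contributes a
    polynomial factor.

    The procedure only uses bounded for-loops, so it is written in a small loop
    language whose compilation to the random access machine costs one
    polynomial factor in the bit length of the numbers involved. *)

(** * A loop language and its compilation *)

(** Cutting into blocks is what makes the greedy construction affordable. It runs over all tuples of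
    points to be separated, and [k] points at once would mean [N ^ k] tuples. With [B] the bit
    length of [N], a block of [kk] points has [N ^ kk < 2 ^ (B * kk) = 2 ^ K] tuples, no more than
    the colour sets of the dynamic program. The price is an exponent quadratic in [B]: the block
    boundaries cost [N ^ (B - 1)], each of the [B] choices of a row has an overhead of [2^O(B)], and
    rounding [k / B] up adds at most [B] colours.

    The reduction modulo a small number is forced by the boundaries: among the jobs themselves they
    would number about [n ^ log n], which is not of the allowed form.

    The dynamic program keeps one time per colour set, because finishing the current machine earlier
    never hurts. The same monotonicity lets a schedule with real starting times be shifted left
    until all its times are integers. *)

Definition state := nat -> nat -> int.

(** [HA x e] is entry [e] of array [x], and [HI e] is the input word at
    address [e]. *)
Inductive hexp : Type :=
| HC of int
| HA of nat & hexp
| HI of hexp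
| HAdd of hexp & hexp
| HSub of hexp & hexp
| HMul of hexp & hexp
| HDiv of hexp & hexp.

(** [HFor x b c] runs [c] for [x] from 0 up to, and excluding, the value of
    [b]; the body may assign neither [x] nor [b]. *)
Inductive hprog : Type :=
| HSkip
| HSet of nat & hexp & hexp
| HSeq of hprog & hprog
| HIf of hexp & hprog & hprog
| HFor of nat & nat & hprog.

Notation HV x := (HA x (HC 0)).

(** The tests use [Nat.eqb], which computes on numerals, so that simplification resolves an access
    to a concrete identifier. *)
Definition upd (s : state) (x i : nat) (v : int) : state :=
  fun y => if Nat.eqb y x then fun j => if Nat.eqb j i then v else s y j
           else s y.

Arguments upd s x i v !y j /.

Lemma upd_eq s x i v : upd s x i v x i = v.
Proof. by rewrite /upd !PeanoNat.Nat.eqb_refl. Qed.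

Lemma upd_neq s x i v y : y != x -> upd s x i v y = s y.
Proof. by rewrite /upd; case: PeanoNat.Nat.eqb_spec => [->|//]; rewrite eqxx. Qed.

Lemma updE s x i v j : upd s x i v x j = if j == i then v else s x j.
Proof.
rewrite /upd PeanoNat.Nat.eqb_refl.
by case: eqP => [->|/PeanoNat.Nat.eqb_neq ->]; rewrite ?PeanoNat.Nat.eqb_refl.
Qed.

Fixpoint heval (inp : nat -> int) (s : state) (e : hexp) : int :=
  match e with
  | HC z => z
  | HA x e1 => s x `|heval inp s e1|%N
  | HI e1 => inp `|heval inp s e1|%N
  | HAdd e1 e2 => heval inp s e1 + heval inp s e2
  | HSub e1 e2 => heval inp s e1 - heval inp s e2
  | HMul e1 e2 => heval inp s e1 * heval inp s e2
  | HDiv e1 e2 => (heval inp s e1 %/ heval inp s e2)%Z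
  end.

Definition hstep (x : nat) (f : state -> state) (s : state) : state :=
  upd (f s) x 0 (f s x 0%N + 1).

Fixpoint sem (inp : nat -> int) (c : hprog) (s : state) : state :=
  match c with
  | HSkip => s
  | HSet x e1 e2 => upd s x `|heval inp s e1|%N (heval inp s e2)
  | HSeq c1 c2 => sem inp c2 (sem inp c1 s)
  | HIf e c1 c2 => if 0 < heval inp s e then sem inp c1 s else sem inp c2 s
  | HFor x b c1 => iter `|s b 0%N|%N (hstep x (sem inp c1)) (upd s x 0 0)
  end.

Definition bounded (V : nat) (z : int) : Prop := - V%:Z <= z <= V%:Z.

(** Intermediate values are bounded too, since every operand is charged its bit length. Nonnegative
    indices make the absolute value taken by [heval] agree with the signed address of the compiled
    code. *)
Fixpoint oke (V : nat) (inp : nat -> int) (s : state) (e : hexp) : Prop :=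
  bounded V (heval inp s e) /\
  match e with
  | HC _ => True
  | HA _ e1 | HI e1 => 0 <= heval inp s e1 /\ oke V inp s e1
  | HAdd e1 e2 | HSub e1 e2 | HMul e1 e2 | HDiv e1 e2 =>
      oke V inp s e1 /\ oke V inp s e2
  end.

(** Iteration bounds are attached to loop variables, not to states, so that [scost] bounds the
    running time from the program text alone. *)
Fixpoint okc (V : nat) (bnd : nat -> nat) (inp : nat -> int) (c : hprog)
    (s : state) : Prop :=
  match c with
  | HSkip => True
  | HSet x e1 e2 =>
      [/\ 0 <= heval inp s e1, oke V inp s e1 & oke V inp s e2]
  | HSeq c1 c2 => okc V bnd inp c1 s /\ okc V bnd inp c2 (sem inp c1 s)
  | HIf e c1 c2 =>
      oke V inp s e /\
      (if 0 < heval inp s e then okc V bnd inp c1 s else okc V bnd inp c2 s)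
  | HFor x b c1 =>
      let n := `|s b 0%N|%N in
      [/\ 0 <= s b 0%N, (n <= V)%N, (n <= bnd x)%N &
          forall i, (i < n)%N ->
            okc V bnd inp c1 (iter i (hstep x (sem inp c1)) (upd s x 0 0))]
  end.

Fixpoint mods (c : hprog) : seq nat :=
  match c with
  | HSkip => [::]
  | HSet x _ _ => [:: x]
  | HSeq c1 c2 | HIf _ c1 c2 => mods c1 ++ mods c2
  | HFor x _ c1 => x :: mods c1
  end.

(** Array [x] lives at the addresses [Negz (x + 64 * i)], hence the bound 64
    on identifiers. *)
Fixpoint wfe (e : hexp) : bool :=
  match e with
  | HC _ => true
  | HA x e1 => (x < 64)%N && wfe e1
  | HI e1 => wfe e1
  | HAdd e1 e2 | HSub e1 e2 | HMul e1 e2 | HDiv e1 e2 => wfe e1 && wfe e2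
  end.

Fixpoint wfc (c : hprog) : bool :=
  match c with
  | HSkip => true
  | HSet x e1 e2 => [&& (x < 64)%N, wfe e1 & wfe e2]
  | HSeq c1 c2 => wfc c1 && wfc c2
  | HIf e c1 c2 => [&& wfe e, wfc c1 & wfc c2]
  | HFor x b c1 =>
      [&& (x < 64)%N, (b < 64)%N, x != b, x \notin mods c1, b \notin mods c1
        & wfc c1]
  end.

(** The unit is [b ^ 2], with [b] the bit length of the largest address: a product or quotient costs
    at most [b * b], any other operation a multiple of [b]. *)
Fixpoint ecost (e : hexp) : nat :=
  match e with
  | HC _ => 1
  | HA _ e1 | HI e1 => ecost e1 + 7
  | HAdd e1 e2 | HSub e1 e2 | HMul e1 e2 | HDiv e1 e2 =>
      ecost e1 + ecost e2 + 2
  end%N.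

Fixpoint scost (bnd : nat -> nat) (c : hprog) : nat :=
  match c with
  | HSkip => 1
  | HSet _ e1 e2 => ecost e1 + ecost e2 + 7
  | HSeq c1 c2 => scost bnd c1 + scost bnd c2
  | HIf e c1 c2 => ecost e + scost bnd c1 + scost bnd c2 + 1
  | HFor x _ c1 => bnd x * (scost bnd c1 + 40) + 40
  end%N.

Definition compile_addr (x : nat) (e : expr) : expr :=
  Defs.Sub (Const (Negz x)) (Mul (Const (Posz 64)) e).

Fixpoint compile_exp (e : hexp) : expr :=
  match e with
  | HC z => Const z
  | HA x e1 => Fetch (compile_addr x (compile_exp e1))
  | HI e1 => Fetch (compile_exp e1)
  | HAdd e1 e2 => Add (compile_exp e1) (compile_exp e2)
  | HSub e1 e2 => Defs.Sub (compile_exp e1) (compile_exp e2)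
  | HMul e1 e2 => Mul (compile_exp e1) (compile_exp e2)
  | HDiv e1 e2 => Div (compile_exp e1) (compile_exp e2)
  end.

Fixpoint compile (c : hprog) : prog :=
  match c with
  | HSkip => Skip
  | HSet x e1 e2 => Store (compile_addr x (compile_exp e1)) (compile_exp e2)
  | HSeq c1 c2 => Seq (compile c1) (compile c2)
  | HIf e c1 c2 => If (compile_exp e) (compile c1) (compile c2)
  | HFor x b c1 =>
      Seq (Store (Const (Negz x)) (Const 0))
        (While (Defs.Sub (Fetch (Const (Negz b))) (Fetch (Const (Negz x))))
          (Seq (compile c1)
            (Store (Const (Negz x)) (Add (Fetch (Const (Negz x))) (Const 1)))))
  end.

Definition hmem (inp : nat -> int) (s : state) : memory :=
  fun a => match a with
           | Posz i => inp i
           | Negz i => s (i %% 64)%N (i %/ 64)%N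
           end.
Arguments hmem : simpl never.

Lemma mem_arr inp s x i : (x < 64)%N -> hmem inp s (Negz (x + 64 * i)) = s x i.
Proof.
move=> lx; rewrite /hmem.
have -> : ((x + 64 * i) %% 64 = x)%N by lia.
by have -> : ((x + 64 * i) %/ 64 = i)%N by lia.
Qed.

Lemma mem_scalar inp s x : (x < 64)%N -> hmem inp s (Negz x) = s x 0%N.
Proof. by move=> lx; rewrite -(mem_arr inp s 0 lx) muln0 addn0. Qed.

Lemma update_mem inp s x i v : (x < 64)%N ->
  update (hmem inp s) (Negz (x + 64 * i)) v = hmem inp (upd s x i v).
Proof.
move=> lx; apply: funext => a; rewrite /update; case: a => a //=.
rewrite /hmem /upd; case: eqP => [[->]|ne].
  have -> : ((x + 64 * i) %% 64 = x)%N by lia.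
  have -> : ((x + 64 * i) %/ 64 = i)%N by lia.
  by rewrite !PeanoNat.Nat.eqb_refl.
case: PeanoNat.Nat.eqb_spec => // e1; case: PeanoNat.Nat.eqb_spec => // e2.
by case: ne; congr Negz; lia.
Qed.

Lemma update_mem_scalar inp s x v : (x < 64)%N ->
  update (hmem inp s) (Negz x) v = hmem inp (upd s x 0 v).
Proof. by move=> lx; rewrite -update_mem// muln0 addn0. Qed.

Lemma addr_Negz x (i : nat) : Negz x - Posz 64 * i%:Z = Negz (x + 64 * i).
Proof. by rewrite !NegzE; lia. Qed.

Lemma bitlen_gt0 z : (0 < bitlen z)%N.
Proof. by []. Qed.

Lemma bitlen_le z (a : nat) : (`|z| <= a)%N -> (bitlen z <= bitlen a%:Z)%N.
Proof. by move=> h; rewrite /bitlen ltnS; apply: leq_trunc_log. Qed.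

Lemma sem_frame inp c s y : y \notin mods c -> sem inp c s y = s y.
Proof.
elim: c s => //=.
- by move=> x e1 e2 s; rewrite inE => /upd_neq.
- by move=> c1 IH1 c2 IH2 s; rewrite mem_cat negb_or => /andP[h1 h2];
     rewrite IH2 ?IH1.
- by move=> e c1 IH1 c2 IH2 s; rewrite mem_cat negb_or => /andP[h1 h2];
     case: ifP; rewrite ?IH2 ?IH1.
- move=> x b c IH s; rewrite inE negb_or => /andP[hx hc].
  elim: `|_|%N => [|n IHn] /=; first by rewrite upd_neq.
  by rewrite /hstep upd_neq// IH.
Qed.

Lemma loop_frame inp x c s y i : y != x -> y \notin mods c ->
  iter i (hstep x (sem inp c)) (upd s x 0 0) y = s y.
Proof.
move=> yx yc; elim: i => [|i IH] /=; first by rewrite upd_neq.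
by rewrite /hstep upd_neq// sem_frame.
Qed.

Lemma loop_counter inp x c s i : x \notin mods c ->
  iter i (hstep x (sem inp c)) (upd s x 0 0) x 0%N = i%:Z.
Proof.
move=> xc; elim: i => [|i IH] /=; first by rewrite upd_eq.
by rewrite /hstep upd_eq sem_frame// IH; lia.
Qed.

Section Compilation.
Variables (V : nat) (bnd : nat -> nat) (inp : nat -> int).

(** For [x < 64] and [i <= V] the address [Negz (x + 64 * i)] has absolute value [x + 64 * i + 1],
    at most [64 * V + 64]. *)
Let b := bitlen (64 * V + 64)%N.

Let bitlen_small z : (`|z| <= 64 * V + 64)%N -> (bitlen z <= b)%N.
Proof. exact: bitlen_le. Qed.

Lemma compile_exp_eval s e : wfe e -> oke V inp s e ->
  Defs.eval (hmem inp s) (compile_exp e) = heval inp s e.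
Proof.
elim: e => //=.
- move=> x e IH /andP[lx we] [_ +] => -[e0 he1]; rewrite IH//.
  by rewrite -(gez0_abs e0) addr_Negz mem_arr.
- by move=> e IH we [_ +] => -[e0 he1]; rewrite IH// -{1}(gez0_abs e0).
- by move=> e1 IH1 e2 IH2 /andP[w1 w2] [_ +] => -[ok1 ok2]; rewrite IH1// IH2.
- by move=> e1 IH1 e2 IH2 /andP[w1 w2] [_ +] => -[ok1 ok2]; rewrite IH1// IH2.
- by move=> e1 IH1 e2 IH2 /andP[w1 w2] [_ +] => -[ok1 ok2]; rewrite IH1// IH2.
- by move=> e1 IH1 e2 IH2 /andP[w1 w2] [_ +] => -[ok1 ok2]; rewrite IH1// IH2.
Qed.

Lemma oke_bounded s e : oke V inp s e -> bounded V (heval inp s e).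
Proof. by case: e => [?|? ?|?|? ?|? ?|? ?|? ?] /= []. Qed.

Lemma bounded_bitlen z : bounded V z -> (bitlen z <= b)%N.
Proof. by rewrite /bounded => /andP[h1 h2]; apply: bitlen_small; lia. Qed.

Lemma compile_exp_cost s e : wfe e -> oke V inp s e ->
  (eval_cost (hmem inp s) (compile_exp e) <= ecost e * b ^ 2)%N.
Proof.
have b1 : (b <= b ^ 2)%N by rewrite expnS expn1 leq_pmulr.
have bb z z' : bounded V z -> bounded V z' ->
    (bitlen z * bitlen z' <= b ^ 2)%N.
  by move=> h h'; rewrite expnS expn1 leq_mul// bounded_bitlen.
elim: e => [z|x e IH|e IH|e1 IH1 e2 IH2|e1 IH1 e2 IH2|e1 IH1 e2 IH2|
  e1 IH1 e2 IH2] /=.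
- by move=> _ [hz _]; move: (bounded_bitlen hz); lia.
- move=> /andP[lx we] [hv +] => -[e0 he1]; rewrite compile_exp_eval//.
  have := IH we he1; move: (bounded_bitlen hv) (oke_bounded he1) e0.
  case: (heval inp s e) => // i; rewrite addr_Negz mem_arr//= => h1 h2 _ h3.
  have h4 : (bitlen (Posz 64) * bitlen i <= b ^ 2)%N.
    rewrite expnS expn1 leq_mul//; last exact: bounded_bitlen.
    by apply: bitlen_small => /=; lia.
  have h5 : (bitlen (Negz x) <= b)%N by apply: bitlen_small; lia.
  have h6 : (bitlen (Posz 64 * i%:Z) <= b)%N.
    by apply: bitlen_small; move: h2; rewrite /bounded; lia.
  have h7 : (bitlen (Negz (x + 64 * i)) <= b)%N.
    by apply: bitlen_small; move: h2; rewrite /bounded; lia.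
  have h8 : (bitlen (Posz 64) <= b)%N by apply: bitlen_small => /=; lia.
  by rewrite mulnDl; lia.
- move=> we [hv +] => -[e0 he1]; rewrite compile_exp_eval//.
  have := IH we he1; move: (bounded_bitlen hv) (bounded_bitlen (oke_bounded he1)).
  by rewrite -[X in hmem _ _ X](gez0_abs e0) /hmem; lia.
- move=> /andP[w1 w2] [hv +] => -[ok1 ok2]; rewrite !compile_exp_eval//.
  have := IH1 w1 ok1; have := IH2 w2 ok2.
  have := bounded_bitlen (oke_bounded ok1).
  by have := bounded_bitlen (oke_bounded ok2); lia.
- move=> /andP[w1 w2] [hv +] => -[ok1 ok2]; rewrite !compile_exp_eval//.
  have := IH1 w1 ok1; have := IH2 w2 ok2.
  have := bounded_bitlen (oke_bounded ok1).
  by have := bounded_bitlen (oke_bounded ok2); lia.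
- move=> /andP[w1 w2] [hv +] => -[ok1 ok2]; rewrite !compile_exp_eval//.
  have := IH1 w1 ok1; have := IH2 w2 ok2.
  by have := bb _ _ (oke_bounded ok1) (oke_bounded ok2); lia.
- move=> /andP[w1 w2] [hv +] => -[ok1 ok2]; rewrite !compile_exp_eval//.
  have := IH1 w1 ok1; have := IH2 w2 ok2.
  by have := bb _ _ (oke_bounded ok1) (oke_bounded ok2); lia.
Qed.

Lemma compile_exec c s : wfc c -> okc V bnd inp c s ->
  exists2 t, exec (compile c) (hmem inp s) t (hmem inp (sem inp c s))
           & (t <= scost bnd c * b ^ 2)%N.
Proof.
have b1 : (b <= b ^ 2)%N by rewrite expnS expn1 leq_pmulr.
have b0 : (0 < b ^ 2)%N by rewrite expn_gt0.
elim: c s => /=.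
- by move=> s _ _; exists 1%N; [exact: exec_skip | rewrite mul1n].
- move=> x e1 e2 s /and3P[lx w1 w2] [e0 ok1 ok2].
  have ca := compile_exp_cost w1 ok1.
  have cb := compile_exp_cost w2 ok2.
  have va := compile_exp_eval w1 ok1.
  have vb := compile_exp_eval w2 ok2.
  have [ba bb] := (oke_bounded ok1, oke_bounded ok2).
  have := exec_store (hmem inp s) (compile_addr x (compile_exp e1))
    (compile_exp e2).
  rewrite /= va vb -{1 2 3 4}(gez0_abs e0) addr_Negz update_mem// => h.
  eexists; first exact: h.
  move: ba e0 ca; case: (heval inp s e1) => //= i ba _ ca.
  have h4 : (bitlen (Posz 64) * bitlen i <= b ^ 2)%N.
    rewrite expnS expn1 leq_mul//; last exact: bounded_bitlen.
    by apply: bitlen_small => /=; lia.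
  have h5 : (bitlen (Negz x) <= b)%N by apply: bitlen_small; lia.
  have h6 : (bitlen (Posz 64 * i%:Z) <= b)%N.
    by apply: bitlen_small; move: ba; rewrite /bounded; lia.
  have h7 : (bitlen (Negz (x + 64 * i)) <= b)%N.
    by apply: bitlen_small; move: ba; rewrite /bounded; lia.
  have h8 : (bitlen (Posz 64) <= b)%N by apply: bitlen_small => /=; lia.
  by have := bounded_bitlen bb; rewrite !mulnDl; lia.
- move=> c1 IH1 c2 IH2 s /andP[w1 w2] [ok1 ok2].
  have [t1 x1 l1] := IH1 _ w1 ok1; have [t2 x2 l2] := IH2 _ w2 ok2.
  by exists (t1 + t2)%N; [apply: exec_seq x1 x2 | rewrite mulnDl leq_add].
- move=> e c1 IH1 c2 IH2 s /and3P[we w1 w2] [he1].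
  have ve := compile_exp_eval we he1.
  have ce := compile_exp_cost we he1.
  case: ltP => he oc.
  + have [t1 x1 l1] := IH1 _ w1 oc.
    eexists; first by apply: exec_if_true x1; rewrite ve.
    by rewrite !mulnDl mul1n; lia.
  + have [t1 x1 l1] := IH2 _ w2 oc.
    eexists; first by apply: exec_if_false x1; rewrite ve.
    by rewrite !mulnDl mul1n; lia.
- move=> x v c IH s /and5P[lx lv xv xc /andP[vc wc]] [s0 sV sb ok].
  set n := `|s v 0%N|%N in sV sb ok *.
  set loop := fun i => iter i (hstep x (sem inp c)) (upd s x 0 0).
  have sn : s v 0%N = n%:Z by rewrite /n gez0_abs.
  have lpv i : loop i v 0%N = n%:Z.
    by rewrite /loop loop_frame// 1?eq_sym.
  have lpx i : loop i x 0%N = i%:Z by rewrite /loop loop_counter.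
  have small z : (`|z| <= V)%N -> (bitlen z <= b)%N.
    by move=> h; apply: bitlen_small; lia.
  have bv : (bitlen (Negz v) <= b)%N by apply: bitlen_small; lia.
  have bx : (bitlen (Negz x) <= b)%N by apply: bitlen_small; lia.
  have bone : (bitlen 1 <= b)%N by apply: bitlen_small => /=; lia.
  have bzero : (bitlen 0 <= b)%N by apply: bitlen_small => /=; lia.
  set test := Defs.Sub _ _.
  have test_val i : Defs.eval (hmem inp (loop i)) test = n%:Z - i%:Z.
    by rewrite /= !mem_scalar// lpv lpx.
  have test_cost i : (i <= n)%N ->
      (eval_cost (hmem inp (loop i)) test <= 8 * b)%N.
    move=> le; rewrite /= !mem_scalar// lpv lpx.
    have h1 : (bitlen n <= b)%N by apply: small; lia.
    have h2 : (bitlen i <= b)%N by apply: small; lia.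
    by lia.
  (* Induction on the number [d] of iterations still to run, since [exec] unfolds a loop at its
     first test. *)
  have loops d i : (i + d = n)%N ->
      exists2 t, exec (While test (Seq (compile c) (Store (Const (Negz x))
        (Add (Fetch (Const (Negz x))) (Const 1))))) (hmem inp (loop i)) t
        (hmem inp (loop n)) & (t <= (d * (scost bnd c + 40) + 30) * b ^ 2)%N.
    elim: d i => [|d IHd] i di.
      have -> : i = n by lia.
      eexists; first by apply: exec_while_false; rewrite test_val; lia.
      by have := test_cost n (leqnn n); lia.
    have li : (i < n)%N by lia.
    have [t1 x1 l1] := IH _ wc (ok i li).
    have [t2 x2 l2] := IHd i.+1 ltac:(lia).
    have hx : sem inp c (loop i) x 0%N = i%:Z by rewrite sem_frame.
    have lS : loop i.+1 = upd (sem inp c (loop i)) x 0 (i%:Z + 1).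
      by rewrite [LHS]/loop iterS -/(loop i) /hstep hx.
    have := exec_store (hmem inp (sem inp c (loop i))) (Const (Negz x))
      (Add (Fetch (Const (Negz x))) (Const 1)).
    rewrite /= mem_scalar// hx update_mem_scalar// -lS => x3.
    eexists.
      apply: exec_while_true; [by rewrite test_val; lia | | exact: x2].
      by apply: exec_seq; [exact: x1 | exact: x3].
    have h1 : (bitlen i <= b)%N by apply: small; lia.
    have h2 : (bitlen (i%:Z + 1) <= b)%N by apply: small; lia.
    have := test_cost i (ltnW li); move: l1 l2; rewrite -[d.+1]addn1 !mulnDl !mulnDr.
    by lia.
  have [t2 x2 l2] := loops n 0%N (add0n n).
  have := exec_store (hmem inp s) (Const (Negz x)) (Const 0).
  rewrite /= update_mem_scalar// => x1.
  eexists; first by apply: exec_seq; [exact: x1 | exact: x2].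
  have : (n * (scost bnd c + 40) <= bnd x * (scost bnd c + 40))%N.
    by rewrite leq_mul2r sb orbT.
  move/(leq_mul (leqnn (b ^ 2))); rewrite /=; move: l2; rewrite !mulnDl.
  by lia.
Qed.

End Compilation.

(** * Program logic for correctness together with the resource bounds *)

Section WeakestPreconditions.
Variables (V : nat) (bnd : nat -> nat) (inp : nat -> int).

Definition wp (c : hprog) (Q : state -> Prop) (s : state) : Prop :=
  okc V bnd inp c s /\ Q (sem inp c s).

Definition agree (l : seq nat) (s s' : state) : Prop :=
  forall y, y \notin l -> s' y = s y.

Lemma wp_skip Q s : Q s -> wp HSkip Q s.
Proof. by []. Qed.

Lemma wp_set x e1 e2 (Q : state -> Prop) s :
  0 <= heval inp s e1 -> oke V inp s e1 -> oke V inp s e2 ->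
  Q (upd s x `|heval inp s e1|%N (heval inp s e2)) -> wp (HSet x e1 e2) Q s.
Proof. by []. Qed.

Lemma wp_seq c1 c2 Q s : wp c1 (wp c2 Q) s -> wp (HSeq c1 c2) Q s.
Proof. by case=> h1 [h2 h3]. Qed.

Lemma wp_if e c1 c2 Q s : oke V inp s e ->
  (0 < heval inp s e -> wp c1 Q s) -> (heval inp s e <= 0 -> wp c2 Q s) ->
  wp (HIf e c1 c2) Q s.
Proof.
move=> he1 h1 h2; rewrite /wp /=; case: ltP => h.
  by have [? ?] := h1 h.
by have [? ?] := h2 h.
Qed.

Lemma wp_conseq c (P Q : state -> Prop) s :
  wp c P s -> (forall s', agree (mods c) s s' -> P s' -> Q s') -> wp c Q s.
Proof.
case=> h1 h2 h; split=> //; apply: h => // y; exact: sem_frame.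
Qed.

(** The invariant is re-established after the counter has been advanced. The value of the counter
    and the frame [agree] are supplied, so that [Inv] only describes what the body changes. *)
Lemma wp_for x v c n (Inv : nat -> state -> Prop) (Q : state -> Prop) s :
  wfc (HFor x v c) ->
  s v 0%N = n%:Z -> (n <= V)%N -> (n <= bnd x)%N ->
  Inv 0%N (upd s x 0 0) ->
  (forall i s', (i < n)%N -> s' x 0%N = i%:Z -> agree (x :: mods c) s s' ->
     Inv i s' -> wp c (fun s'' => Inv i.+1 (upd s'' x 0 i.+1%:Z)) s') ->
  (forall s', agree (x :: mods c) s s' -> Inv n s' -> Q s') ->
  wp (HFor x v c) Q s.
Proof.
move=> /and5P[lx lv xv xc /andP[vc wc]] sn nV nb I0 Istep IQ.
set loop := fun i => iter i (hstep x (sem inp c)) (upd s x 0 0).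
have lpx i : loop i x 0%N = i%:Z by rewrite /loop loop_counter.
have fr i : agree (x :: mods c) s (loop i).
  by move=> y; rewrite inE negb_or => /andP[h1 h2]; rewrite /loop loop_frame.
have inv i : (i <= n)%N -> Inv i (loop i).
  elim: i => [//|i IH] lt.
  have [_] := Istep i (loop i) lt (lpx i) (fr i) (IH (ltnW lt)).
  rewrite [loop i.+1]/loop iterS -/(loop i) /hstep.
  by rewrite [sem inp c (loop i) x]sem_frame// lpx -PoszD addn1.
rewrite /wp /= sn /=; split; last exact: IQ (fr n) (inv n (leqnn n)).
split=> // i lt.
by have [] := Istep i (loop i) lt (lpx i) (fr i) (inv i (ltnW lt)).
Qed.

End WeakestPreconditions.

(** * Separating a set of jobs by a small modulus *)

Section Separation.
Local Open Scope nat_scope.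

(** By Pascal's rule and symmetry, passing from [m] to [m + 1] at least doubles the central
    coefficient. *)
Lemma central_bin_lower m : 2 ^ m <= 'C(m + m, m).
Proof.
elim: m => [//|m IH]; rewrite addnS addSn binS.
have -> : 'C((m + m).+1, m) = 'C((m + m).+1, m.+1).
  rewrite -[in RHS]bin_sub; last by lia.
  by congr binomial; lia.
by rewrite binS expnS; lia.
Qed.

(** By Legendre's formula the exponent of [p] is the sum over [i] of
    [(m + m) %/ p ^ i - 2 * (m %/ p ^ i)]. Each term is 0 or 1, and it vanishes once [p ^ i] exceeds
    [m + m]. *)
Lemma pfactor_central_bin p m : prime p -> 0 < m ->
  p ^ logn p 'C(m + m, m) <= m + m.
Proof.
move=> pp m0; set t := trunc_log p (m + m).
suff h : logn p 'C(m + m, m) <= t.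
  rewrite (leq_trans (leq_pexp2l (prime_gt0 pp) h))//.
  by apply: trunc_logP; [exact: prime_gt1 | lia].
have := congr1 (logn p) (bin_fact (leq_addr m m)).
have bp : 0 < 'C(m + m, m) by rewrite bin_gt0 leq_addr.
rewrite addnK lognM ?muln_gt0 ?fact_gt0// lognM ?fact_gt0// !logn_fact//.
have -> : \sum_(1 <= k < m.+1) m %/ p ^ k = \sum_(1 <= k < (m + m).+1) m %/ p ^ k.
  rewrite [RHS](@big_cat_nat _ _ _ m.+1)//=; last by lia.
  rewrite [X in _ = _ + X]big_nat_cond [X in _ = _ + X]big1 ?addn0//.
  move=> i /andP[/andP[h _] _]; rewrite divn_small//.
  exact: leq_trans h (ltnW (ltn_expl _ (prime_gt1 pp))).
have : \sum_(1 <= k < (m + m).+1) (m + m) %/ p ^ k <=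
  \sum_(1 <= k < (m + m).+1) ((m %/ p ^ k + m %/ p ^ k) + (k <= t)).
  rewrite big_nat_cond [X in _ <= X]big_nat_cond; apply: leq_sum => i _.
  have pi : 0 < p ^ i by rewrite expn_gt0 prime_gt0.
  case: (leqP i t) => hi; last first.
    rewrite divn_small//; apply: leq_trans (trunc_log_ltn _ (prime_gt1 pp)) _.
    exact: leq_pexp2l (prime_gt0 pp) hi.
  by rewrite divnD// leq_add2l leq_b1.
rewrite !big_split /=.
have : \sum_(1 <= k < (m + m).+1) (k <= t) <= t.
  elim: (m + m) => [|i IH]; first by rewrite big_nil.
  rewrite big_nat_recr//=; case: (leqP i.+1 t) => h; last by rewrite addn0.
  rewrite addn1; apply: leq_ltn_trans h; apply: leq_trans (_ : \sum_(1 <= k < i.+1) 1 <= _).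
    by apply: leq_sum => j _; rewrite leq_b1.
  by rewrite sum_nat_const_nat muln1 subSS subn0.
by lia.
Qed.

(** Chebyshev's argument: the prime powers composing the central binomial coefficient are at most
    [m + m], so each divides [d], and hence so does the coefficient. *)
Lemma lcm_lower m d : 0 < d -> 0 < m ->
  (forall q, 0 < q <= m + m -> q %| d) -> 2 ^ m <= d.
Proof.
move=> d0 m0 dv; apply: leq_trans (central_bin_lower m) _.
apply: dvdn_leq => //; apply/dvdn_partP; first by rewrite bin_gt0 leq_addr.
move=> p; rewrite mem_primes => /and3P[pp _ _]; rewrite p_part.
by apply: dv; rewrite expn_gt0 prime_gt0//= pfactor_central_bin.
Qed.

Lemma leq_prod_const (T : eqType) (s : seq T) (F : T -> nat) c :
  {in s, forall x, F x <= c} -> \prod_(x <- s) F x <= c ^ size s.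
Proof.
elim: s => [|x s IH] h; first by rewrite big_nil.
rewrite big_cons /= expnS leq_mul ?h ?inE ?eqxx// IH// => y ys.
by rewrite h// inE ys orbT.
Qed.

Lemma dvdn_prod_seq (T : eqType) (s : seq T) (F : T -> nat) x :
  x \in s -> F x %| \prod_(y <- s) F y.
Proof. by move=> xs; rewrite (perm_big _ (perm_to_rem xs)) big_cons dvdn_mulr. Qed.

(* The product of the differences of J is smaller than the least common
   multiple of the admissible moduli, so some modulus does not divide it. *)
Lemma modn_separates (J : seq nat) n lg : uniq J -> 0 < size J -> 0 < lg ->
  n <= 2 ^ lg -> {in J, forall x, x < n} ->
  exists2 q, q < 2 * (size J * size J * lg) & uniq [seq x %% q.+1 | x <- J].
Proof.
move=> uJ; set k := size J => k0 lg0 nlg Jn; set m := k * k * lg.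
have m0 : 0 < m by rewrite !muln_gt0 k0 lg0.
case: (boolP (has (fun q => uniq [seq x %% q.+1 | x <- J]) (iota 0 (2 * m)))).
  by move=> /hasP[q]; rewrite mem_iota => /andP[_ h] hq; exists q.
move=> /hasPn noq.
pose dist x y := (x - y) + (y - x).
pose d := \prod_(x <- J) \prod_(y <- rem x J) dist x y.
have mem_rem_neq x y : y \in rem x J -> x != y.
  by rewrite mem_rem_uniq// !inE eq_sym => /andP[].
have d0 : 0 < d.
  rewrite /d big_seq; apply: prodn_cond_gt0 => x xJ.
  rewrite big_seq; apply: prodn_cond_gt0 => y /mem_rem_neq.
  by rewrite /dist; lia.
have : 2 ^ m <= d.
  apply: lcm_lower => // q /andP[q0 qm].
  have /noq : q.-1 \in iota 0 (2 * m) by rewrite mem_iota; lia.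
  rewrite prednK// => /uniqPn - /(_ 0)[i [j [ij]]]; rewrite size_map => jk.
  have ik : i < k by apply: ltn_trans ij jk.
  rewrite !(nth_map 0)// => e.
  have xJ := mem_nth 0 ik; have yJ := mem_nth 0 jk.
  set x := nth 0 J i in e xJ *; set y := nth 0 J j in e yJ *.
  have xy : x != y by rewrite nth_uniq//; lia.
  apply: (@dvdn_trans (dist x y)); last first.
    apply: (@dvdn_trans (\prod_(y <- rem x J) dist x y)); last first.
      exact: (@dvdn_prod_seq _ J (fun x => \prod_(y <- rem x J) dist x y)).
    by apply: (@dvdn_prod_seq _ _ (dist x)); rewrite mem_rem_uniq// !inE eq_sym xy.
  rewrite /dist; case: (leqP x y) => h.
    have -> : x - y = 0 by lia.
    by rewrite add0n -eqn_mod_dvd//; apply/eqP.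
  have -> : y - x = 0 by lia.
  by rewrite addn0 -eqn_mod_dvd ?(ltnW h)//; apply/eqP.
(* There are [k * (k - 1)] ordered pairs, each at distance at most [2 ^ lg]; the exponent
   [lg * k * (k - 1)] stays below [m = k * k * lg]. *)
have : d <= ((2 ^ lg) ^ k.-1) ^ k.
  apply: leq_prod_const => x xJ; rewrite -(size_rem xJ).
  apply: leq_prod_const => y /mem_rem yJ.
  by apply: leq_trans _ nlg; have := Jn _ xJ; have := Jn _ yJ; rewrite /dist; lia.
rewrite -!expnM => h1 h2; have := leq_trans h2 h1.
rewrite leq_exp2l// /m; clear -k0 lg0; case: k k0 => // k _ /=.
by nia.
Qed.

End Separation.

(** * Tuples coded by the digits of a number *)

Section Digits.
Local Open Scope nat_scope.

Definition dig (b u l : nat) : nat := (u %/ b ^ l) %% b.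

Definition digs (b len u : nat) : seq nat := mkseq (dig b u) len.

Lemma dig_lt b u l : 0 < b -> dig b u l < b.
Proof. exact: ltn_pmod. Qed.

Lemma digs_lt b len u : 0 < b -> {in digs b len u, forall x, x < b}.
Proof. by move=> b0 x /mapP[l _ ->]; apply: dig_lt. Qed.

(** The first entry is the lowest digit. A loop over the numbers below [b ^ len] thus meets every
    tuple of length [len]. *)
Lemma digs_surj b (s : seq nat) : {in s, forall x, x < b} ->
  exists2 u, u < b ^ size s & digs b (size s) u = s.
Proof.
elim: s => [|x s IH] h; first by exists 0.
have [y ys|u ub e] := IH; first by rewrite h// inE ys orbT.
have xb : x < b by rewrite h// inE eqxx.
have b0 : 0 < b by lia.
exists (x + u * b).
  rewrite /= expnS; apply: leq_trans (_ : u.+1 * b <= _); first by lia.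
  by rewrite mulnC leq_mul2l ub orbT.
rewrite -{2}e /digs /mkseq /= -[1]addn0 iotaDl -map_comp.
congr (_ :: _).
  by rewrite /dig expn0 divn1 addnC modnMDl modn_small.
apply: eq_map => l /=; rewrite /dig add1n expnS divnMA divnDMl//.
by rewrite [x %/ b]divn_small// add0n.
Qed.

End Digits.

(** * Greedy perfect hash families *)

Section Greedy.
Local Open Scope nat_scope.
Variables (N kk : nat).
Hypotheses (N_gt0 : 0 < N) (kk_gt0 : 0 < kk).

(** If [size s = kk], this is [kk ^ kk] times the probability that [s] becomes a
    tuple of distinct colours when its entries that are at least [kk], which stand for points
    without a colour, are replaced by independent uniform colours. *)
Definition wgt (s : seq nat) : nat :=
  uniq s * ((count (leq kk) s)`! * kk ^ count (gtn kk) s).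

Definition fset (H : nat -> nat) (y c : nat) : nat -> nat :=
  fun z => if z == y then c else H z.

(** Divided by [kk ^ kk], this is the expected number of tuples of [U] that become injective when
    the points without a colour are coloured at random. *)
Definition potential (U : nat -> bool) (H : nat -> nat) : nat :=
  \sum_(0 <= u < N ^ kk) U u * wgt [seq H y | y <- digs N kk u].

(** Unassigned points carry pairwise distinct dummy colours, all at least
    [kk], so that a collision of genuine colours and a repetition in the tuple
    are both detected by [uniq]. *)
Definition partial (H : nat -> nat) (y : nat) : Prop :=
  (forall z, z < y -> H z < kk) /\ (forall z, y <= z -> H z = kk + z).

Lemma wgt_perm s t : perm_eq s t -> wgt s = wgt t.
Proof.
by move=> st; rewrite /wgt (perm_uniq st) !(permP st).
Qed.

Lemma wgt_le s : size s <= kk -> wgt s <= kk ^ size s.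
Proof.
move=> sk; rewrite /wgt -(count_predC (leq kk) s) expnD.
have -> : count (predC (leq kk)) s = count (gtn kk) s.
  by apply: eq_count => z /=; rewrite ltnNge.
case: (uniq s); rewrite ?mul0n// mul1n; apply: leq_mul => //.
have : count (leq kk) s <= kk.
  by apply: leq_trans sk; exact: count_size.
by elim: (count _ _) => [//|e IH] h; rewrite factS expnS leq_mul// IH// ltnW.
Qed.

Lemma count_free (t : seq nat) : uniq t ->
  \sum_(c <- iota 0 kk) (c \notin t) = kk - count (gtn kk) t.
Proof.
move=> ut; have <- : count [in t] (iota 0 kk) = count (gtn kk) t.
  rewrite -!size_filter; apply: perm_size; apply: uniq_perm.
  - by rewrite filter_uniq// iota_uniq.
  - by rewrite filter_uniq.
  - by move=> c; rewrite !mem_filter mem_iota add0n leq0n /= andbC.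
have := count_predC [in t] (iota 0 kk); rewrite size_iota.
have -> : \sum_(c <- iota 0 kk) (c \notin t) = count (predC [in t]) (iota 0 kk).
  by rewrite -sum1_count [RHS]big_mkcond /=; apply: eq_bigr => c _; case: (c \in t).
by lia.
Qed.

(** Total probability over the colour of [y]. If [y] occurs in [s], it replaces a dummy. Let the
    other [kk - 1] entries contain [e] dummies: if their genuine colours are distinct, exactly
    [e + 1] colours are free for [y], and [(e + 1) * e!] is the factorial on the right. *)
Lemma wgt_average H y s : partial H y -> size s = kk ->
  \sum_(c <- iota 0 kk) wgt [seq fset H y c z | z <- s] =
  kk * wgt [seq H z | z <- s].
Proof.
move=> [Hlt Hge] sk; case: (boolP (uniq s)) => us; last first.
  have nu (f : nat -> nat) : uniq (map f s) = false.
    by apply/negbTE; apply: contra us; apply: map_uniq.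
  by rewrite /wgt nu mul0n muln0 big1// => c _; rewrite nu.
case: (boolP (y \in s)) => ys; last first.
  rewrite (eq_bigr (fun=> wgt [seq H z | z <- s])).
    by rewrite big_const_seq count_predT size_iota iter_addn_0 mulnC.
  move=> c _; congr wgt; apply/eq_in_map => z zs; rewrite /fset.
  by case: eqP => // e; rewrite -e zs in ys.
have P (f : nat -> nat) := perm_map f (perm_to_rem ys).
have yr : y \notin rem y s by rewrite mem_rem_uniq// !inE eqxx.
set s' := rem y s in P yr; pose t := [seq H z | z <- s'].
rewrite (wgt_perm (P H)) /= (Hge y)//.
rewrite (eq_bigr (fun c => wgt (c :: t))); last first.
  move=> c _; rewrite (wgt_perm (P (fset H y c))) /= /fset eqxx.
  congr (wgt (_ :: _)); apply/eq_in_map => z zs.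
  by case: eqP => // e; rewrite -e zs in yr.
have kyt : kk + y \notin t.
  apply/mapP => -[z zs]; case: (ltnP z y) => h; first by have := Hlt z h; lia.
  by rewrite Hge// => e; have ez : y = z by [lia]; rewrite ez zs in yr.
have st : (size t).+1 = kk.
  by rewrite size_map size_rem// prednK ?sk.
have cc := count_predC (leq kk) t.
have eqc : count (predC (leq kk)) t = count (gtn kk) t.
  by apply: eq_count => z /=; rewrite ltnNge.
rewrite eqc in cc.
rewrite big_seq (eq_bigr (fun c => (c \notin t) *
    (uniq t * ((count (leq kk) t)`! * kk ^ (count (gtn kk) t).+1)))); last first.
  move=> c; rewrite mem_iota add0n => /andP[_ ck]; rewrite /wgt /=.
  rewrite ck leqNgt ck /= add0n add1n.
  by rewrite [RHS]mulnA mulnb.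
rewrite -big_seq -big_distrl /= /wgt /= kyt leq_addr ltnNge leq_addr /= add0n add1n.
case: (boolP (uniq t)) => ut; last by rewrite !mul0n !muln0.
rewrite count_free// factS.
have -> : kk - count (gtn kk) t = (count (leq kk) t).+1 by lia.
by rewrite expnS; ring.
Qed.

Lemma potential_average U H y : partial H y ->
  \sum_(c <- iota 0 kk) potential U (fset H y c) = kk * potential U H.
Proof.
move=> pH; rewrite /potential exchange_big big_distrr /=.
apply: eq_bigr => u _; rewrite -big_distrr /= wgt_average ?size_mkseq//.
by rewrite mulnCA.
Qed.

(** A colour of largest potential does at least as well as the average over all [kk] colours. *)
Lemma potential_best U H y b : partial H y ->
  (forall c, c < kk -> potential U (fset H y c) <= potential U (fset H y b)) ->
  potential U H <= potential U (fset H y b).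
Proof.
move=> pH hb; rewrite -(leq_pmul2l kk_gt0) -(potential_average U pH).
rewrite big_seq; apply: leq_trans (_ : \sum_(c <- iota 0 kk | c \in iota 0 kk)
    potential U (fset H y b) <= _).
  by apply: leq_sum => c; rewrite mem_iota => /andP[_ h]; apply: hb.
by rewrite -big_seq big_const_seq count_predT size_iota iter_addn_0 mulnC.
Qed.

Lemma partial_fset H y b : b < kk -> partial H y -> partial (fset H y b) y.+1.
Proof.
move=> bk [h1 h2]; split=> z hz; rewrite /fset; case: eqP => // e.
- by apply: h1; lia.
- by lia.
- by apply: h2; lia.
Qed.

Definition uncovered (U : nat -> bool) : nat :=
  \sum_(0 <= u < N ^ kk) (U u && uniq (digs N kk u)).

(** Just above [kk ^ kk / kk!], the inverse of the probability that a random function is injective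
    on [kk] points. A greedy round covers at least the fraction [1 / rounds_unit] of the remaining
    tuples. *)
Definition rounds_unit : nat := (kk ^ kk %/ kk`!).+1.

Lemma potential_dummy U : potential U (fun y => kk + y) = uncovered U * kk`!.
Proof.
rewrite /potential /uncovered big_distrl /=; apply: eq_bigr => u _.
rewrite /wgt map_inj_uniq; last by move=> a b /addnI.
have -> : count (leq kk) [seq kk + y | y <- digs N kk u] = kk.
  rewrite (eq_in_count (a2 := predT)) ?count_predT ?size_map ?size_iota//.
  by move=> z /mapP[w _ ->]; rewrite leq_addr.
have -> : count (gtn kk) [seq kk + y | y <- digs N kk u] = 0.
  rewrite (eq_in_count (a2 := pred0)) ?count_pred0//.
  by move=> z /mapP[w _ ->]; rewrite /= ltnNge leq_addr.
by rewrite muln1 mulnA mulnb.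
Qed.

Lemma wgt_total H u : (forall y, y < N -> H y < kk) ->
  wgt [seq H y | y <- digs N kk u] =
  uniq [seq H y | y <- digs N kk u] * kk ^ kk.
Proof.
move=> hH; rewrite /wgt; congr muln.
have -> : count (leq kk) [seq H y | y <- digs N kk u] = 0.
  rewrite (eq_in_count (a2 := pred0)) ?count_pred0//.
  by move=> z /mapP[w /(digs_lt N_gt0) wN ->]; rewrite /= leqNgt hH.
have -> : count (gtn kk) [seq H y | y <- digs N kk u] = kk.
  rewrite (eq_in_count (a2 := predT)) ?count_predT ?size_map ?size_iota//.
  by move=> z /mapP[w /(digs_lt N_gt0) wN ->]; rewrite /= hH.
by rewrite fact0 mul1n.
Qed.

(** Once all points are coloured, the potential is [kk ^ kk] times the number of newly covered
    tuples, and by assumption it is at least its initial value [uncovered U * kk!]. The resulting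
    fraction is stated without denominators. *)
Lemma uncovered_round U H : (forall y, y < N -> H y < kk) ->
  potential U (fun y => kk + y) <= potential U H ->
  rounds_unit * uncovered (fun u => U u && (wgt [seq H y | y <- digs N kk u] == 0))
  <= rounds_unit.-1 * uncovered U.
Proof.
move=> hH; rewrite potential_dummy => hp.
set U' := fun u => _.
pose cov := \sum_(0 <= u < N ^ kk) (U u && uniq [seq H y | y <- digs N kk u]).
have kkkk : 0 < kk ^ kk by rewrite expn_gt0 kk_gt0.
have split_cov : uncovered U = uncovered U' + cov.
  rewrite /uncovered /cov -big_split /=; apply: eq_bigr => u _; rewrite /U'.
  rewrite wgt_total// muln_eq0 -(negbK (kk ^ kk == 0)) -lt0n kkkk orbF eqb0.
  case: (U u) => //=; case: (boolP (uniq [seq H y | y <- _])) => h /=; last by rewrite addn0.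
  by rewrite (map_uniq h).
have potE : potential U H = cov * kk ^ kk.
  rewrite /potential /cov big_distrl; apply: eq_bigr => u _ /=.
  by rewrite wgt_total// mulnA mulnb.
rewrite potE in hp.
have fk : 0 < kk`! by exact: fact_gt0.
have h1 : kk ^ kk <= rounds_unit * kk`!.
  by rewrite /rounds_unit mulSn addnC {1}(divn_eq (kk ^ kk) kk`!) leq_add2l ltnW ?ltn_pmod.
have h2 : uncovered U <= cov * rounds_unit.
  rewrite -(leq_pmul2r fk); apply: leq_trans hp _.
  by rewrite -mulnA leq_mul2l h1 orbT.
move: h2; rewrite split_cov /rounds_unit /=; set q := _ %/ _.
by rewrite mulnS; lia.
Qed.

(** Bernoulli's inequality: the first two terms in the expansion of [(d + 1) ^ (d + 1)] already
    suffice. *)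
Lemma bernoulli_half d : 2 * d ^ d.+1 <= d.+1 ^ d.+1.
Proof.
have : forall e, d ^ e + e * d ^ e.-1 <= d.+1 ^ e.
  elim=> [|e IH]; first by [].
  rewrite [X in _ <= X]expnS; apply: leq_trans (leq_mul (leqnn d.+1) IH).
  by case: e {IH} => [|e]; rewrite /= ?expn0 ?expn1 ?expnS; nia.
by move=> /(_ d.+1) /=; rewrite expnS; lia.
Qed.

(** Every [rounds_unit] rounds at least halve the number of uncovered tuples, so after [s] such
    phases at most [N ^ kk / 2 ^ s < 1] of them remain. *)
Lemma rounds_suffice s a : N ^ kk < 2 ^ s ->
  rounds_unit ^ (rounds_unit * s) * a <= rounds_unit.-1 ^ (rounds_unit * s) * N ^ kk ->
  a = 0.
Proof.
rewrite /rounds_unit /=; set d := _ %/ _ => Ns.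
have d0 : 0 < d.
  rewrite divn_gt0 ?fact_gt0//.
  have fact_le e : e <= kk -> e`! <= kk ^ e.
    by elim: e => [//|e IH] h; rewrite factS expnS leq_mul// IH// ltnW.
  exact: fact_le.
have h : 2 ^ s * d ^ (d.+1 * s) <= d.+1 ^ (d.+1 * s).
  rewrite !(expnM _ d.+1) -expnMn; case: s {Ns} => [//|s].
  by rewrite leq_exp2r// bernoulli_half.
move=> h2; have : 2 ^ s * d ^ (d.+1 * s) * a <= d ^ (d.+1 * s) * N ^ kk.
  by apply: leq_trans h2; rewrite leq_mul2r h orbT.
rewrite [2 ^ s * _]mulnC -mulnA leq_pmul2l ?expn_gt0 ?d0// => h3.
case: a h2 h3 => // a _; rewrite mulnS => h3.
by have := leq_trans (leq_addr _ _) h3; rewrite leqNgt Ns.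
Qed.

Lemma uncovered0 U : uncovered U = 0 ->
  forall u, u < N ^ kk -> uniq (digs N kk u) -> ~~ U u.
Proof.
rewrite /uncovered => /eqP; rewrite big_mkord sum_nat_eq0 => /forallP h u uN du.
by have := h (Ordinal uN); rewrite /= du andbT eqb0.
Qed.

End Greedy.

(** * Colourings from a modulus, block boundaries and a hash family *)

Section Colouring.
Local Open Scope nat_scope.

(** The family is stored as a table, row by row: entry [r * N + y] is the value of function [r] at
    [y]. *)
Definition perfect_family (N kk L : nat) (FT : nat -> nat) : Prop :=
  forall s, size s = kk -> uniq s -> {in s, forall y, y < N} ->
  exists2 r, r < L & uniq [seq FT (r * N + y) | y <- s].

Lemma perfect_family_tuples N kk L FT :
  (forall u, u < N ^ kk -> uniq (digs N kk u) ->
     exists2 r, r < L & uniq [seq FT (r * N + y) | y <- digs N kk u]) ->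
  perfect_family N kk L FT.
Proof.
move=> h s sk us sN; have [u] := digs_surj sN; rewrite sk => uN e.
by have [|r rL] := h u uN; rewrite e// => hr; exists r.
Qed.

(** The digits of [t1] in base [N] are the boundaries between the blocks of
    residues, and those of [t2] in base [L] select the row of the hash family
    [FT] that colours each block. *)
Definition block (N B t1 y : nat) : nat :=
  count (fun l => dig N t1 l <= y) (iota 0 B.-1).

Definition colour (N B kk L : nat) (FT : nat -> nat) (q t1 t2 j : nat) : nat :=
  let y := j %% q.+1 in
  let b := block N B t1 y in b * kk + FT (dig L t2 b * N + y).

Lemma block_le N B t1 y : block N B t1 y <= B.-1.
Proof. by rewrite -[X in _ <= X](size_iota 0) count_size. Qed.

Lemma colour_lt N B kk L FT q t1 t2 j : 0 < B -> 0 < L ->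
  (forall i, i < L * N -> FT i < kk) -> q < N ->
  colour N B kk L FT q t1 t2 j < B * kk.
Proof.
move=> B0 L0 FTk qN; rewrite /colour /=; set y := j %% q.+1; set b := block _ _ _ _.
have yN : y < N by apply: leq_trans qN; rewrite ltn_pmod.
have bB : b < B by have := block_le N B t1 y; rewrite -/b; lia.
have dL : dig L t2 b < L by exact: dig_lt.
have ixN : dig L t2 b * N + y < L * N.
  apply: (@leq_trans ((dig L t2 b).+1 * N)); last by rewrite leq_mul2r dL orbT.
  by rewrite mulSn addnC ltn_add2r.
apply: (@leq_trans (b.+1 * kk)); last by rewrite leq_mul2r bB orbT.
by rewrite mulSn addnC ltn_add2r FTk.
Qed.

Lemma count_ltn_iota b n : b <= n -> count (fun l => l < b) (iota 0 n) = b.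
Proof.
move=> bn; rewrite -(subnKC bn) iotaD count_cat add0n.
rewrite (eq_in_count (a2 := predT)); last by move=> l; rewrite mem_iota => /andP[].
rewrite count_predT size_iota (eq_in_count (a2 := pred0)) ?count_pred0 ?addn0//.
by move=> l; rewrite mem_iota => /andP[h _]; apply/negbTE; rewrite -leqNgt.
Qed.

(** The residues of [J] are padded to exactly [K] points and sorted. Consecutive groups of [kk]
    points form the blocks, and the family has a row that is injective on each group. The padding
    gives every group the full size that [perfect_family] demands. *)
Lemma colour_exists N B kk L FT (J : seq nat) q :
  0 < B -> 0 < kk -> 0 < N ->
  perfect_family N kk L FT ->
  (forall r y, r < L -> y < N -> FT (r * N + y) < kk) ->
  uniq [seq x %% q.+1 | x <- J] -> q < N -> size J <= B * kk -> B * kk <= N ->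
  exists t1 t2, [/\ t1 < N ^ B.-1, t2 < L ^ B &
    uniq [seq colour N B kk L FT q t1 t2 j | j <- J]].
Proof.
move=> B0 kk0 N0 PF FTk; set X := map _ J => uX qN sJ KN; set K := B * kk in sJ KN.
have XN : {in X, forall x, x < N}.
  by move=> x /mapP[j _ ->]; rewrite (leq_trans (ltn_pmod j (ltn0Sn q))).
have sX : size X = size J by rewrite size_map.
(* Since [B * kk <= N], enough residues are left for the padding. *)
pose Y := [seq y <- iota 0 N | y \notin X].
have sY : K - size X <= size Y.
  rewrite size_filter; have := count_predC [in X] (iota 0 N); rewrite size_iota.
  have : count [in X] (iota 0 N) <= size X.
    rewrite -size_filter; apply: uniq_leq_size.
      by rewrite filter_uniq// iota_uniq.
    by move=> x; rewrite mem_filter => /andP[].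
  have -> : count (predC [in X]) (iota 0 N) = count (fun y => y \notin X) (iota 0 N).
    by apply: eq_count.
  by lia.
pose Z := X ++ take (K - size X) Y.
have uZ : uniq Z.
  rewrite cat_uniq uX take_uniq ?filter_uniq ?iota_uniq// andbT /=.
  by apply/hasPn => x /mem_take; rewrite mem_filter => /andP[].
have sZ : size Z = K by rewrite size_cat size_takel// subnKC// sX.
have ZN : {in Z, forall x, x < N}.
  move=> x; rewrite mem_cat => /orP[/XN//|/mem_take].
  by rewrite mem_filter mem_iota => /and3P[].
pose xs := sort leq Z.
have sxs : size xs = K by rewrite size_sort.
have uxs : uniq xs by rewrite sort_uniq.
have xsN : {in xs, forall x, x < N} by move=> x; rewrite mem_sort => /ZN.
have srt : sorted ltn xs.
  by rewrite ltn_sorted_uniq_leq uxs sort_sorted//; exact: leq_total.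
have xs_lt i j : j < K -> i < j -> nth 0 xs i < nth 0 xs j.
  move=> jK ij; apply: (sorted_ltn_nth ltn_trans 0 srt); rewrite ?inE ?sxs//.
  exact: ltn_trans ij jK.
have xs_le i j : i < K -> j < K -> (nth 0 xs i <= nth 0 xs j) = (i <= j).
  move=> iK jK; case: (leqP i j) => h.
    move: h; rewrite leq_eqVlt => /orP[/eqP->|h]; first by rewrite leqnn.
    by rewrite ltnW// xs_lt.
  by apply/negbTE; rewrite -ltnNge xs_lt.
(* The boundaries are the first points of all blocks but the first, hence [B.-1] digits. *)
have [t1] : exists2 t1, t1 < N ^ B.-1 &
    digs N B.-1 t1 = mkseq (fun l => nth 0 xs (l.+1 * kk)) B.-1.
  rewrite -{1 2}(size_mkseq (fun l => nth 0 xs (l.+1 * kk)) B.-1).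
  apply: digs_surj => x /mapP[l]; rewrite mem_iota => /andP[_ lB] ->.
  by apply/xsN/mem_nth; rewrite sxs /K ltn_pmul2r//; lia.
move=> t1N t1E.
have blk i : i < K -> block N B t1 (nth 0 xs i) = i %/ kk.
  move=> iK; rewrite /block -(@count_ltn_iota (i %/ kk) B.-1); last first.
    by rewrite -ltnS prednK// ltn_divLR.
  apply: eq_in_count => l; rewrite mem_iota => /andP[_ lB].
  have -> : dig N t1 l = nth 0 xs (l.+1 * kk).
    have := congr1 (fun s => nth 0 s l) t1E.
    by rewrite /digs !nth_mkseq.
  rewrite xs_le//; last by rewrite /K ltn_pmul2r//; lia.
  by rewrite leq_divRL.
pose blockseq b := take kk (drop (b * kk) xs).
pose row b := find (fun r => uniq [seq FT (r * N + y) | y <- blockseq b]) (iota 0 L).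
have rowP b : b < B -> row b < L /\ uniq [seq FT (row b * N + y) | y <- blockseq b].
  move=> bB; have [||x|r rL ur] := PF (blockseq b).
  - rewrite size_takel// size_drop sxs /K.
    by have := leq_mul bB (leqnn kk); rewrite mulSn; lia.
  - by rewrite take_uniq// drop_uniq.
  - by move=> /mem_take/mem_drop/xsN.
  have hs : has (fun r => uniq [seq FT (r * N + y) | y <- blockseq b]) (iota 0 L).
    by apply/hasP; exists r; rewrite ?mem_iota.
  have rL' : row b < L by move: hs; rewrite has_find size_iota.
  by split=> //; have := nth_find 0 hs; rewrite nth_iota.
have [t2] : exists2 t2, t2 < L ^ B & digs L B t2 = mkseq row B.
  rewrite -{1 2}(size_mkseq row B); apply: digs_surj => x /mapP[b].
  by rewrite mem_iota => /andP[_ bB] ->; have [] := rowP b bB.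
move=> t2L t2E.
have t2d b : b < B -> dig L t2 b = row b.
  move=> bB; have := congr1 (fun s => nth 0 s b) t2E.
  by rewrite /digs !nth_mkseq.
exists t1, t2; split=> //.
pose col y := let b := block N B t1 y in b * kk + FT (dig L t2 b * N + y).
have -> : [seq colour N B kk L FT q t1 t2 j | j <- J] = [seq col y | y <- X].
  by rewrite /X -map_comp.
rewrite map_inj_in_uniq// => x x' xX x'X.
have inxs z : z \in X -> exists2 i, i < K & nth 0 xs i = z.
  move=> zX; have zx : z \in xs by rewrite mem_sort mem_cat zX.
  by exists (index z xs); rewrite ?nth_index// -sxs index_mem.
have [[i iK <-] [i' i'K <-]] := (inxs _ xX, inxs _ x'X).
have bl z : z < K -> z %/ kk < B by move=> zK; rewrite ltn_divLR.
have FTs z : z < K -> FT (row (z %/ kk) * N + nth 0 xs z) < kk.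
  move=> zK; apply: FTk; first by have [] := rowP _ (bl z zK).
  by apply/xsN/mem_nth; rewrite sxs.
rewrite /col !blk// !t2d ?bl// => e.
(* The values of [FT] are below [kk], so dividing a colour by [kk] recovers the block. *)
have eb : i %/ kk = i' %/ kk.
  have := congr1 (divn^~ kk) e.
  by rewrite !divnMDl// !(divn_small (FTs _ _))// !addn0.
have ef : FT (row (i %/ kk) * N + nth 0 xs i) =
          FT (row (i %/ kk) * N + nth 0 xs i').
  by move: e; rewrite -eb => /addnI.
have [_ ur] := rowP _ (bl i iK).
have mb z : z < K -> z %/ kk = i %/ kk -> nth 0 xs z \in blockseq (i %/ kk).
  move=> zK ez; have zm : z %% kk < kk by rewrite ltn_pmod.
  have -> : nth 0 xs z = nth 0 (blockseq (i %/ kk)) (z %% kk).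
    by rewrite nth_take// nth_drop -ez -divn_eq.
  apply: mem_nth; rewrite size_takel// size_drop sxs /K.
  by have := leq_mul (bl i iK) (leqnn kk); rewrite mulSn; lia.
have mi := mb i iK erefl; have mi' := mb i' i'K (esym eb).
set s := blockseq _ in mi mi' ur.
have [si si'] : index (nth 0 xs i) s < size s /\ index (nth 0 xs i') s < size s.
  by rewrite !index_mem.
suff e2 : index (nth 0 xs i) s = index (nth 0 xs i') s.
  by rewrite -(nth_index 0 mi) e2 nth_index.
apply/eqP; rewrite -(nth_uniq 0 _ _ ur) ?size_map//.
by rewrite !(nth_map 0)// !nth_index//; apply/eqP.
Qed.

End Colouring.

(** * Dynamic programming over sets of colours *)

Section Bits.
Local Open Scope nat_scope.

(** Adding an absent power of two causes no carry; halving both numbers reduces the claim to the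
    lowest bit. *)
Lemma bit_add c M c' : ~~ odd (M %/ 2 ^ c) ->
  odd ((M + 2 ^ c) %/ 2 ^ c') = (c' == c) || odd (M %/ 2 ^ c').
Proof.
elim: c M c' => [|c IH] M [|c']; rewrite ?expn0 ?divn1.
- by rewrite addn1 /= => ->.
- by move=> Me; rewrite expnS !divnMA; congr (odd (_ %/ _)); lia.
- by move=> _; rewrite oddD expnS oddM /= addbF.
- by rewrite !expnS !divnMA => /IH <-; congr (odd (_ %/ _)); lia.
Qed.

Lemma bit_sub c M : odd (M %/ 2 ^ c) ->
  [/\ 2 ^ c <= M & ~~ odd ((M - 2 ^ c) %/ 2 ^ c)].
Proof.
move=> h; have c0 : 0 < 2 ^ c by rewrite expn_gt0.
have cM : 2 ^ c <= M.
  by rewrite leqNgt; apply/negP => l; rewrite divn_small in h.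
split=> //; move: h; rewrite -{1}(subnK cM) -{2}(mul1n (2 ^ c)) divnDMl//.
by rewrite addn1.
Qed.

Lemma bit_sub_imp c c' M : odd (M %/ 2 ^ c) ->
  odd ((M - 2 ^ c) %/ 2 ^ c') -> odd (M %/ 2 ^ c').
Proof.
by move=> /bit_sub[h1 h2] h; rewrite -(subnK h1) bit_add// h orbT.
Qed.

Definition mask (s : seq nat) : nat := \sum_(c <- s) 2 ^ c.

Lemma bit_mask s c : uniq s -> odd (mask s %/ 2 ^ c) = (c \in s).
Proof.
elim: s c => [|x s IH] c; first by rewrite /mask big_nil div0n.
move=> /= /andP[xs us]; rewrite /mask big_cons addnC bit_add.
  by rewrite -/(mask s) IH// inE.
by rewrite -/(mask s) IH.
Qed.

Lemma mask_lt s K : uniq s -> {in s, forall c, c < K} -> mask s < 2 ^ K.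
Proof.
elim: K s => [|K IH] s us sK.
  by case: s us sK => [|x s] _ h; [rewrite /mask big_nil | have := h x; rewrite inE eqxx => /(_ isT)].
have h t : uniq t -> K \notin t -> {in t, forall c, c < K.+1} -> mask t < 2 ^ K.
  move=> ut Kt tK; apply: IH => // c ct; have := tK c ct.
  by rewrite ltnS leq_eqVlt => /orP[/eqP e|//]; rewrite -e ct in Kt.
case: (boolP (K \in s)) => Ks; last first.
  by apply: ltn_trans (h s us Ks sK) _; rewrite ltn_exp2l.
rewrite /mask (perm_big _ (perm_to_rem Ks)) big_cons expnS.
have := h (rem K s); rewrite rem_uniq// mem_rem_uniq// !inE eqxx /= => /(_ isT isT).
by rewrite mul2n -addnn ltn_add2l; apply=> c /mem_rem/sK.
Qed.

Variables (K : nat) (C : nat -> nat).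
Hypothesis C0 : C 0 = 0.
Hypothesis CS : forall S, S < 2 ^ K -> C S = C (S %/ 2) + odd S.

(** [C] is known only through its recursion, which is what the program guarantees for its table of
    bit counts. *)
Lemma popcount_add c M : ~~ odd (M %/ 2 ^ c) -> M + 2 ^ c < 2 ^ K ->
  C (M + 2 ^ c) = (C M).+1.
Proof.
elim: c M => [|c IH] M; rewrite ?expn0 ?divn1.
  move=> Me l; rewrite addn1 in l *; rewrite CS// [in RHS]CS ?(ltnW l)//=.
  have -> : M.+1 %/ 2 = M %/ 2 by lia.
  by rewrite (negbTE Me) addn0 addn1.
move=> h l; rewrite CS// [in RHS]CS; last by apply: leq_ltn_trans l; lia.
have -> : (M + 2 ^ c.+1) %/ 2 = M %/ 2 + 2 ^ c by rewrite expnS; lia.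
have -> : odd (M + 2 ^ c.+1) = odd M by rewrite expnS oddD oddM /= addbF.
rewrite IH //; first by move: h; rewrite expnS divnMA.
by move: l; rewrite expnS; lia.
Qed.

Lemma popcount_mask s : uniq s -> {in s, forall c, c < K} -> C (mask s) = size s.
Proof.
elim: s => [|x s IH] /=; first by rewrite /mask big_nil.
move=> /andP[xs us] sK.
have e : mask (x :: s) = mask s + 2 ^ x by rewrite /mask big_cons addnC.
rewrite e popcount_add ?IH//.
- by move=> c cs; rewrite sK// inE cs orbT.
- by rewrite bit_mask.
- by rewrite -e; apply: mask_lt => //=; rewrite xs us.
Qed.

End Bits.

Section DynamicProgram.
Variables (r d : nat -> int) (p : nat -> nat -> int) (col : nat -> nat).
Variables (n : nat) (low cm : int).

(** [feas i S t]: some jobs whose colours are the bits of [S] can be processed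
    on the first [i] machines, with machine [i.-1] free again at time [t]. *)
Inductive feas : nat -> nat -> int -> Prop :=
| feas_empty : feas 0 0 low
| feas_machine i S t : feas i S t -> feas i.+1 S low
| feas_job i S j t : (j < n)%N -> odd (S %/ 2 ^ col j) ->
    feas i.+1 (S - 2 ^ col j)%N t ->
    Num.max t (r j) + p i j <= d j -> Num.max t (r j) + p i j <= cm ->
    feas i.+1 S (Num.max t (r j) + p i j).

(** The value [cm + 1] stands for infeasibility. *)
Definition is_min (i S : nat) (v : int) : Prop :=
  [/\ v <= cm + 1, v <= cm -> feas i S v & forall t, feas i S t -> v <= t].

End DynamicProgram.

(** * Equivalence of the recursion with schedules *)

Section Schedules.
Import mathcomp.boot.fintype mathcomp.boot.finset.
Variables (R : realType) (I : sched_instance).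
Variables (r d : nat -> int) (p : nat -> nat -> int) (col : nat -> nat) (low : int).
Hypothesis rE : forall j : 'I_(jobs I), r j = release j.
Hypothesis dE : forall j : 'I_(jobs I), d j = deadline j.
Hypothesis pE : forall (i : 'I_(machines I)) (j : 'I_(jobs I)),
  p i j = (ptime i j)%:Z.
Hypothesis low_cm : low <= cmax I.
Hypothesis low_r : forall j, (j < jobs I)%N -> low <= r j.

Local Notation feas := (feas r d p col (jobs I) low (cmax I)).
Let toR (z : int) : R := z%:~R.

(** Each job is appended to the last machine in use, at time [Num.max t (r j)]. Its colour is absent
    from the remaining set, so the job is new and the size of the selection follows the number of
    bits. The last clause, on the times when machine [i.-1] is busy, excludes overlaps. *)
Lemma feas_sound (K : nat) (C : nat -> nat) (C0 : C 0 = 0%N)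
    (CS : forall S, (S < 2 ^ K)%N -> C S = (C (S %/ 2) + odd S)%N) i S t :
  feas i S t -> (i <= machines I)%N -> (S < 2 ^ K)%N ->
  exists s : schedule R I,
    [/\ valid_schedule s, makespan_le s (toR (cmax I)), #|selected s| = C S,
        (forall j, isSome (s j) -> odd (S %/ 2 ^ col j)) &
        forall j (mi : 'I_(machines I)) x, s j = Some (mi, x) ->
          (mi < i)%N /\ (mi.+1 = i -> x + (ptime mi j)%:R <= toR t)].
Proof.
elim=> {i S t} [|i S t _ IH|i S j t jn Sj _ IH td tc] im SK.
- exists (fun=> None); split=> //.
  by rewrite C0; apply: eq_card0 => j; rewrite inE.
- have [s [h1 h2 h3 h4 h5]] := IH (ltnW im) SK.
  exists s; split=> // j mi x e; have [h6 _] := h5 _ _ _ e.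
  by split; [lia | lia].
have [cS nbit] := bit_sub Sj.
have [s [[v1 v2] h2 h3 h4 h5]] := IH im (leq_ltn_trans (leq_subr _ _) SK).
pose jj := Ordinal jn; pose ii := Ordinal im.
have pj : p i j = (ptime ii jj)%:Z by rewrite -pE.
have sj : s jj = None.
  case E : (s jj) => [v|//]; have : isSome (s jj) by rewrite E.
  by move/h4; rewrite (negbTE nbit).
set t' := Num.max t (r j) + p i j in td tc *.
exists (fun j' => if j' == jj then Some (ii, toR (Num.max t (r j))) else s j').
have endE : toR (Num.max t (r j)) + (ptime ii jj)%:R = toR t'.
  by rewrite /toR /t' pj intrD pmulrn.
have busy j' x : s j' = Some (ii, x) -> x + (ptime ii j')%:R <= toR (Num.max t (r j)).
  move=> e; have [_ h] := h5 _ _ _ e; apply: le_trans (h erefl) _.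
  by rewrite /toR ler_int le_max lexx.
split.
- split.
    move=> j' mi x; case: eqP => [->|_]; last exact: v1.
    move=> [<- <-]; rewrite endE -rE -dE /toR !ler_int; split=> //.
    by rewrite le_max lexx orbT.
  move=> j1 j2 mi x1 x2 ne; case: eqP => [e1|_]; case: eqP => [e2|_].
  + by rewrite e1 e2 eqxx in ne.
  + by move=> [<- <-] e; right; apply: busy.
  + by move=> e [e3 e4]; left; rewrite -e4; move: e; rewrite -e3; apply: busy.
  + exact: v2.
- move=> j' mi x; case: eqP => [->|_]; last exact: h2.
  by move=> [<- <-]; rewrite endE /toR ler_int.
- have -> : selected (fun j' => if j' == jj then Some (ii, toR (Num.max t (r j))) else s j')
      = jj |: selected s.
    by apply/setP => j'; rewrite !inE; case: eqP.
  rewrite cardsU1 inE sj /= h3 add1n.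
  by rewrite -(popcount_add C0 CS nbit) ?subnK.
- move=> j'; case: eqP => [->//|_] /h4.
  exact: bit_sub_imp.
- move=> j' mi x; case: eqP => [->|_].
    by move=> [<- <-]; rewrite endE; split=> //=.
  move=> e; have [h6 h7] := h5 _ _ _ e; split=> // em; apply: le_trans (h7 em) _.
  rewrite /toR ler_int /t'; apply: le_trans (_ : Num.max t (r j) <= _).
    by rewrite le_max lexx.
  by rewrite pj; lia.
Qed.

Variable s : schedule R I.
Hypothesis sv : valid_schedule s.
Hypothesis sm : makespan_le s (toR (cmax I)).

(** An unselected job is sent to the nonexistent machine [machines I], so that lying on an actual
    machine implies being selected. *)
Let mach (j : 'I_(jobs I)) : nat :=
  if s j is Some (mi, _) then nat_of_ord mi else machines I.
Let start (j : 'I_(jobs I)) : R := if s j is Some (_, x) then x else 0.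
Let dur (j : 'I_(jobs I)) : R :=
  if s j is Some (mi, _) then (ptime mi j)%:R else 0.

Let cmask (A : {set 'I_(jobs I)}) : nat := (\sum_(j in A) 2 ^ col j)%N.

Let cmaskE A : cmask A = mask [seq col j | j : 'I_(jobs I) <- enum A].
Proof. by rewrite /mask big_map big_enum. Qed.

Let cmask_uniq (A : {set 'I_(jobs I)}) : {in A &, injective (fun j : 'I_(jobs I) => col j)} ->
  uniq [seq col j | j : 'I_(jobs I) <- enum A].
Proof.
move=> h; rewrite map_inj_in_uniq ?enum_uniq// => x y.
by rewrite !mem_enum; apply: h.
Qed.

(** Left shift by induction on [T]. Without its last job, the recursion frees the machine by the
    real time at which that job starts in [s], or at [low]; appended there, the job ends no later
    than in [s]. Comparing with every [tau] above all end times avoids a maximum over [T], and [low]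
    accounts for an empty machine. *)
Let one_machine (A T : {set 'I_(jobs I)}) i : (i < machines I)%N ->
  {in A :|: T &, injective (fun j : 'I_(jobs I) => col j)} ->
  [disjoint A & T] -> {in T, forall j, mach j = i} ->
  (exists t, feas i (cmask A) t) ->
  exists2 t, feas i.+1 (cmask (A :|: T)) t &
    forall tau : R, {in T, forall j, start j + dur j <= tau} ->
      toR t <= Num.max (toR low) tau.
Proof.
move=> im; move: {2}#|T| (leqnn #|T|) => c; elim: c T => [|c IH] T cT inj dis mT fA.
  have -> : T = set0 by apply/eqP; rewrite -cards_eq0 -leqn0.
  rewrite setU0; case: fA => t ft; exists low; first exact: feas_machine ft.
  by move=> tau _; rewrite le_max lexx.
case: (set_0Vmem T) => [T0|[j0 j0T]].
  by apply: IH => //; rewrite T0 cards0.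
(* The last job is one maximising 2 * start + dur: it resolves the ties caused
   by jobs of duration zero. *)
pose j := [arg max_(j > j0 in T) (start j + (start j + dur j))]%O.
have [jT jmax] : j \in T /\
    {in T, forall j', start j' + (start j' + dur j') <= start j + (start j + dur j)}.
  by rewrite /j; case: arg_maxP => //= j1 j1T h; split.
have [mi [x sj]] : exists mi x, s j = Some (mi, x).
  have := mT j jT; rewrite /mach; case: (s j) => [[mi x]|] e.
    by exists mi, x.
  by rewrite e ltnn in im.
have mii : nat_of_ord mi = i by have := mT j jT; rewrite /mach sj.
have stj : start j = x by rewrite /start sj.
have duj : dur j = (ptime mi j)%:R by rewrite /dur sj.
have TjT : T :\ j \subset T by exact: subsetDl.
have sub : A :|: (T :\ j) \subset A :|: T by exact: setUS.
have [||||//|t ft ht] := IH (T :\ j).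
- by move: cT; rewrite (cardsD1 j T) jT add1n ltnS.
- by move=> a b ha hb; apply: inj; apply: (subsetP sub).
- exact: disjointWr TjT dis.
- by move=> a /(subsetP TjT); apply: mT.
have jA : j \notin A by have /disjointFl -> := dis.
have jin : j \in A :|: T by rewrite inE jT orbT.
have AT : (A :|: T) :\ j = A :|: (T :\ j).
  by apply/setP => a; rewrite !inE; case: eqP => // ->; rewrite (negbTE jA).
have cm_j : cmask (A :|: T) = (2 ^ col j + cmask (A :|: (T :\ j)))%N.
  by rewrite /cmask (big_setD1 j jin)/= AT.
have bitj : odd (cmask (A :|: T) %/ 2 ^ col j).
  by rewrite cmaskE bit_mask ?cmask_uniq// map_f// mem_enum.
have cm_s : (cmask (A :|: T) - 2 ^ col j)%N = cmask (A :|: (T :\ j)).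
  by rewrite cm_j addKn.
have [v1 v2] := sv.
have [rx xd] := v1 _ _ _ sj.
have dur_ge0 a : 0 <= dur a by rewrite /dur; case: (s a) => [[? ?]|]; rewrite ?ler0n.
(* If instead [j] ended before [a] started, the choice of [j] would force both durations to be 0 and
   both starts to be equal, and the bound holds again. *)
have before : {in T :\ j, forall a, start a + dur a <= x}.
  move=> a; rewrite in_setD1 => /andP[aj aT].
  have ha := jmax a aT; rewrite stj duj in ha.
  have := mT a aT; have da := dur_ge0 a; rewrite /mach /start /dur in ha da *.
  case sa : (s a) ha da => [[ma y]|] ha da e; last by rewrite e ltnn in im.
  have em : ma = mi by apply: val_inj; rewrite /= e mii.
  rewrite em in sa ha da *.
  have pj0 : 0 <= (ptime mi j)%:R :> R by rewrite ler0n.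
  by have [] := v2 _ _ _ _ _ aj sa sj; lra.
have tx : toR (Num.max t (r j)) <= x.
  rewrite /toR; case: (leP t (r j)) => h; first by rewrite rE.
  have := ht x before; rewrite le_max => /orP[|//].
  move/le_trans; apply; apply: le_trans rx; rewrite -rE /toR ler_int.
  exact: low_r.
have iE : p i j = (ptime mi j)%:Z by rewrite -mii pE.
have endx : toR (Num.max t (r j) + p i j) <= x + (ptime mi j)%:R.
  by rewrite /toR intrD iE -pmulrn lerD2r.
exists (Num.max t (r j) + p i j).
  apply: feas_job => //.
  - by rewrite cm_s.
  - by rewrite -(ler_int R) dE; apply: le_trans xd.
  - by rewrite -(ler_int R); apply: le_trans (sm sj).
move=> tau /(_ j jT); rewrite stj duj => h; rewrite le_max; apply/orP; right.
exact: le_trans endx h.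
Qed.

(** The jobs of [A] enter machine by machine, and [one_machine] handles each new machine. *)
Lemma feas_complete (A : {set 'I_(jobs I)}) : A \subset selected s ->
  {in A &, injective (fun j : 'I_(jobs I) => col j)} ->
  exists t, feas (machines I) (mask [seq col j | j : 'I_(jobs I) <- enum A]) t.
Proof.
move=> As inj.
have step i : (i <= machines I)%N ->
    exists t, feas i (cmask [set j in A | (mach j < i)%N]) t.
  elim: i => [|i IH] im.
    exists low; rewrite /cmask big_pred0; first exact: feas_empty.
    by move=> j; rewrite inE ltn0 andbF.
  have := @one_machine [set j in A | (mach j < i)%N] [set j in A | mach j == i] i im.
  have -> : [set j in A | (mach j < i)%N] :|: [set j in A | mach j == i] =
      [set j in A | (mach j < i.+1)%N].
    by apply/setP => j; rewrite !inE ltnS [in RHS]leq_eqVlt -andb_orr orbC.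
  move=> [||||t ft _].
  - by move=> a b; rewrite !inE => /andP[aA _] /andP[bA _]; apply: inj.
  - rewrite -setI_eq0; apply/eqP/setP => j; rewrite !inE.
    by case: (j \in A) => //=; lia.
  - by move=> j; rewrite inE => /andP[_ /eqP].
  - exact: IH (ltnW im).
  by exists t.
have [t] := step _ (leqnn _).
have -> : [set j in A | (mach j < machines I)%N] = A.
  apply/setP => j; rewrite inE; case jA : (j \in A) => //=.
  have := subsetP As j jA; rewrite inE /mach.
  by case: (s j) => [[mi x]|//] _ /=; rewrite ltn_ord.
by rewrite cmaskE => ft; exists t.
Qed.

End Schedules.

(** * Program variables and arithmetic subroutines *)

Notation v_m := 0%N.
Notation v_n := 1%N.
Notation v_k := 2%N.
Notation v_cm := 3%N.
Notation v_lg := 4%N.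
Notation v_N := 5%N.
Notation v_B := 6%N.
Notation v_kk := 7%N.
Notation v_K := 8%N.
Notation v_pw := 9%N.
Notation v_i := 10%N.
Notation v_NK := 11%N.
Notation v_fact := 12%N.
Notation v_D := 13%N.
Notation v_L := 14%N.
Notation v_NB := 15%N.
Notation v_LB := 16%N.
Notation v_TK := 17%N.
Notation v_B1 := 18%N.
Notation v_low := 19%N.
Notation v_ans := 20%N.
Notation v_rho := 21%N.
Notation v_y := 22%N.
Notation v_c := 23%N.
Notation v_u := 24%N.
Notation v_l := 25%N.
Notation v_l2 := 26%N.
Notation v_w := 27%N.
Notation v_b := 28%N.
Notation v_x := 29%N.
Notation v_phi := 30%N.
Notation v_best := 31%N.
Notation v_bc := 32%N.
Notation a_H := 33%N.
Notation a_G := 34%N.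
Notation a_U := 35%N.
Notation a_FT := 36%N.
Notation a_PC := 37%N.
Notation a_P2 := 38%N.
Notation a_AT := 39%N.
Notation a_IX := 40%N.
Notation a_PJ := 41%N.
Notation a_F := 42%N.
Notation v_q := 43%N.
Notation v_t1 := 44%N.
Notation v_t2 := 45%N.
Notation v_j := 46%N.
Notation v_S := 47%N.
Notation v_mi := 48%N.
Notation v_beta := 49%N.
Notation v_t := 50%N.
Notation v_yv := 51%N.

Notation HMod e1 e2 := (HSub e1 (HMul (HDiv e1 e2) e2)).
Notation HLet x e := (HSet x (HC 0) e).
Notation "c1 ;; c2" := (HSeq c1 c2) (at level 60, right associativity).

Lemma hmodE (a b : nat) : a%:Z - (a%:Z %/ b%:Z)%Z * b%:Z = (a %% b)%N%:Z.
Proof. by rewrite -modz_nat. Qed.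

Lemma hmod_natE (a b : nat) : a%:Z - (a %/ b)%N%:Z * b%:Z = (a %% b)%N%:Z.
Proof. by rewrite -hmodE divz_nat. Qed.

(** [v_b] receives the bit length of [v_x]. A loop of [v_x] rounds is affordable because the routine
    is only applied to [n] and [N], which are polynomial in the input size. *)
Definition prog_log2 : hprog :=
  HLet v_pw (HC 1) ;; HLet v_b (HC 0) ;;
  HFor v_i v_x
    (HIf (HAdd (HSub (HV v_x) (HV v_pw)) (HC 1))
      (HLet v_pw (HAdd (HV v_pw) (HV v_pw)) ;;
       HLet v_b (HAdd (HV v_b) (HC 1)))
      HSkip).

Definition prog_pow : hprog :=
  HLet v_b (HC 1) ;;
  HFor v_i v_w (HLet v_b (HMul (HV v_b) (HV v_x))).

(** The colours of the digits of [v_u] are collected in [a_G]. The weight is then built as a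
    product: a coloured point contributes [kk], the dummy number [b] contributes [b], which yields
    the factorial, and a repetition makes the product 0. *)
Definition prog_weight : hprog :=
  HLet v_x (HV v_u) ;;
  HFor v_l v_kk
    (HSet a_G (HV v_l) (HA a_H (HMod (HV v_x) (HV v_N))) ;;
     HLet v_x (HDiv (HV v_x) (HV v_N))) ;;
  HLet v_w (HC 1) ;; HLet v_b (HC 0) ;;
  HFor v_l v_kk
    (HIf (HSub (HV v_kk) (HA a_G (HV v_l)))
       (HLet v_w (HMul (HV v_w) (HV v_kk)))
       (HLet v_b (HAdd (HV v_b) (HC 1)) ;;
        HLet v_w (HMul (HV v_w) (HV v_b))) ;;
     HFor v_l2 v_l
       (HIf (HSub (HA a_G (HV v_l)) (HA a_G (HV v_l2))) HSkip
         (HIf (HSub (HA a_G (HV v_l2)) (HA a_G (HV v_l))) HSkip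
           (HLet v_w (HC 0))))).

Section Arithmetic.
Variables (V : nat) (bnd : nat -> nat) (inp : nat -> int).
Local Notation wp := (wp V bnd inp).

Ltac ok := repeat split; rewrite /bounded /=; try lia.

Lemma wp_log2 s x : (0 < x)%N -> s v_x 0%N = x%:Z -> (2 * x + 2 <= V)%N ->
  (x <= bnd v_i)%N ->
  wp prog_log2 (fun s' => s' v_b 0%N = (trunc_log 2 x).+1%:Z) s.
Proof.
move=> x0 sx xV xb.
apply: wp_seq; apply: wp_set; [by []| by ok | by ok |].
apply: wp_seq; apply: wp_set; [by []| by ok | by ok |] => /=.
(* Either every round so far has doubled the power, or the power already exceeds [x]; since
   [x < 2 ^ x], the second case holds at the end. *)
pose Inv (i : nat) (s' : state) := exists e : nat,
  [/\ s' v_b 0%N = e%:Z, s' v_pw 0%N = (2 ^ e)%N%:Z,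
      (e = i /\ (2 ^ i <= x.*2)%N) \/ (x < 2 ^ e)%N & (e = 0)%N \/ (2 ^ e.-1 <= x)%N].
apply: (wp_for (n := x) (Inv := Inv)) => //=.
- by lia.
- by exists 0%N; split=> //=; left; split=> //; lia.
- move=> i s' ix si ag [e [sb spw h1 h2]].
  have sx' : s' v_x 0%N = x%:Z by rewrite ag.
  have pe : (2 ^ e <= x.*2)%N.
    case: h1 => [[-> //]|_]; case: h2 => [->|h]; first by rewrite expn0; lia.
    by case: e h {sb spw} => [|e]; rewrite ?expn0 ?expnS /=; lia.
  apply: wp_if => /=.
  + by rewrite sx' spw; ok.
  + rewrite sx' spw => h3.
    have ltV : (e < x)%N.
      have := @ltn_expl 2 e isT; lia.
    apply: wp_seq; apply: wp_set => //=; rewrite ?spw; [by ok|by ok|].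
    apply: wp_set => //=; rewrite ?sb; [by ok| ok |].
    exists e.+1; split=> //=; rewrite ?expnS; [lia|lia| |right; rewrite /=; lia].
    case: h1 => [[ei hi]|h]; last by lia.
    by left; rewrite -ei; split=> //; lia.
  + rewrite sx' spw => h3; apply: wp_skip; exists e; split=> //=.
    by right; lia.
- move=> s' ag [e [sb spw h1 h2]]; rewrite sb; congr Posz.
  have xe : (x < 2 ^ e)%N.
    case: h1 => [[-> _]|//]; exact: ltn_expl.
  case: h2 => [e0|h2]; first by rewrite e0 expn0 in xe; lia.
  case: e xe h2 {sb spw h1} => [|e] xe h2; first by rewrite expn0 in xe; lia.
  by rewrite (@trunc_log_eq 2 e)// xe andbT.
Qed.

Lemma wp_pow s (x e : nat) : (0 < x)%N -> s v_x 0%N = x%:Z -> s v_w 0%N = e%:Z ->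
  (x <= V)%N -> (e <= V)%N -> (e <= bnd v_i)%N -> (x ^ e <= V)%N ->
  wp prog_pow (fun s' => s' v_b 0%N = (x ^ e)%N%:Z) s.
Proof.
move=> x0 sx se xV eV eb peV.
have V0 : (0 < V)%N by apply: leq_trans peV; rewrite expn_gt0 x0.
have pw i : (i <= e)%N -> (x ^ i <= V)%N.
  by move=> h; apply: leq_trans peV; rewrite leq_pexp2l.
apply: wp_seq; apply: wp_set; [by []| by ok | by ok |] => /=.
apply: (wp_for (n := e) (Inv := fun i s' => s' v_b 0%N = (x ^ i)%N%:Z)) => //=.
move=> i s' ie si ag sb.
have sx' : s' v_x 0%N = x%:Z by rewrite ag.
have := pw _ ie; rewrite expnSr => h1; have h2 := pw _ (ltnW ie).
apply: wp_set => //=; rewrite ?sb ?sx' -?PoszM; [by ok|by ok|].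
by [].
Qed.

Variables (N kk : nat).
Hypotheses (N_gt0 : (0 < N)%N) (kk_gt0 : (0 < kk)%N).
Hypothesis NV : (2 * (N + kk) + 2 <= V)%N.
Hypothesis kkV : (kk ^ kk <= V)%N.
Hypothesis b_l : (kk <= bnd v_l)%N.
Hypothesis b_l2 : (kk <= bnd v_l2)%N.

Lemma wp_weight s (H : nat -> nat) u :
  s v_u 0%N = u%:Z -> s v_N 0%N = N%:Z -> s v_kk 0%N = kk%:Z -> (u <= V)%N ->
  (forall y, (y < N)%N -> s a_H y = (H y)%:Z) ->
  (forall y, (y < N)%N -> (H y <= kk + N)%N) ->
  wp prog_weight
    (fun s' => s' v_w 0%N = (wgt kk [seq H y | y <- digs N kk u])%:Z) s.
Proof.
move=> su sN skk uV sH HV.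
pose g l := H (dig N u l).
have gV l : (g l <= kk + N)%N by apply/HV/dig_lt.
apply: wp_seq; apply: wp_set => //=; [by ok|by rewrite su; ok|].
apply: wp_seq.
pose Inv1 (i : nat) (s' : state) :=
  s' v_x 0%N = (u %/ N ^ i)%N%:Z /\
  forall l, (l < i)%N -> s' a_G l = (g l)%:Z.
apply: (wp_for (n := kk) (Inv := Inv1)) => //=; first by lia.
- by split=> //=; rewrite su expn0 divn1.
- move=> i s' ik si ag [sx sG].
  have sN' : s' v_N 0%N = N%:Z by rewrite ag//=.
  have sH' y : (y < N)%N -> s' a_H y = (H y)%:Z by move=> yN; rewrite ag//=; apply: sH.
  have dx : (u %/ N ^ i <= V)%N by apply: leq_trans uV; exact: leq_div.
  have dlt := dig_lt u i N_gt0.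
  have dxm : (u %/ N ^ i %/ N * N <= u %/ N ^ i)%N by apply: leq_trunc_div.
  have dx1 : (u %/ N ^ i %/ N <= u %/ N ^ i)%N by apply: leq_div.
  apply: wp_seq; apply: wp_set => /=; rewrite ?si ?sx ?sN' ?hmodE ?divz_nat //=.
  + by ok.
  + rewrite -/(dig N u i) sH'//; have := gV i; rewrite /g => h.
    move: dx dxm dx1; generalize (u %/ N ^ i %/ N)%N; generalize (u %/ N ^ i)%N.
    by move=> d1 d2 dx dxm dx1; ok.
  rewrite -/(dig N u i) sH'// -/(g i).
  apply: wp_set => //=; rewrite ?sx ?sN' ?divz_nat; first by ok.
    move: dx dxm dx1; generalize (u %/ N ^ i %/ N)%N; generalize (u %/ N ^ i)%N.
    by move=> d1 d2 dx dxm dx1; ok.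
  split=> /=.
    by rewrite expnSr divnMA.
  move=> l; rewrite ltnS leq_eqVlt => /orP[/eqP->|li].
    by rewrite PeanoNat.Nat.eqb_refl.
  by case: PeanoNat.Nat.eqb_spec => [e|_]; [lia|apply: sG].
- move=> s1 ag1 [_ sG].
apply: wp_seq; apply: wp_set => //=; [by ok|by ok|].
apply: wp_seq; apply: wp_set => //=; [by ok|by ok|].
pose Inv2 (i : nat) (s' : state) :=
  [/\ s' v_b 0%N = (count (leq kk) (mkseq g i))%:Z,
      s' v_w 0%N = (wgt kk (mkseq g i))%:Z &
      (wgt kk (mkseq g i) <= kk ^ i)%N].
have kV i : (i <= kk)%N -> (kk ^ i <= V)%N.
  by move=> h; apply: leq_trans kkV; rewrite leq_pexp2l.
apply: (wp_for (n := kk) (Inv := Inv2)) => //=.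
- by rewrite ag1.
- by lia.
- move=> i s' ik si ag [sb sw wk].
  have skk' : s' v_kk 0%N = kk%:Z by rewrite ag//= ag1.
  have sG' l : (l < kk)%N -> s' a_G l = (g l)%:Z by move=> lk; rewrite ag//=; apply: sG.
  have cb : (count (leq kk) (mkseq g i) <= i)%N.
    by rewrite -[X in (_ <= X)%N](size_mkseq g i) count_size.
  set W0 := (wgt kk (mkseq g i)) in sw wk.
  set b0 := count _ _ in sb cb.
  have gi := gV i; have ki := kV _ ik; rewrite expnS in ki.
  (* The weight including point [i], before the inner loop tests whether its colour repeats an
     earlier one. *)
  pose W1 := (if (g i < kk)%N then W0 * kk else W0 * b0.+1)%N.
  have W1k : (W1 <= kk ^ i.+1)%N.
    rewrite /W1 expnSr; case: ifP => _; first by rewrite leq_mul2r wk orbT.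
    by apply: leq_mul => //; lia.
  have W1V : (W1 <= V)%N by apply: leq_trans W1k (kV _ ik).
  apply: wp_seq; apply: (@wp_conseq _ _ _ _ (fun s2 =>
    s2 v_b 0%N = (count (leq kk) (mkseq g i.+1))%:Z /\ s2 v_w 0%N = W1%:Z)).
    rewrite mkseqS -cats1 count_cat /= -/b0 addn0.
    apply: wp_if => /=; rewrite ?skk' ?si /= ?sG'//; first by ok.
    + move=> h; have gk : (g i < kk)%N by lia.
      move: W1V; rewrite /W1 gk => W1V.
      apply: wp_set => //=; rewrite ?sw ?skk' -?PoszM; [by ok| |].
        by have := kV i (ltnW ik); ok.
      by rewrite leqNgt gk addn0.
    + move=> h; have gk : (g i < kk)%N = false by lia.
      move: W1V; rewrite /W1 gk => W1V.
      apply: wp_seq; apply: wp_set => //=; rewrite ?sb; [by ok|by ok|].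
      have e1 : b0%:Z + 1 = b0.+1%:Z by lia.
      rewrite e1; apply: wp_set => //=; rewrite ?sw -?PoszM; [by ok| |].
        by have := kV i (ltnW ik); ok.
      by rewrite leqNgt gk addn1.
  move=> s2 ag2 [sb2 sw2].
  have si2 : s2 v_l 0%N = i%:Z by rewrite ag2.
  have sG2 l : (l < kk)%N -> s2 a_G l = (g l)%:Z by move=> lk; rewrite ag2//=; apply: sG'.
  pose Inv3 (j : nat) (s' : state) :=
    s' v_w 0%N = ((g i \notin mkseq g j) * W1)%N%:Z.
  apply: (wp_for (n := i) (Inv := Inv3)) => //=; [by lia|by lia| | |].
  + by rewrite /Inv3 /= mul1n.
  + move=> j s3 ji sj ag3; rewrite /Inv3 => sw3.
    have sG3 l : (l < kk)%N -> s3 a_G l = (g l)%:Z by move=> lk; rewrite ag3//=; apply: sG2.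
    have si3 : s3 v_l 0%N = i%:Z by rewrite ag3.
    have gj := gV j; have jk : (j < kk)%N by lia.
    rewrite mkseqS mem_rcons inE negb_or /=.
    apply: wp_if => /=; rewrite ?si3 ?sj /= ?sG3//; first by ok.
    * by move=> h; apply: wp_skip => /=; have -> : (g i != g j) by lia.
    * move=> h; apply: wp_if => /=; rewrite ?si3 ?sj /= ?sG3//; first by ok.
        by move=> h2; apply: wp_skip => /=; have -> : (g i != g j) by lia.
      move=> h2; apply: wp_set => //=; [by ok|by ok|].
      by have -> : g i = g j by [lia]; rewrite eqxx.
  + move=> s3 ag3; rewrite /Inv3 => sw3.
    have W1E : ((g i \notin mkseq g i) * W1)%N = wgt kk (mkseq g i.+1).
      rewrite mkseqS /wgt rcons_uniq -cats1 !count_cat /= !addn0 /W1 /W0 /b0 /wgt.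
      case: ltnP => gk /=; rewrite ?addn0 ?addn1.
        by rewrite expnSr -mulnb; ring.
      by rewrite factS -mulnb; ring.
    split=> /=; [by rewrite ag3|by rewrite sw3 W1E|].
    by rewrite -W1E; apply: leq_trans W1k; case: (_ \notin _) => /=; lia.
- move=> s2 ag2 [_ -> _]; congr (Posz (wgt _ _)).
  by rewrite /digs /mkseq -map_comp.
Qed.

End Arithmetic.

(** * The greedy construction as a program *)

Definition prog_phi : hprog :=
  HLet v_phi (HC 0) ;;
  HFor v_u v_NK
    (HIf (HA a_U (HV v_u))
      (prog_weight ;; HLet v_phi (HAdd (HV v_phi) (HV v_w))) HSkip).

(** The initial value -1 of [v_best] lies below every potential, so the first colour is always
    recorded. *)
Definition prog_choose : hprog :=
  HLet v_best (HC (-1)) ;; HLet v_bc (HC 0) ;;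
  HFor v_c v_kk
    (HSet a_H (HV v_y) (HV v_c) ;;
     prog_phi ;;
     HIf (HSub (HV v_phi) (HV v_best))
       (HLet v_best (HV v_phi) ;; HLet v_bc (HV v_c)) HSkip) ;;
  HSet a_H (HV v_y) (HV v_bc).

Definition prog_round : hprog :=
  HFor v_y v_N (HSet a_H (HV v_y) (HAdd (HV v_kk) (HV v_y))) ;;
  HFor v_y v_N prog_choose ;;
  HFor v_y v_N
    (HSet a_FT (HAdd (HMul (HV v_rho) (HV v_N)) (HV v_y)) (HA a_H (HV v_y))) ;;
  HFor v_u v_NK
    (HIf (HA a_U (HV v_u))
      (prog_weight ;; HIf (HV v_w) (HSet a_U (HV v_u) (HC 0)) HSkip) HSkip).

Definition prog_greedy : hprog :=
  HFor v_u v_NK (HSet a_U (HV v_u) (HC 1)) ;;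
  HFor v_rho v_L prog_round.

Definition arr (s : state) (a n : nat) (f : nat -> nat) : Prop :=
  forall i, (i < n)%N -> s a i = (f i)%:Z.

Section GreedyProgram.
Variables (V : nat) (bnd : nat -> nat) (inp : nat -> int).
Local Notation wp := (wp V bnd inp).
Variables (N kk NK L e : nat).
Hypotheses (N_gt0 : (0 < N)%N) (kk_gt0 : (0 < kk)%N).
Hypothesis NKE : NK = (N ^ kk)%N.
Hypothesis LE : L = (rounds_unit kk * e)%N.
Hypothesis Ne : (N ^ kk < 2 ^ e)%N.
Hypothesis NV : (2 * (N + kk) + 2 <= V)%N.
Hypothesis kkV : (NK * kk ^ kk + NK + 1 <= V)%N.
Hypothesis LV : (L * N + N + L <= V)%N.
Hypothesis b_l : (kk <= bnd v_l)%N.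
Hypothesis b_l2 : (kk <= bnd v_l2)%N.
Hypothesis b_u : (NK <= bnd v_u)%N.
Hypothesis b_c : (kk <= bnd v_c)%N.
Hypothesis b_y : (N <= bnd v_y)%N.
Hypothesis b_rho : (L <= bnd v_rho)%N.

Ltac ok := repeat split; rewrite /bounded /=; try lia.

Definition greedy_ctx (s : state) : Prop :=
  [/\ s v_N 0%N = N%:Z, s v_kk 0%N = kk%:Z, s v_NK 0%N = NK%:Z & s v_L 0%N = L%:Z].

Lemma greedy_ctx_agree l s s' : agree l s s' ->
  all (fun x => x \notin l) [:: v_N; v_kk; v_NK; v_L] ->
  greedy_ctx s -> greedy_ctx s'.
Proof.
move=> ag /= /and5P[h1 h2 h3 h4 _] [e1 e2 e3 e4].
by split; rewrite ag.
Qed.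

Let NK_gt0 : (0 < NK)%N. Proof. by rewrite NKE expn_gt0 N_gt0. Qed.
Let kkkkV : (kk ^ kk <= V)%N.
Proof.
apply: leq_trans kkV; apply: (@leq_trans (NK * kk ^ kk)%N); last by lia.
by rewrite leq_pmull.
Qed.
Let NKV : (NK <= V)%N. Proof. by lia. Qed.

Lemma wp_phi s (H : nat -> nat) (U : nat -> bool) : greedy_ctx s ->
  arr s a_H N H -> (forall y, (y < N)%N -> (H y <= kk + N)%N) -> arr s a_U NK U ->
  wp prog_phi (fun s' => s' v_phi 0%N = (potential N kk U H)%:Z /\
    (potential N kk U H <= NK * kk ^ kk)%N) s.
Proof.
move=> C sH HB sU; apply: wp_seq; apply: wp_set => //=; [by ok|by ok|].
pose P i := (\sum_(0 <= u < i) U u * wgt kk [seq H y | y <- digs N kk u])%N.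
have W u : (wgt kk [seq H y | y <- digs N kk u] <= kk ^ kk)%N.
  have := @wgt_le kk [seq H y | y <- digs N kk u].
  by rewrite size_map size_mkseq; apply.
have PB i : (P i <= i * kk ^ kk)%N.
  rewrite /P; elim: i => [|i IH]; first by rewrite big_geq.
  rewrite big_nat_recr//= mulSn addnC leq_add//.
  by apply: leq_trans (W i); case: (U i) => /=; lia.
pose Inv (i : nat) (s' : state) := s' v_phi 0%N = (P i)%:Z.
have [_ _ hNK _] := C.
apply: (wp_for (n := NK) (Inv := Inv)) => //=.
- by rewrite /Inv /P big_geq.
- move=> u s' uN su ag; rewrite /Inv => sp.
  have C' : greedy_ctx s' by exact: greedy_ctx_agree ag _ C.
  have sU' : arr s' a_U NK U by move=> i iN; rewrite ag//=; apply: sU.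
  have sH' : arr s' a_H N H by move=> i iN; rewrite ag//=; apply: sH.
  have PS : P u.+1 = (P u + U u * wgt kk [seq H y | y <- digs N kk u])%N.
    by rewrite /P big_nat_recr.
  have PV : (P u.+1 <= V)%N.
    apply: leq_trans (PB _) _; apply: leq_trans kkV.
    by rewrite -addnA; apply: leq_trans (leq_addr _ _); rewrite leq_mul2r uN orbT.
  apply: wp_if => /=; rewrite su /= sU'//.
  + by case: (U u); ok.
  + case Uu : (U u) => //= _; rewrite Uu mul1n in PS.
    apply: wp_seq; have [h1 h2 _ _] := C'.
    apply: (@wp_conseq _ _ _ _ _ _ _ (@wp_weight V bnd inp N kk N_gt0 kk_gt0
      NV kkkkV b_l b_l2 s' H u su h1 h2 _ sH' HB)); first by lia.
    move=> s2 ag2 sw; apply: wp_set => //=; rewrite ?sw ?ag2 ?sp//.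
      by ok.
      by have := W u; ok.
    by rewrite PS PoszD.
  + case Uu : (U u) => //= _; rewrite Uu mul0n addn0 in PS.
    by apply: wp_skip; rewrite /= PS.
- move=> s' _; rewrite /Inv => ->; rewrite /potential -NKE.
  by split=> //; exact: PB.
Qed.

Lemma wp_choose s (H : nat -> nat) (U : nat -> bool) y : greedy_ctx s ->
  (y < N)%N -> s v_y 0%N = y%:Z -> arr s a_H N H -> partial kk H y ->
  arr s a_U NK U ->
  wp prog_choose (fun s' => exists b, [/\ (b < kk)%N,
    (forall c, (c < kk)%N ->
      potential N kk U (fset H y c) <= potential N kk U (fset H y b))%N &
    arr s' a_H N (fset H y b)]) s.
Proof.
move=> C yN sy sH pH sU.
apply: wp_seq; apply: wp_set => //=; [by ok|by ok|].
apply: wp_seq; apply: wp_set => //=; [by ok|by ok|].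
apply: wp_seq.
have HB z c : (c < kk)%N -> (z < N)%N -> (fset H y c z <= kk + N)%N.
  move=> ck zN; rewrite /fset; case: eqP => _; first by lia.
  have [h1 h2] := pH; case: (ltnP z y) => h; first by have := h1 _ h; lia.
  by rewrite h2//; lia.
pose P c := potential N kk U (fset H y c).
(* Entry [y] of [a_H] holds the colour tried last, so only the other entries are kept in the
   invariant. *)
pose Inv (i : nat) (s' : state) := exists b : nat,
  [/\ s' v_bc 0%N = b%:Z,
      [/\ i = 0%N, s' v_best 0%N = -1 & b = 0%N] \/
      [/\ (b < i)%N, s' v_best 0%N = (P b)%:Z, (P b <= NK * kk ^ kk)%N &
          forall c, (c < i)%N -> (P c <= P b)%N] &
      forall z, (z < N)%N -> z != y -> s' a_H z = (H z)%:Z].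
have [hN hkk hNK _] := C.
apply: (wp_for (n := kk) (Inv := Inv)) => //=; first by lia.
- exists 0%N; split=> //=; first by left; split.
  by move=> z zN _; apply: sH.
- move=> c s' ck sc ag [b [sb hb sHz]].
  have C' : greedy_ctx s' by exact: greedy_ctx_agree ag _ C.
  have sy' : s' v_y 0%N = y%:Z by rewrite ag.
  have sU' : arr s' a_U NK U by move=> i iN; rewrite ag//=; apply: sU.
  apply: wp_seq; apply: wp_set => //=; rewrite ?sy' ?sc//; [by ok|by ok|].
  apply: wp_seq; apply: wp_conseq.
    apply: (@wp_phi _ (fset H y c) U).
    + exact: C'.
    + move=> z zN /=; rewrite /fset; case: PeanoNat.Nat.eqb_spec => [->|/eqP ne].
        by rewrite eqxx.
      by rewrite (negbTE ne); apply: sHz.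
    + by move=> z zN; apply: HB.
    + exact: sU'.
  move=> s2 ag2 [sphi phiB].
  have sb2 : s2 v_bc 0%N = b%:Z by rewrite ag2.
  have sc2 : s2 v_c 0%N = c%:Z by rewrite ag2.
  have best2 : s2 v_best 0%N = s' v_best 0%N by rewrite ag2.
  have sH2 z : (z < N)%N -> z != y -> s2 a_H z = (H z)%:Z.
    move=> zN zy; rewrite ag2//=; case: PeanoNat.Nat.eqb_spec => [ez|_].
      by rewrite ez eqxx in zy.
    exact: sHz.
  apply: wp_if => /=; rewrite ?sphi ?best2.
  + by case: hb => [[_ -> _]|[_ -> h _]]; ok.
  + move=> gt; apply: wp_seq; apply: wp_set => //=; rewrite ?sphi; [by ok|by ok|].
    apply: wp_set => //=; rewrite ?sc2; [by ok|by ok|].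
    exists c; split=> //=; right; split=> // c'.
    rewrite ltnS leq_eqVlt => /orP[/eqP->//|c'c].
    case: hb => [[c0 _ _]|[_ hb _ hc]]; first by lia.
    by have := hc _ c'c; rewrite /P in hb *; lia.
  + move=> le; apply: wp_skip; exists b; split=> //=; right.
    case: hb => [[_ hb _]|[bc hb h hc]]; first by lia.
    split=> //; first by lia.
    by rewrite best2.
    move=> c'; rewrite ltnS leq_eqVlt => /orP[/eqP->|/hc//].
    by rewrite /P in hb *; lia.
- move=> s' ag [b [sb hb sHz]].
  have sy' : s' v_y 0%N = y%:Z by rewrite ag.
  case: hb => [[k0 _ _]|[bk _ _ hc]]; first by lia.
  apply: wp_set => //=; rewrite ?sy' ?sb//; [by ok|by ok|].
  exists b; split=> //= z zN; rewrite /= /fset.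
  case: PeanoNat.Nat.eqb_spec => [->|/eqP ne]; first by rewrite eqxx.
  by rewrite (negbTE ne); apply: sHz.
Qed.

(** A tuple already dropped from [U] is separated by one of the first [rho] rows. The last clause
    says that at most [(1 - 1 / rounds_unit kk) ^ rho * N ^ kk] tuples are left, written without
    denominators. *)
Definition greedy_inv (rho : nat) (s : state) : Prop :=
  exists FT (U : nat -> bool), [/\
    arr s a_FT (rho * N) FT /\ (forall i, (i < rho * N)%N -> (FT i < kk)%N),
    arr s a_U NK U,
    (forall u, (u < N ^ kk)%N -> uniq (digs N kk u) -> ~~ U u ->
       exists2 r, (r < rho)%N & uniq [seq FT (r * N + y)%N | y <- digs N kk u]) &
    (rounds_unit kk ^ rho * uncovered N kk U <=
     (rounds_unit kk).-1 ^ rho * N ^ kk)%N].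

Lemma wp_round s rho : greedy_ctx s -> (rho < L)%N -> s v_rho 0%N = rho%:Z ->
  greedy_inv rho s -> wp prog_round (fun s' => greedy_inv rho.+1 s') s.
Proof.
move=> C rL srho [FT [U [[sFT FTk] sU cov pot]]].
have [hN hkk hNK hL] := C.
apply: wp_seq.
apply: (wp_for (n := N) (Inv := fun i s' => arr s' a_H i (fun y => kk + y)%N)) => //=.
- by lia.
- move=> i s' iN si ag sH.
  have hkk' : s' v_kk 0%N = kk%:Z by rewrite ag.
  apply: wp_set => //=; rewrite ?si ?hkk'//=; [by ok|by ok|].
  move=> j /=; rewrite ltnS leq_eqVlt; case: PeanoNat.Nat.eqb_spec => [->//|/eqP ne].
  by rewrite (negbTE ne) /=; apply: sH.
move=> s1 ag1 sH1; apply: wp_seq.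
have C1 : greedy_ctx s1 by exact: greedy_ctx_agree ag1 _ C.
have [hN1 hkk1 hNK1 hL1] := C1.
have sU1 : arr s1 a_U NK U by move=> i iN; rewrite ag1//=; apply: sU.
pose Inv2 (i : nat) (s' : state) := exists H, [/\ arr s' a_H N H, partial kk H i &
  (potential N kk U (fun y => kk + y) <= potential N kk U H)%N].
apply: (wp_for (n := N) (Inv := Inv2)) => //=; first by lia.
- by exists (fun y => kk + y)%N; split=> //; split=> // z; rewrite ltn0.
- move=> i s' iN si ag [H [sH pH hpot]].
  have C' : greedy_ctx s' by exact: greedy_ctx_agree ag _ C1.
  have sU' : arr s' a_U NK U by move=> j jN; rewrite ag//=; apply: sU1.
  apply: wp_conseq; first exact: (wp_choose C' iN si sH pH sU').
  move=> s2 _ [b [bk hb sH2]]; exists (fset H i b); split=> //.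
    exact: (partial_fset N_gt0 kk_gt0).
  by apply: leq_trans hpot _; apply: potential_best.
move=> s2 ag2 [H [sH2 [Hlt _] hpot]]; apply: wp_seq.
have C2 : greedy_ctx s2 by exact: greedy_ctx_agree ag2 _ C1.
have [hN2 hkk2 hNK2 hL2] := C2.
have sU2 : arr s2 a_U NK U by move=> i iN; rewrite ag2//=; apply: sU1.
have srho2 : s2 v_rho 0%N = rho%:Z by rewrite ag2//= ag1.
have sFT2 : arr s2 a_FT (rho * N) FT.
  by move=> i iN; rewrite ag2//= ag1//=; apply: sFT.
pose FT' i := if (i < rho * N)%N then FT i else H (i - rho * N)%N.
have FTE y : (y < N)%N -> FT' (rho * N + y)%N = H y.
  by move=> yN; rewrite /FT' ltnNge leq_addr addKn.
have rNV : (rho * N + N <= V)%N.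
  have : (rho.+1 * N <= L * N)%N by rewrite leq_mul2r rL orbT.
  by rewrite mulSn; lia.
apply: (wp_for (n := N) (Inv := fun i s' => arr s' a_FT (rho * N + i) FT')) => //=.
- by lia.
- by rewrite addn0 => i iN /=; rewrite /FT' iN; apply: sFT2.
- move=> i s' iN si ag sFT'.
  have hN' : s' v_N 0%N = N%:Z by rewrite ag.
  have srho' : s' v_rho 0%N = rho%:Z by rewrite ag.
  have sH' : s' a_H i = (H i)%:Z by rewrite ag//=; apply: sH2.
  have hHi := Hlt _ iN.
  apply: wp_set => /=; rewrite ?si ?hN' ?srho' /= ?sH' -?PoszM -?PoszD//=.
    by ok.
    by ok.
  rewrite addnS => j /=; rewrite ltnS leq_eqVlt.
  case: PeanoNat.Nat.eqb_spec => [->|/eqP ne] jb; first by rewrite FTE.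
  by rewrite (negbTE ne) /= in jb; apply: sFT'.
move=> s3 ag3 sFT3.
have C3 : greedy_ctx s3 by exact: greedy_ctx_agree ag3 _ C2.
have [hN3 hkk3 hNK3 hL3] := C3.
have sU3 : arr s3 a_U NK U by move=> i iN; rewrite ag3//=; apply: sU2.
have sH3 : arr s3 a_H N H by move=> i iN; rewrite ag3//=; apply: sH2.
pose w u := wgt kk [seq H y | y <- digs N kk u].
pose U' u := U u && (w u == 0%N).
pose Inv4 (i : nat) (s' : state) :=
  arr s' a_U NK (fun u => if (u < i)%N then U' u else U u).
apply: (wp_for (n := NK) (Inv := Inv4)) => //=.
- move=> u s' uN su ag sU'.
  have C' : greedy_ctx s' by exact: greedy_ctx_agree ag _ C3.
  have [hN' hkk' _ _] := C'.
  have sH' : arr s' a_H N H by move=> j jN; rewrite ag//=; apply: sH3.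
  have Uu : s' a_U u = (U u)%:Z by rewrite sU'// ltnn.
  have same : U u = U' u -> forall s'', s'' a_U = s' a_U -> Inv4 u.+1 s''.
    move=> eU s'' es j jN; rewrite es sU'// ltnS [in RHS]leq_eqVlt.
    by case: eqP => [->|_] //=; rewrite ltnn eU.
  apply: wp_if => /=; rewrite su /= Uu.
  + by case: (U u); ok.
  + case Ut : (U u) => //= _; apply: wp_seq.
    apply: (@wp_conseq _ _ _ _ _ _ _ (@wp_weight V bnd inp N kk N_gt0 kk_gt0
      NV kkkkV b_l b_l2 s' H u su hN' hkk' _ sH' _)); [by lia| |].
      by move=> y yN; have := Hlt _ yN; lia.
    move=> s4 ag4 sw.
    have su4 : s4 v_u 0%N = u%:Z by rewrite ag4.
    have wk : (w u <= V)%N.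
      apply: leq_trans kkkkV; have := @wgt_le kk [seq H y | y <- digs N kk u].
      by rewrite size_map size_mkseq; apply.
    apply: wp_if => /=; rewrite ?sw -/(w u); first by ok.
    * move=> w0; apply: wp_set => //=; rewrite ?su4//; [by ok|by ok|].
      move=> j jN /=; rewrite ltnS leq_eqVlt.
      case: PeanoNat.Nat.eqb_spec => [->|/eqP ne].
        by rewrite eqxx /= /U'; have -> : (w u == 0%N) = false; [lia|rewrite andbF].
      by rewrite (negbTE ne) /= ag4//= sU'.
    * move=> w0; apply: wp_skip; apply: same; last by rewrite upd_neq// ag4.
      by rewrite /U' Ut; have -> : w u = 0%N by lia.
  + by case Ut : (U u) => //= _; apply: wp_skip; apply: same => //; rewrite /U' Ut.
move=> s4 ag4 sU4; exists FT', U'; split.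
- split.
    by move=> i iN; rewrite ag4//=; apply: sFT3; move: iN; rewrite mulSn addnC.
  move=> i; rewrite mulSn /FT' => iN; case: (ltnP i (rho * N)) => h; first exact: FTk.
  by apply: Hlt; lia.
- by move=> u uN; rewrite sU4// uN.
- move=> u uN du; rewrite /U' negb_and => /orP[nU|nw].
    have [r rr ur] := cov u uN du nU; exists r; first by lia.
    suff -> : [seq FT' (r * N + y)%N | y <- digs N kk u] =
              [seq FT (r * N + y)%N | y <- digs N kk u] by [].
    apply/eq_in_map => y /(digs_lt N_gt0) yN; rewrite /FT'.
    have : (r.+1 * N <= rho * N)%N by rewrite leq_mul2r rr orbT.
    by rewrite mulSn => h; have -> : (r * N + y < rho * N)%N by lia.
  exists rho => //.
  suff -> : [seq FT' (rho * N + y)%N | y <- digs N kk u] =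
            [seq H y | y <- digs N kk u].
    by move: nw; rewrite /w /wgt; case: (uniq [seq H y | y <- digs N kk u]).
  by apply/eq_in_map => y /(digs_lt N_gt0) yN; rewrite FTE.
- have := @uncovered_round N kk N_gt0 kk_gt0 U H Hlt hpot.
  rewrite -/U' !expnS => h1.
  set D := rounds_unit kk in pot h1 *; set D1 := D.-1 in pot h1 *.
  have := leq_mul (leqnn (D ^ rho)) h1; have := leq_mul (leqnn D1) pot.
  by rewrite !mulnA [(D ^ rho * D)%N]mulnC [(D ^ rho * D1)%N]mulnC => *; lia.
Qed.

Lemma wp_greedy s : greedy_ctx s ->
  wp prog_greedy (fun s' => exists FT, [/\ arr s' a_FT (L * N) FT,
    (forall i, (i < L * N)%N -> (FT i < kk)%N) & perfect_family N kk L FT]) s.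
Proof.
move=> C; have [hN hkk hNK hL] := C; apply: wp_seq.
apply: (wp_for (n := NK) (Inv := fun i s' => arr s' a_U i (fun=> true))) => //=.
- move=> i s' iN si ag sU.
  apply: wp_set => //=; rewrite ?si//=; [by ok|by ok|].
  move=> j /=; rewrite ltnS leq_eqVlt; case: PeanoNat.Nat.eqb_spec => [->//|/eqP ne].
  by rewrite (negbTE ne) /=; apply: sU.
move=> s1 ag1 sU1.
have C1 : greedy_ctx s1 by exact: greedy_ctx_agree ag1 _ C.
have [hN1 hkk1 hNK1 hL1] := C1.
apply: (wp_for (n := L) (Inv := greedy_inv)) => //=; first by lia.
- exists (fun=> 0%N), (fun=> true); split=> //.
  rewrite !expn0 !mul1n /uncovered.
  apply: leq_trans (_ : \sum_(0 <= u < N ^ kk) 1 <= _)%N.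
    by apply: leq_sum => u _; rewrite leq_b1.
  by rewrite sum_nat_const_nat muln1 subn0.
- move=> rho s' rL srho ag inv.
  have C' : greedy_ctx s' by exact: greedy_ctx_agree ag _ C1.
  apply: wp_conseq; first exact: (wp_round C' rL srho inv).
  by [].
move=> s2 ag2 [FT [U [[sFT FTk] sU cov pot]]]; exists FT; split=> //.
(* After [L] rounds no tuple with distinct entries is left in [U], so each one has its row. *)
apply: perfect_family_tuples => u uN du; apply: cov => //.
apply: (uncovered0 _ uN du).
by apply: (@rounds_suffice N kk) Ne _ => //; rewrite -LE.
Qed.

End GreedyProgram.

(** * The search program: colourings, dynamic program and test *)

Definition prog_popcount : hprog :=
  HSet a_PC (HC 0) (HC 0) ;;
  HFor v_S v_TK
    (HSet a_PC (HV v_S)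
      (HAdd (HA a_PC (HDiv (HV v_S) (HC (Posz 2)))) (HMod (HV v_S) (HC (Posz 2))))).

Definition prog_pow2 : hprog :=
  HLet v_pw (HC 1) ;;
  HFor v_l v_K
    (HSet a_P2 (HV v_l) (HV v_pw) ;; HLet v_pw (HAdd (HV v_pw) (HV v_pw))) ;;
  HLet v_TK (HV v_pw).

Notation e_r := (HI (HAdd (HC (Posz 4)) (HV v_j))).
Notation e_d := (HI (HAdd (HAdd (HC (Posz 4)) (HV v_n)) (HV v_j))).
Notation e_p := (HI (HAdd (HAdd (HC (Posz 4)) (HAdd (HV v_n) (HV v_n)))
  (HAdd (HMul (HV v_mi) (HV v_n)) (HV v_j)))).

(** An idle machine is free at [low], a time preceding all release dates. Starting from [v_cm] keeps
    it at most the makespan bound, so that it is never mistaken for infeasibility. *)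
Definition prog_low : hprog :=
  HLet v_low (HV v_cm) ;;
  HFor v_j v_n (HIf (HSub (HV v_low) e_r) (HLet v_low e_r) HSkip).

Definition prog_digits (a b v : nat) : hprog :=
  HFor v_l v
    (HSet a (HV v_l) (HMod (HV v_x) (HV b)) ;;
     HLet v_x (HDiv (HV v_x) (HV b))).

(** [a_PJ] stores [2 ^ colour], the number by which the dynamic program shifts a colour set and
    which it subtracts from it. *)
Definition prog_colours : hprog :=
  HLet v_x (HV v_t1) ;; prog_digits a_AT v_N v_B1 ;;
  HLet v_x (HV v_t2) ;; prog_digits a_IX v_L v_B ;;
  HFor v_j v_n
    (HLet v_yv (HMod (HV v_j) (HAdd (HV v_q) (HC 1))) ;;
     HLet v_beta (HC 0) ;;
     HFor v_l v_B1
       (HIf (HAdd (HSub (HV v_yv) (HA a_AT (HV v_l))) (HC 1))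
         (HLet v_beta (HAdd (HV v_beta) (HC 1))) HSkip) ;;
     HSet a_PJ (HV v_j)
       (HA a_P2 (HAdd (HMul (HV v_beta) (HV v_kk))
         (HA a_FT (HAdd (HMul (HA a_IX (HV v_beta)) (HV v_N)) (HV v_yv)))))).

Definition prog_relax : hprog :=
  HIf (HMod (HDiv (HV v_S) (HA a_PJ (HV v_j))) (HC (Posz 2)))
    (HLet v_t (HA a_F (HSub (HV v_S) (HA a_PJ (HV v_j)))) ;;
     HIf (HSub e_r (HV v_t)) (HLet v_t e_r) HSkip ;;
     HLet v_t (HAdd (HV v_t) e_p) ;;
     HIf (HAdd (HSub e_d (HV v_t)) (HC 1))
       (HIf (HAdd (HSub (HV v_cm) (HV v_t)) (HC 1))
         (HIf (HSub (HA a_F (HV v_S)) (HV v_t))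
           (HSet a_F (HV v_S) (HV v_t)) HSkip)
         HSkip)
       HSkip)
    HSkip.

(** A single row of the table is overwritten in increasing order of [S]. At [S], smaller sets
    already include the current machine, while larger ones still refer to the previous machines. A
    feasible entry is reset to [low], the current machine being idle; adding a job reads the smaller
    set [S - 2 ^ colour], which already accounts for that machine. *)
Definition prog_dp : hprog :=
  HFor v_S v_TK (HSet a_F (HV v_S) (HAdd (HV v_cm) (HC 1))) ;;
  HSet a_F (HC 0) (HV v_low) ;;
  HFor v_mi v_m
    (HFor v_S v_TK
      (HIf (HSub (HA a_F (HV v_S)) (HV v_cm)) HSkip
         (HSet a_F (HV v_S) (HV v_low)) ;;
       HFor v_j v_n prog_relax)).

Definition prog_check : hprog :=
  HFor v_S v_TK
    (HIf (HAdd (HSub (HV v_cm) (HA a_F (HV v_S))) (HC 1))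
      (HIf (HAdd (HSub (HA a_PC (HV v_S)) (HV v_k)) (HC 1))
        (HLet v_ans (HC 1)) HSkip)
      HSkip).

Definition prog_search : hprog :=
  HFor v_q v_N (HFor v_t1 v_NB (HFor v_t2 v_LB
    (prog_colours ;; prog_dp ;; prog_check))).

Definition in_release (inp : nat -> int) (j : nat) : int := inp (4 + j)%N.
Definition in_deadline (inp : nat -> int) (n j : nat) : int := inp (4 + n + j)%N.
Definition in_ptime (inp : nat -> int) (n i j : nat) : int :=
  inp (4 + (n + n) + (i * n + j))%N.

Lemma feas_bounds r d p col n low cm i S t :
  low <= cm -> (forall j, (j < n)%N -> low <= r j) ->
  (forall i j, (j < n)%N -> 0 <= p i j) ->
  feas r d p col n low cm i S t -> low <= t <= cm.
Proof.
move=> lc lr p0; elim=> {i S t} [|i S t _ _|i S j t jn _ _ _ _ tc].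
- by rewrite lexx.
- by rewrite lexx.
- rewrite tc andbT; have := lr j jn; have := p0 i j jn.
  have : r j <= Num.max t (r j) by rewrite le_max lexx orbT.
  by lia.
Qed.

Section SearchProgram.
Variables (V : nat) (bnd : nat -> nat) (inp : nat -> int).
Local Notation wp := (wp V bnd inp).

Ltac ok := repeat split; rewrite /bounded /=; try lia.

Lemma wp_popcount s TK : (0 < TK)%N -> s v_TK 0%N = TK%:Z -> (2 * TK + 4 <= V)%N ->
  (TK <= bnd v_S)%N ->
  wp prog_popcount (fun s' => exists C : nat -> nat,
    [/\ arr s' a_PC TK C, (forall S, (S < TK)%N -> (C S <= S)%N), C 0%N = 0%N &
        forall S, (S < TK)%N -> C S = (C (S %/ 2) + odd S)%N]) s.
Proof.
move=> TK0 sTK VT bS.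
apply: wp_seq; apply: wp_set => //=; [by ok|by ok|].
(* Entry 0 is set in advance, because at [S = 0] the recursion reads the entry being written; hence
   [maxn i 1]. *)
pose Inv (i : nat) (s' : state) := exists C : nat -> nat,
  [/\ arr s' a_PC (maxn i 1) C, (forall S, (S < maxn i 1)%N -> (C S <= S)%N),
      C 0%N = 0%N & forall S, (S < i)%N -> C S = (C (S %/ 2) + odd S)%N].
apply: (wp_for (n := TK) (Inv := Inv)) => //=; first by lia.
- exists (fun=> 0%N); split=> //= i i1.
  by have -> : i = 0%N by lia.
- move=> i s' iN si ag [C [sC CB C0 CS]].
  have i2 : (i %/ 2 < maxn i 1)%N by lia.
  have C2 := CB _ i2.
  have m2 : (i %% 2 = odd i)%N by rewrite modn2.
  apply: wp_set => /=; rewrite ?si//=; first by ok.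
    by rewrite !mul1n !hmodE !divz_nat sC//; ok.
  rewrite mul1n hmodE sC// m2 -PoszD.
  pose C' j := if j == i then (C (i %/ 2) + odd i)%N else C j.
  have C'E j : j != i -> C' j = C j by rewrite /C' => /negbTE ->.
  have C'0 : C' 0%N = 0%N.
    by rewrite /C'; case: eqP => // <-; rewrite div0n C0.
  have C'2 j : C' (j %/ 2)%N = C (j %/ 2)%N \/ j = 0%N \/ (i < j)%N.
    rewrite /C'; case: eqP => [e|_]; last by left.
    case: j e => [|j] e; first by right; left.
    by right; right; lia.
  exists C'; split=> //.
  + move=> j jn /=; rewrite /C'; case: PeanoNat.Nat.eqb_spec => [->|/eqP ne].
      by rewrite eqxx.
    by rewrite (negbTE ne) sC//; move: jn ne; rewrite !leq_max; lia.
  + move=> j jn; rewrite /C'; case: eqP => [->|/eqP ne].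
      by have := odd_double_half i; lia.
    by apply: CB; move: jn ne; rewrite !leq_max; lia.
  + move=> j jn; case: (C'2 j) => [->|[->|h]]; [|by rewrite div0n C'0|by lia].
    rewrite {1}/C'; case: eqP => [-> //|/eqP ne].
    by apply: CS; lia.
- move=> s' ag [C [sC CB C0 CS]]; exists C; split=> //.
    by move=> i iT; apply: sC; rewrite leq_max iT.
  by move=> i iT; apply: CB; rewrite leq_max iT.
Qed.

Lemma wp_pow2 s K : s v_K 0%N = K%:Z -> (2 * 2 ^ K + 2 <= V)%N -> (K <= bnd v_l)%N ->
  wp prog_pow2 (fun s' => arr s' a_P2 K (fun l => 2 ^ l)%N /\
    s' v_TK 0%N = (2 ^ K)%N%:Z) s.
Proof.
move=> sK VK bl; have KV : (K <= V)%N by have := @ltn_expl 2 K isT; lia.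
apply: wp_seq; apply: wp_set => //=; [by ok|by ok|].
apply: wp_seq.
pose Inv (i : nat) (s' : state) :=
  arr s' a_P2 i (fun l => 2 ^ l)%N /\ s' v_pw 0%N = (2 ^ i)%N%:Z.
apply: (wp_for (n := K) (Inv := Inv)) => //=.
- move=> i s' iK si ag [sP spw].
  have le : (2 ^ i.+1 <= 2 ^ K)%N by rewrite leq_exp2l.
  rewrite expnS in le.
  apply: wp_seq; apply: wp_set => //=; rewrite ?si ?spw//; [by ok|by ok|].
  apply: wp_set => //=; rewrite ?spw//; [by ok|by ok|].
  split=> /=; last by rewrite expnS; lia.
  move=> j; rewrite ltnS leq_eqVlt /=; case: PeanoNat.Nat.eqb_spec => [->//|/eqP ne].
  by rewrite (negbTE ne) /=; apply: sP.
- by move=> s' ag [sP spw]; apply: wp_set => //=; rewrite ?spw; ok.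
Qed.

Variables (T : nat).
Hypothesis inpT : forall i, - T%:Z <= inp i <= T%:Z.
Variables (m n k : nat) (cm : int).
Hypothesis cmT : - T%:Z <= cm <= T%:Z.
Hypothesis TV : (4 * T + 8 <= V)%N.
Hypothesis inV : (4 + (n + n) + m * n + n + m + 1 <= V)%N.
Hypothesis b_j : (n <= bnd v_j)%N.

Local Notation r := (in_release inp).
Local Notation d := (in_deadline inp n).
Local Notation p := (in_ptime inp n).

Lemma wp_low s : s v_n 0%N = n%:Z -> s v_cm 0%N = cm ->
  wp prog_low (fun s' => exists low, [/\ s' v_low 0%N = low, low <= cm,
    - T%:Z <= low <= T%:Z & forall j, (j < n)%N -> low <= r j]) s.
Proof.
move=> sn scm; apply: wp_seq; apply: wp_set => //=; rewrite ?scm; [by ok|by ok|].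
pose Inv (i : nat) (s' : state) := exists low, [/\ s' v_low 0%N = low, low <= cm,
    - T%:Z <= low <= T%:Z & forall j, (j < i)%N -> low <= r j].
apply: (wp_for (n := n) (Inv := Inv)) => //=; first by lia.
- by exists cm; split.
- move=> i s' iN si ag [low [sl lc lT lr]].
  have e4 : 4%N%:Z + i%:Z = (4 + i)%N%:Z by rewrite PoszD.
  have iT := inpT (4 + i)%N.
  apply: wp_if => /=; rewrite ?si ?sl ?e4 /=; first by ok.
  + move=> h; apply: wp_set => //=; rewrite ?si ?e4 /=; [by ok|by ok|].
    exists (r i); split=> //=; first by rewrite /in_release; lia.
    move=> j; rewrite ltnS leq_eqVlt => /orP[/eqP->//|/lr].
    by rewrite /in_release; lia.
  + move=> h; apply: wp_skip; exists low; split=> // j.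
    by rewrite ltnS leq_eqVlt => /orP[/eqP->|/lr//]; rewrite /in_release; lia.
Qed.

Lemma wp_digits s (a b v base x len : nat) : wfc (prog_digits a b v) ->
  a \notin [:: v_x; v_l] -> b \notin [:: v_x; v_l; a] -> (0 < base)%N ->
  s v_x 0%N = x%:Z -> s b 0%N = base%:Z -> s v 0%N = len%:Z ->
  (x <= V)%N -> (base <= V)%N -> (len <= V)%N -> (len <= bnd v_l)%N ->
  wp (prog_digits a b v) (fun s' => arr s' a len (dig base x)) s.
Proof.
rewrite !inE !negb_or => wf /andP[ax al] /and3P[bx bl ba] b0 sx sb sv xV bV lV lb.
pose Inv (i : nat) (s' : state) :=
  s' v_x 0%N = (x %/ base ^ i)%N%:Z /\ arr s' a i (dig base x).
apply: (wp_for (n := len) (Inv := Inv)) => //=.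
- by split=> //=; rewrite sx expn0 divn1.
- move=> i s' il si ag [sx' sA].
  have sb' : s' b 0%N = base%:Z by rewrite ag// !inE !negb_or bl bx ba.
  have dx : (x %/ base ^ i <= V)%N by apply: leq_trans xV; exact: leq_div.
  have dlt := dig_lt x i b0.
  have dxm : (x %/ base ^ i %/ base * base <= x %/ base ^ i)%N.
    by apply: leq_trunc_div.
  have dx1 : (x %/ base ^ i %/ base <= x %/ base ^ i)%N by apply: leq_div.
  apply: wp_seq; apply: wp_set => /=; rewrite ?si ?sx' ?sb' ?hmodE ?divz_nat //=.
  + by ok.
  + rewrite -/(dig base x i); move: dx dxm dx1.
    generalize (x %/ base ^ i %/ base)%N; generalize (x %/ base ^ i)%N.
    by move=> d1 d2 dx dxm dx1; ok.
  rewrite -/(dig base x i); set s1 := upd _ _ _ _.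
  have s1x : s1 v_x 0%N = (x %/ base ^ i)%N%:Z by rewrite /s1 upd_neq// eq_sym.
  have s1b : s1 b 0%N = base%:Z by rewrite /s1 upd_neq.
  have s1a l : s1 a l = if l == i then (dig base x i)%:Z else s' a l.
    by rewrite /s1 updE.
  clearbody s1; apply: wp_set => //=; rewrite ?s1x ?s1b ?divz_nat.
  + by ok.
  + move: dx dxm dx1.
    generalize (x %/ base ^ i %/ base)%N; generalize (x %/ base ^ i)%N.
    by move=> d1 d2 dx dxm dx1; ok.
  split=> /=; first by rewrite expnSr divnMA.
  move=> l li; rewrite !upd_neq// s1a.
  case: eqP => [->//|/eqP ne]; apply: sA.
  by move: li; rewrite ltnS leq_eqVlt (negbTE ne).
- by move=> s' ag [].
Qed.

Variables (N B kk K L NB LB TK : nat) (low : int) (FT C : nat -> nat).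
Hypotheses (N_gt0 : (0 < N)%N) (kk_gt0 : (0 < kk)%N) (B_gt0 : (0 < B)%N)
  (L_gt0 : (0 < L)%N).
Hypothesis KE : K = (B * kk)%N.
Hypothesis TKE : TK = (2 ^ K)%N.
Hypothesis FTk : forall i, (i < L * N)%N -> (FT i < kk)%N.
Hypothesis CB : forall S, (S < TK)%N -> (C S <= S)%N.
Hypothesis low_cm : low <= cm.
Hypothesis lowT : - T%:Z <= low <= T%:Z.
Hypothesis low_r : forall j, (j < n)%N -> low <= r j.
Hypothesis p_ge0 : forall i j, (j < n)%N -> 0 <= p i j.
Hypothesis TKV : (2 * TK + 4 <= V)%N.
Hypothesis LNV : (L * N + N + L + 2 <= V)%N.
Hypothesis KV : (K + kk + B + k + 2 <= V)%N.
Hypothesis NBV : (NB <= V)%N.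
Hypothesis LBV : (LB <= V)%N.
Hypothesis b_l : (B <= bnd v_l)%N.
Hypothesis b_S : (TK <= bnd v_S)%N.
Hypothesis b_mi : (m <= bnd v_mi)%N.
Hypothesis b_q : (N <= bnd v_q)%N.
Hypothesis b_t1 : (NB <= bnd v_t1)%N.
Hypothesis b_t2 : (LB <= bnd v_t2)%N.

Record search_ctx (s : state) : Prop := SearchCtx {
  sc_m : s v_m 0%N = m%:Z;
  sc_n : s v_n 0%N = n%:Z;
  sc_k : s v_k 0%N = k%:Z;
  sc_cm : s v_cm 0%N = cm;
  sc_N : s v_N 0%N = N%:Z;
  sc_B : s v_B 0%N = B%:Z;
  sc_B1 : s v_B1 0%N = B.-1%:Z;
  sc_kk : s v_kk 0%N = kk%:Z;
  sc_L : s v_L 0%N = L%:Z;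
  sc_NB : s v_NB 0%N = NB%:Z;
  sc_LB : s v_LB 0%N = LB%:Z;
  sc_TK : s v_TK 0%N = TK%:Z;
  sc_low : s v_low 0%N = low;
  sc_FT : arr s a_FT (L * N) FT;
  sc_PC : arr s a_PC TK C;
  sc_P2 : arr s a_P2 K (fun l => 2 ^ l)%N
}.

Lemma search_ctx_agree l s s' : agree l s s' ->
  all (fun x => x \notin l) [:: v_m; v_n; v_k; v_cm; v_N; v_B; v_B1; v_kk; v_L;
    v_NB; v_LB; v_TK; v_low; a_FT; a_PC; a_P2] ->
  search_ctx s -> search_ctx s'.
Proof.
move=> ag /allP h [*]; split; try (by rewrite ag// h// !inE ?eqxx ?orbT).
- by move=> i hi; rewrite ag ?h//; auto.
- by move=> i hi; rewrite ag ?h//; auto.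
- by move=> i hi; rewrite ag ?h//; auto.
Qed.

Lemma wp_colours s q t1 t2 : search_ctx s -> (q < N)%N -> (t1 <= V)%N -> (t2 <= V)%N ->
  s v_q 0%N = q%:Z -> s v_t1 0%N = t1%:Z -> s v_t2 0%N = t2%:Z ->
  wp prog_colours (fun s' =>
    arr s' a_PJ n (fun j => 2 ^ colour N B kk L FT q t1 t2 j)%N) s.
Proof.
move=> X qN t1V t2V sq st1 st2.
have BV : (B <= V)%N by lia.
have LV : (L <= V)%N by lia.
have NV : (N <= V)%N by lia.
apply: wp_seq; apply: wp_set => //=; rewrite ?st1; [by ok|by ok|].
apply: wp_seq; apply: wp_conseq.
  apply: (@wp_digits _ a_AT v_N v_B1 N t1 B.-1) => //=.
  - exact: sc_N X.
  - exact: sc_B1 X.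
  - by lia.
  - by lia.
move=> s1 ag1 sAT.
have X1 : search_ctx s1.
  by apply: search_ctx_agree ag1 _ _ => //; case: X => *; split.
have st2' : s1 v_t2 0%N = t2%:Z by rewrite ag1.
have sq1 : s1 v_q 0%N = q%:Z by rewrite ag1.
apply: wp_seq; apply: wp_set => //=; rewrite ?st2'; [by ok|by ok|].
apply: wp_seq; apply: wp_conseq.
  apply: (@wp_digits _ a_IX v_L v_B L t2 B) => //=.
  - exact: sc_L X1.
  - exact: sc_B X1.
move=> s2 ag2 sIX.
have X2 : search_ctx s2.
  by apply: search_ctx_agree ag2 _ _ => //; case: X1 => *; split.
have sAT2 : arr s2 a_AT B.-1 (dig N t1).
  by move=> i hi; rewrite ag2//=; apply: sAT.
have sq2 : s2 v_q 0%N = q%:Z by rewrite ag2.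
pose col := colour N B kk L FT q t1 t2.
apply: (wp_for (n := n) (Inv := fun i s' => arr s' a_PJ i (fun j => 2 ^ col j)%N)) => //=.
- exact: sc_n X2.
- by lia.
move=> j s3 jn sj ag3 sPJ.
have X3 : search_ctx s3 by exact: search_ctx_agree ag3 _ X2.
have sq3 : s3 v_q 0%N = q%:Z by rewrite ag3.
have sAT3 : arr s3 a_AT B.-1 (dig N t1).
  by move=> i hi; rewrite ag3//=; apply: sAT2.
have sIX3 : arr s3 a_IX B (dig L t2).
  by move=> i hi; rewrite ag3//=; apply: sIX.
pose y := (j %% q.+1)%N.
have yq : (y < q.+1)%N by rewrite ltn_pmod.
have q1 : q%:Z + 1 = q.+1%:Z by lia.
have jq : (j %/ q.+1 * q.+1 <= j)%N by apply: leq_trunc_div.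
have jq1 : (j %/ q.+1 <= j)%N by apply: leq_div.
apply: wp_seq; apply: wp_set => //=; rewrite ?sj ?sq3 ?q1 ?hmodE ?divz_nat -/y.
- by ok.
- by move: jq jq1; generalize (j %/ q.+1)%N => j1 jq jq1; ok.
apply: wp_seq; apply: wp_set => //=; [by ok|by ok|].
apply: wp_seq.
pose Inv (i : nat) (s' : state) :=
  s' v_beta 0%N = (count (fun l => dig N t1 l <= y)%N (iota 0 i))%:Z.
apply: (wp_for (n := B.-1) (Inv := Inv)) => //=.
- exact: sc_B1 X3.
- by lia.
- by lia.
- move=> i s4 iB si ag4; rewrite /Inv => sbeta.
  have sy4 : s4 v_yv 0%N = y%:Z by rewrite ag4.
  have sAT4 : s4 a_AT i = (dig N t1 i)%:Z by rewrite ag4//=; apply: sAT3.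
  have dN := dig_lt t1 i N_gt0.
  have cnt : (count (fun l => dig N t1 l <= y)%N (iota 0 i) <= i)%N.
    by rewrite -[X in (_ <= X)%N](size_iota 0 i) count_size.
  have -> : iota 0 i.+1 = iota 0 i ++ [:: i] by rewrite -addn1 iotaD.
  rewrite count_cat /= addn0.
  move: sbeta cnt; generalize (count (fun l => dig N t1 l <= y)%N (iota 0 i)) => c sbeta cnt.
  apply: wp_if => /=; rewrite ?sy4 ?si /= ?sAT4; first by ok.
  + move=> h; apply: wp_set => //=; rewrite ?sbeta; [by ok|by ok|].
    by have -> : (dig N t1 i <= y)%N by lia.
  + move=> h; apply: wp_skip => /=; rewrite sbeta.
    by have -> : (dig N t1 i <= y)%N = false; [lia|rewrite addn0].
move=> s4 ag4; rewrite /Inv -/(block N B t1 y) => sbeta.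
have bB : (block N B t1 y < B)%N by have := block_le N B t1 y; lia.
have X4 : search_ctx s4.
  apply: search_ctx_agree ag4 _ _ => //; case: X3 => *; split=> //.
have [hN hkk] := (sc_N X4, sc_kk X4).
have sy4 : s4 v_yv 0%N = y%:Z by rewrite ag4.
have sj4 : s4 v_j 0%N = j%:Z by rewrite ag4.
set bt := block N B t1 y in sbeta bB.
have sIX4 : s4 a_IX bt = (dig L t2 bt)%:Z by rewrite ag4//=; apply: sIX3.
have dL := dig_lt t2 bt L_gt0; set ix := dig L t2 bt in sIX4 dL.
have ixN : (ix * N + y < L * N)%N.
  have : (ix.+1 * N <= L * N)%N by rewrite leq_mul2r dL orbT.
  by rewrite mulSn; lia.
have ft : s4 a_FT (ix * N + y)%N = (FT (ix * N + y)%N)%:Z by apply: sc_FT X4 _ ixN.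
have ftk := FTk ixN.
have colE : col j = (bt * kk + FT (ix * N + y))%N by [].
have colK : (col j < K)%N.
  have : (bt.+1 * kk <= K)%N by rewrite KE leq_mul2r bB orbT.
  by rewrite colE mulSn; lia.
have p2 : s4 a_P2 (col j) = (2 ^ col j)%N%:Z by apply: sc_P2 X4 _ colK.
have p2le : (2 ^ col j <= TK)%N by rewrite TKE leq_exp2l// ltnW.
have btk : (bt * kk <= K)%N by rewrite KE leq_mul2r ltnW ?orbT.
rewrite colE in colK p2 p2le.
apply: wp_set => /=; rewrite ?sj4 ?sbeta /= ?hkk ?sIX4 ?hN ?sy4 -?PoszM -?PoszD /= ?ft -?PoszD /= ?p2.
- by [].
- by ok.
- by ok.
move=> i /=; rewrite ltnS leq_eqVlt; case: PeanoNat.Nat.eqb_spec => [->|/eqP ne].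
  by rewrite colE.
by rewrite (negbTE ne) /= => h; rewrite ag4//=; apply: sPJ.
Qed.

Section DP.
Variable col : nat -> nat.
Hypothesis colK : forall j, (j < n)%N -> (col j < K)%N.

Local Notation feas := (feas r d p col n low cm).
Local Notation is_min := (is_min r d p col n low cm).

Lemma is_min_bounds i S v : is_min i S v -> low <= v <= cm + 1.
Proof.
case=> h1 h2 _; rewrite h1 andbT; case: (leP v cm) => h; last by lia.
by have /andP[] := feas_bounds low_cm low_r p_ge0 (h2 h).
Qed.

(** An intermediate stage of entry [S]: attained if feasible, and no worse than leaving machine [i]
    idle or ending it with a job below [j]. For [j = n] the rules of [feas] offer no other case, and
    [is_min i.+1 S] results. *)
Definition min_upto (i S j : nat) (v : int) : Prop :=
  [/\ v <= cm + 1, v <= cm -> feas i.+1 S v,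
      forall t, feas i S t -> v <= low &
      forall j' t, (j' < j)%N -> odd (S %/ 2 ^ col j') ->
        feas i.+1 (S - 2 ^ col j')%N t ->
        Num.max t (r j') + p i j' <= d j' -> Num.max t (r j') + p i j' <= cm ->
        v <= Num.max t (r j') + p i j'].

(** Keeping only the earliest time is enough because [Num.max t (r j) + p i j] is monotone in [t]:
    whenever a later predecessor meets the deadline and the makespan bound, so does the earliest
    one, and it ends no later. *)
Lemma wp_relax s i S j : search_ctx s -> arr s a_PJ n (fun j => 2 ^ col j)%N ->
  (i < m)%N -> (S < TK)%N -> (j < n)%N -> s v_mi 0%N = i%:Z -> s v_S 0%N = S%:Z ->
  s v_j 0%N = j%:Z -> min_upto i S j (s a_F S) ->
  (forall S', (S' < S)%N -> is_min i.+1 S' (s a_F S')) ->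
  wp prog_relax (fun s' => min_upto i S j.+1 (s' a_F S) /\
    forall S', S' != S -> s' a_F S' = s a_F S') s.
Proof.
move=> X sPJ im ST jn si sS sj [v1 v2 v3 v4] prev.
have c0 : (0 < 2 ^ col j)%N by rewrite expn_gt0.
have cT : (2 ^ col j <= TK)%N by rewrite TKE leq_exp2l// ltnW// colK.
have PJ := sPJ j jn.
have [sn scm] := (sc_n X, sc_cm X).
have vB : low <= s a_F S <= cm + 1.
  rewrite v1 andbT; case: (leP (s a_F S) cm) => h; last by lia.
  by have /andP[] := feas_bounds low_cm low_r p_ge0 (v2 h).
have extend v : (odd (S %/ 2 ^ col j) -> forall t, feas i.+1 (S - 2 ^ col j)%N t ->
    Num.max t (r j) + p i j <= d j -> Num.max t (r j) + p i j <= cm ->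
    v <= Num.max t (r j) + p i j) -> v <= s a_F S ->
    (v <= cm -> feas i.+1 S v) -> min_upto i S j.+1 v.
  move=> hj vle hf; split=> //; first by lia.
    by move=> t ft; have := v3 _ ft; lia.
  move=> j' t; rewrite ltnS leq_eqVlt => /orP[/eqP->|j'j] o f l1 l2.
    exact: hj.
  by have := v4 j' t j'j o f l1 l2; lia.
have pj0 := p_ge0 i jn.
have S2 : (S %/ 2 ^ col j %/ 2 * 2 <= S %/ 2 ^ col j)%N by apply: leq_trunc_div.
have S1 : (S %/ 2 ^ col j <= S)%N by apply: leq_div.
have S3 : (S %/ 2 ^ col j %/ 2 <= S %/ 2 ^ col j)%N by apply: leq_div.
have e4 : 4%N%:Z + j%:Z = (4 + j)%N%:Z by rewrite PoszD.
have e4n : 4%N%:Z + n%:Z + j%:Z = (4 + n + j)%N%:Z by rewrite !PoszD.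
have e4p : 4%N%:Z + (n%:Z + n%:Z) + (i%:Z * n%:Z + j%:Z) =
    (4 + (n + n) + (i * n + j))%N%:Z by rewrite !PoszD PoszM.
have inm : (i * n + n <= m * n)%N.
  by have : (i.+1 * n <= m * n)%N by [rewrite leq_mul2r im orbT]; rewrite mulSn; lia.
have rT := inpT (4 + j)%N; have dT := inpT (4 + n + j)%N.
have pT := inpT (4 + (n + n) + (i * n + j))%N.
apply: wp_if => /=; rewrite ?sS ?sj /= ?PJ ?divz_nat ?hmod_natE.
- have := modn2 (S %/ 2 ^ col j); move: S1 S2 S3.
  generalize (S %/ 2 ^ col j %/ 2)%N (S %/ 2 ^ col j %% 2)%N.
  generalize (S %/ 2 ^ col j)%N => d1 d2 d3 S1 S2 S3 h.
  have : (d3 <= 1)%N by rewrite h leq_b1.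
  by move=> h'; ok.
- rewrite modn2; case o : (odd _) => // _.
  have [cS _] := bit_sub o.
  (* The smaller set was treated before [S], so its entry is already final for [i.+1] machines. *)
  have Sc : (S - 2 ^ col j < S)%N by lia.
  have mn := prev _ Sc; have /andP[mn1 mn2] := is_min_bounds mn.
  have [f1 f2 f3] := mn.
  have eS : S%:Z - (2 ^ col j)%N%:Z = (S - 2 ^ col j)%N%:Z by rewrite subzn.
  set v0 := s a_F (S - 2 ^ col j)%N in mn1 mn2 f1 f2 f3.
  apply: wp_seq; apply: wp_set => //=; rewrite ?sS ?sj /= ?PJ ?eS /= -/v0.
  + by ok.
  + by ok.
  apply: wp_seq; apply: (@wp_conseq _ _ _ _ (fun s' => s' v_t 0%N = Num.max v0 (r j) /\
      forall y, y != v_t -> s' y = s y)).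
    apply: wp_if => /=; rewrite ?sj ?e4 /=; first by ok.
    + move=> h; apply: wp_set => //=; rewrite ?sj ?e4 /=; [by ok|by ok|].
      split=> //=; first by rewrite max_r// /in_release; lia.
      by move=> y yt; rewrite !upd_neq.
    + move=> h; apply: wp_skip; split=> /=; first by rewrite max_l// /in_release; lia.
      by move=> y yt; rewrite !upd_neq.
  move=> s1 _ [st1 fr1].
  have mx : - T%:Z - 1 <= Num.max v0 (r j) <= T%:Z + 1.
    by rewrite /Num.max; case: ifP => _; rewrite /in_release; lia.
  have M0 : v0 <= Num.max v0 (r j) by rewrite le_max lexx.
  have Mmono t : v0 <= t -> Num.max v0 (r j) <= Num.max t (r j).
    by move=> h; rewrite ge_max !le_max h lexx orbT.
  have Mf : Num.max v0 (r j) + p i j <= d j -> Num.max v0 (r j) + p i j <= cm ->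
      feas i.+1 S (Num.max v0 (r j) + p i j).
    move=> h1 h2; apply: feas_job => //; apply: f2; apply: le_trans h2.
    by apply: le_trans M0 _; rewrite lerDl.
  move: (Num.max v0 (r j)) st1 mx M0 Mmono Mf => M st1 mx M0 Mmono Mf.
  apply: wp_seq; apply: wp_set => //=; rewrite ?st1 ?fr1// ?si ?sn ?sj /= ?e4p /=.
  + by ok.
  + by ok.
  set t' := _ + _.
  have t'B : - T%:Z - 1 <= t' <= T%:Z + T%:Z + 1 by move: pj0; rewrite /t' /in_ptime; lia.
  have t'f : t' <= d j -> t' <= cm -> feas i.+1 S t' by exact: Mf.
  have t'm t : feas i.+1 (S - 2 ^ col j)%N t -> t' <= Num.max t (r j) + p i j.
    by move=> /f3 h; rewrite /t' lerD2r; apply: Mmono.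
  clearbody t'; clear st1 mx Mmono Mf M0 M.
  have skip_ok : (t' <= d j -> t' <= cm -> s a_F S <= t') -> min_upto i S j.+1 (s a_F S).
    move=> h; apply: extend => // _ t ft l1 l2; have mono := t'm t ft.
    exact: le_trans (h (le_trans mono l1) (le_trans mono l2)) mono.
  apply: wp_if => /=; rewrite ?fr1//= ?sn ?sj ?e4n /=; first by ok.
  + move=> hd; apply: wp_if => /=; rewrite ?fr1//= ?scm; first by ok.
    * move=> hc; apply: wp_if => /=; rewrite ?fr1//= ?sS /= ?fr1//=; first by ok.
      -- move=> hv; apply: wp_set => //=; rewrite ?fr1//= ?sS//; [by ok|by ok|].
         split=> /=; last first.
           move=> S' ne.
           by case: PeanoNat.Nat.eqb_spec => // eS'; rewrite eS' eqxx in ne.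
         rewrite PeanoNat.Nat.eqb_refl; apply: extend; [|by lia|].
           by move=> _ t ft _ _; apply: t'm.
         by move=> _; apply: t'f; [rewrite /in_deadline; lia|lia].
      -- move=> hv; apply: wp_skip; split=> /=; last by move=> S' _; rewrite fr1.
         by rewrite fr1//; apply: skip_ok; lia.
    * move=> hc; apply: wp_skip; split=> /=; last by move=> S' _; rewrite fr1.
      by rewrite fr1//; apply: skip_ok; lia.
  + move=> hc; apply: wp_skip; split=> /=; last by move=> S' _; rewrite fr1.
    by rewrite fr1//; apply: skip_ok; rewrite /in_deadline; lia.
- rewrite modn2; case o : (odd _) => // _.
  by apply: wp_skip; split=> //; apply: extend => //; rewrite o.
Qed.

Lemma wp_dp s : search_ctx s -> arr s a_PJ n (fun j => 2 ^ col j)%N ->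
  wp prog_dp (fun s' => forall S, (S < TK)%N -> is_min m S (s' a_F S)) s.
Proof.
move=> X sPJ; have TK0 : (0 < TK)%N by rewrite TKE expn_gt0.
have [[scm sTK] slow] := (sc_cm X, sc_TK X, sc_low X).
apply: wp_seq.
apply: (wp_for (n := TK) (Inv := fun i s' =>
    forall S, (S < i)%N -> s' a_F S = cm + 1)) => //=; first by lia.
- move=> i s' iT si ag h.
  have scm' : s' v_cm 0%N = cm by rewrite ag.
  apply: wp_set => //=; rewrite ?si ?scm'//; [by ok|by ok|].
  move=> S; rewrite ltnS leq_eqVlt /=; case: PeanoNat.Nat.eqb_spec => [->//|/eqP ne].
  by rewrite (negbTE ne) /=; apply: h.
move=> s1 ag1 F1.
have X1 : search_ctx s1 by exact: search_ctx_agree ag1 _ X.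
have sPJ1 : arr s1 a_PJ n (fun j => 2 ^ col j)%N.
  by move=> j jn; rewrite ag1//=; apply: sPJ.
apply: wp_seq; apply: wp_set => //=; rewrite ?(sc_low X1); [by ok|by ok|].
set s2 := upd _ _ _ _.
have X2 : search_ctx s2 by case: X1 => *; split.
have sPJ2 : arr s2 a_PJ n (fun j => 2 ^ col j)%N by exact: sPJ1.
have feas0 S t : feas 0 S t -> S = 0%N /\ t = low.
  by move=> f; inversion f.
have F2 S : (S < TK)%N -> is_min 0 S (s2 a_F S).
  move=> ST; rewrite /s2 /=; case: S ST => [|S] ST /=.
    split; [by lia| |].
      by move=> _; exact: feas_empty.
    by move=> t /feas0[_ ->].
  rewrite F1//; split; [by []|by lia|].
  by move=> t /feas0[].
apply: (wp_for (n := m) (Inv := fun i s' =>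
    forall S, (S < TK)%N -> is_min i S (s' a_F S))) => //=.
- exact: sc_m X2.
- by lia.
move=> i s3 im si ag3 F3.
have X3 : search_ctx s3 by exact: search_ctx_agree ag3 _ X2.
have sPJ3 : arr s3 a_PJ n (fun j => 2 ^ col j)%N.
  by move=> j jn; rewrite ag3//=; apply: sPJ2.
apply: (wp_for (n := TK) (Inv := fun S s' =>
    (forall S', (S' < S)%N -> is_min i.+1 S' (s' a_F S')) /\
    (forall S', (S <= S' < TK)%N -> is_min i S' (s' a_F S')))) => //=.
- exact: sc_TK X3.
- by lia.
- move=> S s4 ST sS ag4 [F4 F4'].
  have X4 : search_ctx s4 by exact: search_ctx_agree ag4 _ X3.
  have sPJ4 : arr s4 a_PJ n (fun j => 2 ^ col j)%N.
    by move=> j jn; rewrite ag4//=; apply: sPJ3.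
  have si4 : s4 v_mi 0%N = i%:Z by rewrite ag4.
  have cur : is_min i S (s4 a_F S) by apply: F4'; rewrite leqnn.
  have /andP[c1 c2] := is_min_bounds cur; have [d1 d2 d3] := cur.
  have [scm4 slow4] := (sc_cm X4, sc_low X4).
  apply: wp_seq; apply: (@wp_conseq _ _ _ _ (fun s' => min_upto i S 0 (s' a_F S) /\
      forall S', S' != S -> s' a_F S' = s4 a_F S')).
    apply: wp_if => /=; rewrite ?sS /= ?scm4; first by ok.
    + move=> h; apply: wp_skip; split=> //; split=> //; first by lia.
      move=> t ft; have := d3 _ ft.
      by have /andP[] := feas_bounds low_cm low_r p_ge0 ft; lia.
    + move=> h; apply: wp_set => //=; rewrite ?sS ?slow4//; [by ok|by ok|].
      split=> /=; last first.
        move=> S' ne.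
        by case: PeanoNat.Nat.eqb_spec => // eS'; rewrite eS' eqxx in ne.
      rewrite PeanoNat.Nat.eqb_refl; split=> //; first by lia.
      by move=> _; apply: feas_machine; apply: d2; lia.
  move=> s5 ag5 [m5 fr5].
  have X5 : search_ctx s5 by exact: search_ctx_agree ag5 _ X4.
  have sPJ5 : arr s5 a_PJ n (fun j => 2 ^ col j)%N.
    by move=> j jn; rewrite ag5//=; apply: sPJ4.
  have si5 : s5 v_mi 0%N = i%:Z by rewrite ag5.
  have sS5 : s5 v_S 0%N = S%:Z by rewrite ag5.
  apply: (wp_for (n := n) (Inv := fun j s' => min_upto i S j (s' a_F S) /\
      forall S', S' != S -> s' a_F S' = s4 a_F S')) => //=.
  + exact: sc_n X5.
  + by lia.
  + move=> j s6 jn sj ag6 [m6 fr6].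
    have X6 : search_ctx s6 by exact: search_ctx_agree ag6 _ X5.
    have sPJ6 : arr s6 a_PJ n (fun j => 2 ^ col j)%N.
      by move=> j' jn'; rewrite ag6//=; apply: sPJ5.
    have si6 : s6 v_mi 0%N = i%:Z by rewrite ag6.
    have sS6 : s6 v_S 0%N = S%:Z by rewrite ag6.
    apply: wp_conseq; first apply: (wp_relax X6 sPJ6 im ST jn si6 sS6 sj m6).
      by move=> S' S'S; rewrite fr6; [apply: F4|lia].
    move=> s7 _ [m7 fr7]; split=> //= S' ne.
    by rewrite fr7// fr6.
  + move=> s6 ag6 [[e1 e2 e3 e4] fr6]; split=> /=.
      move=> S'; rewrite ltnS leq_eqVlt => /orP[/eqP->|S'S]; last first.
        by rewrite fr6; [apply: F4|lia].
      split=> // t ft; inversion ft as [|i0 S0 t0 ft0|i0 S0 j0 t0 jn o ft0 l1 l2]; subst.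
        exact: e3 ft0.
      exact: e4.
    move=> S' /andP[SS' S'T]; rewrite fr6; last by lia.
    by apply: F4'; rewrite S'T andbT ltnW.
- by move=> s4 ag4 [F4 _].
Qed.

Lemma wp_check s : search_ctx s ->
  (forall S, (S < TK)%N -> is_min m S (s a_F S)) ->
  (s v_ans 0%N = 0 \/ s v_ans 0%N = 1) ->
  wp prog_check (fun s' =>
    (s' v_ans 0%N = s v_ans 0%N \/ s' v_ans 0%N = 1) /\
    (s' v_ans 0%N = 1 <-> s v_ans 0%N = 1 \/
      exists S t, [/\ (S < TK)%N, feas m S t & (k <= C S)%N])) s.
Proof.
move=> X F a01.
apply: (wp_conseq (P := fun s' =>
  (s' v_ans 0%N = s v_ans 0%N \/ s' v_ans 0%N = 1) /\
    (s' v_ans 0%N = 1 <-> s v_ans 0%N = 1 \/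
      exists S, [/\ (S < TK)%N, s a_F S <= cm & (k <= C S)%N]))); last first.
  move=> s' _ [h1 h2]; split=> //; split=> [/h2[h|[S [ST Sc kC]]]|[h|[S [t [ST ft kC]]]]].
  - by left.
  - by right; exists S, (s a_F S); split=> //; have [_ + _] := F S ST; apply.
  - by apply/h2; left.
  - apply/h2; right; exists S; split=> //; have [_ _ h3] := F S ST.
    by have /andP[_] := feas_bounds low_cm low_r p_ge0 ft; have := h3 _ ft; lia.
apply: (wp_for (n := TK) (Inv := fun i s' =>
  (s' v_ans 0%N = s v_ans 0%N \/ s' v_ans 0%N = 1) /\
    (s' v_ans 0%N = 1 <-> s v_ans 0%N = 1 \/
      exists S, [/\ (S < i)%N, s a_F S <= cm & (k <= C S)%N]))) => //=.
- exact: sc_TK X.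
- by lia.
- split; first by left.
  by split=> [h|[//|[S []]]//]; left.
move=> S s' ST sS ag [h1 h2].
have X' : search_ctx s' by exact: search_ctx_agree ag _ X.
have FS : s' a_F S = s a_F S by rewrite ag.
have /andP[f1 f2] := is_min_bounds (F S ST).
have PC := sc_PC X' ST; have CS := CB ST.
have [scm sk] := (sc_cm X', sc_k X').
have keep : ~ (s a_F S <= cm /\ (k <= C S)%N) ->
    (s' v_ans 0%N = s v_ans 0%N \/ s' v_ans 0%N = 1) /\
    (s' v_ans 0%N = 1 <-> s v_ans 0%N = 1 \/
      exists S0, [/\ (S0 < S.+1)%N, s a_F S0 <= cm & (k <= C S0)%N]).
  move=> no; split=> //; rewrite h2; split=> -[h|[S0 [l1 l2 l3]]]; try by left.
    by right; exists S0; split=> //; lia.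
  right; exists S0; split=> //; move: l1; rewrite ltnS leq_eqVlt => /orP[/eqP e|//].
  by case: no; rewrite -e.
apply: wp_if => /=; rewrite ?sS /= ?FS ?scm; first by ok.
- move=> hF; apply: wp_if => /=; rewrite ?sS /= ?PC ?sk; first by ok.
  + move=> hC; apply: wp_set => //=; [by ok|by ok|].
    split; first by right.
    by split=> // _; right; exists S; split; lia.
  + by move=> hC; apply: wp_skip; apply: keep => -[_ h]; lia.
- by move=> hF; apply: wp_skip; apply: keep => -[h _]; lia.
Qed.

End DP.

Definition good (q t1 t2 : nat) : Prop := exists S t, [/\ (S < TK)%N,
  feas r d p (colour N B kk L FT q t1 t2) n low cm m S t & (k <= C S)%N].

(** An answer 1 must always be justified, whereas a good candidate must be noticed only if it lies
    in [P], the set of candidates examined so far, which the three nested loops extend in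
    lexicographic order. *)
Definition searched (P : nat -> nat -> nat -> Prop) (s : state) : Prop :=
  [/\ s v_ans 0%N = 0 \/ s v_ans 0%N = 1,
      s v_ans 0%N = 1 -> exists q t1 t2, (q < N)%N /\ good q t1 t2 &
      forall q t1 t2, P q t1 t2 -> good q t1 t2 -> s v_ans 0%N = 1].

Lemma wp_search s : search_ctx s -> s v_ans 0%N = 0 ->
  wp prog_search (searched (fun q t1 t2 =>
    [/\ (q < N)%N, (t1 < NB)%N & (t2 < LB)%N])) s.
Proof.
move=> X a0.
have weaken (P Q : nat -> nat -> nat -> Prop) s' s'' :
    s'' v_ans 0%N = s' v_ans 0%N -> (forall q t1 t2, Q q t1 t2 -> P q t1 t2) ->
    searched P s' -> searched Q s''.
  by move=> e PQ [h1 h2 h3]; split; rewrite ?e// => q t1 t2 /PQ; apply: h3.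
apply: (wp_for (n := N) (Inv := fun q => searched (fun q' t1 t2 =>
    [/\ (q' < q)%N, (t1 < NB)%N & (t2 < LB)%N]))) => //=.
- exact: sc_N X.
- by lia.
- by split; [left|rewrite /= a0|move=> q t1 t2 []].
move=> q s1 qN sq ag1 I1.
have X1 : search_ctx s1 by exact: search_ctx_agree ag1 _ X.
apply: (wp_for (n := NB) (Inv := fun t1 => searched (fun q' t1' t2 =>
    ([/\ (q' < q)%N, (t1' < NB)%N & (t2 < LB)%N]) \/
    ([/\ q' = q, (t1' < t1)%N & (t2 < LB)%N])))) => //=.
- exact: sc_NB X1.
- by apply: weaken I1 => // q' t1' t2' [|[]].
- move=> t1 s2 t1N st1 ag2 I2.
  have X2 : search_ctx s2 by exact: search_ctx_agree ag2 _ X1.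
  have sq2 : s2 v_q 0%N = q%:Z by rewrite ag2.
  apply: (wp_for (n := LB) (Inv := fun t2 => searched (fun q' t1' t2' =>
      ([/\ (q' < q)%N, (t1' < NB)%N & (t2' < LB)%N]) \/
      ([/\ q' = q, (t1' < t1)%N & (t2' < LB)%N]) \/
      ([/\ q' = q, t1' = t1 & (t2' < t2)%N])))) => //=.
  + exact: sc_LB X2.
  + by apply: weaken I2 => // q' t1' t2' [h|[h|[]]] //; [left|right].
  + move=> t2 s3 t2L st2 ag3 I3.
    have X3 : search_ctx s3 by exact: search_ctx_agree ag3 _ X2.
    have sq3 : s3 v_q 0%N = q%:Z by rewrite ag3.
    have st13 : s3 v_t1 0%N = t1%:Z by rewrite ag3.
    apply: wp_seq; apply: wp_conseq.
      by apply: (wp_colours X3 qN _ _ sq3 st13 st2); [lia|lia].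
    move=> s4 ag4 sPJ.
    have X4 : search_ctx s4 by exact: search_ctx_agree ag4 _ X3.
    have ck j : (j < n)%N -> (colour N B kk L FT q t1 t2 j < K)%N.
      by move=> _; rewrite KE; exact: colour_lt.
    apply: wp_seq; apply: wp_conseq; first exact: (wp_dp ck X4 sPJ).
    move=> s5 ag5 F5.
    have X5 : search_ctx s5 by exact: search_ctx_agree ag5 _ X4.
    have a5 : s5 v_ans 0%N = s3 v_ans 0%N by rewrite ag5// ag4.
    have [i1 i2 i3] := I3.
    apply: wp_conseq; first by apply: (wp_check X5 F5); rewrite a5.
    move=> s6 _; rewrite a5 => -[h1 h2]; split=> /=.
    * by case: h1 => ->; [|right].
    * move/h2 => [/i2//|[S [t [ST ft kC]]]].
      by exists q, t1, t2; split=> //; exists S, t.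
    * move=> q' t1' t2' h g; apply/h2.
      have [h'|e] : (([/\ (q' < q)%N, (t1' < NB)%N & (t2' < LB)%N]) \/
        ([/\ q' = q, (t1' < t1)%N & (t2' < LB)%N]) \/
        ([/\ q' = q, t1' = t1 & (t2' < t2)%N])) \/ [/\ q' = q, t1' = t1 & t2' = t2].
        case: h => [h|[h|[e1 e2]]]; [by left; left|by left; right; left|].
        rewrite ltnS leq_eqVlt => /orP[/eqP e3|h]; first by right.
        by left; right; right.
        by left; apply: i3 h' g.
      by right; case: e => e1 e2 e3; move: g; rewrite e1 e2 e3.
  + move=> s3 ag3 I3; apply: weaken I3 => // q' t1' t2' [h|[e1 h l]]; first by left.
    right; move: h; rewrite ltnS leq_eqVlt => /orP[/eqP e2|h]; last by left.
    by right.
- move=> s2 ag2 I2; apply: weaken I2 => // q' t1' t2' [h l1 l2].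
  move: h; rewrite ltnS leq_eqVlt => /orP[/eqP e2|h]; last by left.
  by right.
Qed.

End SearchProgram.

(** * Computation of the parameters and the main program *)

Definition prog_fact : hprog :=
  HLet v_fact (HC 1) ;;
  HFor v_l v_kk (HLet v_fact (HMul (HV v_fact) (HAdd (HV v_l) (HC 1)))).

Definition prog_sizes : hprog :=
  HLet v_x (HV v_n) ;; prog_log2 ;; HLet v_lg (HV v_b) ;;
  HLet v_N (HMul (HC (Posz 2))
    (HAdd (HMul (HMul (HV v_k) (HV v_k)) (HV v_lg)) (HAdd (HV v_k) (HC (Posz 8))))) ;;
  HLet v_x (HV v_N) ;; prog_log2 ;; HLet v_B (HV v_b) ;;
  HLet v_kk (HAdd (HDiv (HV v_k) (HV v_B)) (HC 1)) ;;
  HLet v_K (HMul (HV v_B) (HV v_kk)) ;;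
  HLet v_B1 (HSub (HV v_B) (HC 1)) ;;
  HLet v_x (HV v_N) ;; HLet v_w (HV v_kk) ;; prog_pow ;; HLet v_NK (HV v_b) ;;
  HLet v_x (HV v_kk) ;; HLet v_w (HV v_kk) ;; prog_pow ;; HLet v_D (HV v_b) ;;
  prog_fact ;;
  HLet v_D (HAdd (HDiv (HV v_D) (HV v_fact)) (HC 1)) ;;
  HLet v_L (HMul (HV v_D) (HAdd (HV v_K) (HC 1))) ;;
  HLet v_x (HV v_N) ;; HLet v_w (HV v_B1) ;; prog_pow ;; HLet v_NB (HV v_b) ;;
  HLet v_x (HV v_L) ;; HLet v_w (HV v_B) ;; prog_pow ;; HLet v_LB (HV v_b).

Definition prog_solve : hprog :=
  prog_sizes ;; prog_pow2 ;; prog_popcount ;; prog_low ;; prog_greedy ;;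
  HLet v_ans (HC 0) ;; prog_search.

Definition prog_main : hprog :=
  HLet v_m (HI (HC 0)) ;; HLet v_n (HI (HC 1)) ;;
  HLet v_k (HI (HC (Posz 2))) ;; HLet v_cm (HI (HC (Posz 3))) ;;
  HIf (HV v_k)
    (HIf (HAdd (HSub (HV v_n) (HV v_k)) (HC 1)) prog_solve (HLet v_ans (HC 0)))
    (HLet v_ans (HC 1)).

(** * Sizes of the parameters *)

Section Sizes.
Local Open Scope nat_scope.

Lemma leq_exp2rW a b e : a <= b -> a ^ e <= b ^ e.
Proof. by case: e => // e ab; rewrite leq_exp2r. Qed.

(** All moduli and residues are below [N]; there are [B] blocks of residues,
    [kk] colours for each block, [K] colours in total, and [L] functions in the
    hash family. *)
Definition size_lg (n : nat) : nat := (trunc_log 2 n).+1.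
Definition size_N (n k : nat) : nat := 2 * (k * k * size_lg n + (k + 8)).
Definition size_B (n k : nat) : nat := (trunc_log 2 (size_N n k)).+1.
Definition size_kk (n k : nat) : nat := (k %/ size_B n k).+1.
Definition size_K (n k : nat) : nat := size_B n k * size_kk n k.
Definition size_L (n k : nat) : nat :=
  rounds_unit (size_kk n k) * (size_K n k).+1.

Variables n k : nat.
Local Notation lg := (size_lg n).
Local Notation N := (size_N n k).
Local Notation B := (size_B n k).
Local Notation kk := (size_kk n k).
Local Notation K := (size_K n k).
Local Notation L := (size_L n k).

(** The summand [k + 8] of [size_N] serves this purpose: it leaves room for the padding up to [K]
    points and makes [N] at least 16. *)
Lemma size_N_ge : 2 * k + 16 <= N.
Proof. by rewrite /size_N; lia. Qed.

Lemma size_N_lt : N < 2 ^ B.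
Proof. exact: trunc_log_ltn. Qed.

(** As [N >= 16], the logarithm is at least 4, and [2 * (b + 1) <= 2 ^ b] for [b >= 4]. *)
Lemma size_B_double : 2 * B <= N.
Proof.
have h : 2 ^ B.-1 <= N by apply: trunc_logP => //; have := size_N_ge; lia.
have h4 : 4 <= B.-1.
  rewrite /size_B /=; apply: (@leq_trans (trunc_log 2 16)) => //.
  by apply: leq_trunc_log; have := size_N_ge; lia.
suff : 2 * (B.-1).+1 <= 2 ^ B.-1 by rewrite prednK; lia.
elim: (B.-1) h4 => // b IH; rewrite leq_eqVlt => /orP[/eqP<-//|].
by move=> /IH; rewrite expnS; lia.
Qed.

(** Rounding [k / B] up to [kk] adds at most one colour per block. *)
Lemma size_K_bounds : k <= K <= k + B.
Proof.
rewrite /size_K /size_kk mulnS addnC mulnC leq_add2r leq_trunc_div andbT.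
by have := ltn_ceil k (ltn0Sn (trunc_log 2 N)); rewrite -/B mulSn; lia.
Qed.

Lemma size_K_le : K <= N.
Proof.
by have := size_K_bounds; have := size_B_double; have := size_N_ge; lia.
Qed.

Lemma size_kk_le : kk <= K.
Proof. by rewrite /size_K leq_pmull. Qed.

Lemma size_NK_lt : N ^ kk < 2 ^ K.
Proof. by rewrite /size_K expnM ltn_exp2r// size_N_lt. Qed.

Lemma size_kkkk_lt : kk ^ kk < 2 ^ K.
Proof.
apply: leq_ltn_trans size_NK_lt; rewrite leq_exp2r//.
exact: leq_trans size_kk_le size_K_le.
Qed.

Lemma rounds_unit_le : rounds_unit kk <= 2 ^ K.
Proof.
rewrite /rounds_unit; apply: leq_ltn_trans size_kkkk_lt; exact: leq_div.
Qed.

Lemma size_L_le : L <= 2 ^ (2 * N + 1).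
Proof.
have h1 := rounds_unit_le; have h2 : K.+1 <= 2 ^ K.+1 by rewrite ltnW// ltn_expl.
apply: leq_trans (leq_mul h1 h2) _; rewrite -expnD leq_exp2l//.
by have := size_K_le; lia.
Qed.

Lemma size_NB_le : N ^ B.-1 <= 2 ^ (N * N).
Proof.
apply: leq_trans (_ : (2 ^ N) ^ N <= _); last by rewrite expnM.
apply: leq_trans (_ : (2 ^ N) ^ B.-1 <= _); last first.
  rewrite leq_pexp2l ?expn_gt0//; have := size_B_double; lia.
by apply: leq_exp2rW; rewrite ltnW// ltn_expl.
Qed.

Lemma size_LB_le : L ^ B <= 2 ^ ((2 * N + 1) * N).
Proof.
rewrite expnM; apply: leq_trans (_ : (2 ^ (2 * N + 1)) ^ B <= _).
  by apply: leq_exp2rW; exact: size_L_le.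
by rewrite leq_pexp2l ?expn_gt0//; have := size_B_double; lia.
Qed.

End Sizes.

(** * Symbolic execution of the parameter computation *)

Fixpoint holds (e : seq (nat * int)) (s : state) : Prop :=
  if e is (x, v) :: e' then s x 0%N = v /\ holds e' s else True.

Arguments holds : simpl never.

Lemma holds_cons x v e s : s x 0%N = v -> holds e s -> holds ((x, v) :: e) s.
Proof. by []. Qed.

(** Forgets the variables that a command may modify. It computes on concrete lists, so that the
    facts surviving a long sequence of assignments are found by simplification. *)
Definition drop_vars (l : seq nat) (e : seq (nat * int)) : seq (nat * int) :=
  [seq xv <- e | ~~ has (Nat.eqb xv.1) l].

Lemma holds_agree l e s s' : agree l s s' -> holds e s -> holds (drop_vars l e) s'.
Proof.
move=> ag; elim: e => [//|[x v] e IH] [sx /IH h]; rewrite /drop_vars /=; case: ifP => //= xl.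
split=> //; rewrite ag//; apply/negP => h'; move/hasPn: xl => /(_ x h').
by rewrite PeanoNat.Nat.eqb_refl.
Qed.

Lemma wp_call V bnd inp e c (P Q : state -> Prop) s : holds e s ->
  wp V bnd inp c P s ->
  (forall s', P s' -> holds (drop_vars (mods c) e) s' -> Q s') ->
  wp V bnd inp c Q s.
Proof.
move=> he hc hQ; apply: wp_conseq hc _ => s' ag hP; apply: hQ => //.
exact: holds_agree ag he.
Qed.

Lemma wp_let V bnd inp e x ex v (Q : state -> Prop) s : holds e s ->
  oke V inp s ex -> heval inp s ex = v ->
  (forall s', holds ((x, v) :: drop_vars [:: x] e) s' -> Q s') ->
  wp V bnd inp (HLet x ex) Q s.
Proof.
move=> he ok ev hQ; apply: (@wp_call _ _ _ e _ (fun s' => s' x 0%N = v)) => //.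
  apply: wp_set => //=; first by rewrite /bounded; lia.
  by rewrite ev upd_eq.
by move=> s' sx h; apply: hQ.
Qed.

Section SizesProgram.
Variables (V : nat) (bnd : nat -> nat) (inp : nat -> int).
Local Notation wp := (wp V bnd inp).
Variables (n k lg N B kk K L : nat).
Hypotheses (k_gt0 : (0 < k)%N) (kn : (k <= n)%N).
Hypothesis lgE : lg = (trunc_log 2 n).+1.
Hypothesis NE : N = (2 * (k * k * lg + (k + 8)))%N.
Hypothesis BE : B = (trunc_log 2 N).+1.
Hypothesis kkE : kk = (k %/ B).+1.
Hypothesis KE : K = (B * kk)%N.
Hypothesis LE : L = (rounds_unit kk * K.+1)%N.
Hypothesis nV : (2 * n + 4 * N + 16 <= V)%N.
Hypothesis KV : (K + B + 2 ^ K <= V)%N.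
Hypothesis kkV : (kk ^ kk < 2 ^ K)%N.
Hypothesis NKV : (N ^ kk < 2 ^ K)%N.
Hypothesis LV : (L <= V)%N.
Hypothesis NBV : (N ^ B.-1 <= V)%N.
Hypothesis LBV : (L ^ B <= V)%N.
Hypothesis b_i : (n + N + B + kk <= bnd v_i)%N.
Hypothesis b_l : (kk <= bnd v_l)%N.

Ltac ok := repeat split; rewrite /bounded /=; try lia.
Ltac rwenv H := rewrite /holds in H; repeat (let h := fresh "h" in case: H => h H; rewrite ?h).

Lemma wp_fact s : s v_kk 0%N = kk%:Z ->
  wp prog_fact (fun s' => s' v_fact 0%N = (kk`!)%N%:Z) s.
Proof.
move=> skk; have kkV' : (kk <= K)%N by rewrite KE BE; lia.
have fle i : (i <= kk)%N -> (i`! <= kk ^ i)%N.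
  by elim: i => [//|i IH] h; rewrite factS expnS leq_mul// IH// ltnW.
have pw i : (i <= kk)%N -> (i`! <= V)%N.
  move=> ik; apply: leq_trans (fle i ik) _.
  have : (kk ^ i <= kk ^ kk)%N by rewrite leq_pexp2l// kkE.
  by lia.
have V0 : (16 <= V)%N by lia.
apply: wp_seq; apply: wp_set => //=; [by ok|by ok|].
apply: (wp_for (n := kk) (Inv := fun i s' => s' v_fact 0%N = (i`!)%N%:Z)) => //=.
  by lia.
move=> i s' ik si ag sf.
have e1 : i%:Z + 1 = i.+1%:Z by lia.
have := pw _ ik; have := pw _ (ltnW ik); rewrite factS mulnC => h1 h2.
apply: wp_set => //=; rewrite ?sf ?si ?e1 -?PoszM; [by ok|by ok|by []].
Qed.

Lemma wp_sizes s : s v_n 0%N = n%:Z -> s v_k 0%N = k%:Z ->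
  wp prog_sizes (holds [:: (v_LB, (L ^ B)%N%:Z); (v_NB, (N ^ B.-1)%N%:Z);
    (v_L, L%:Z); (v_NK, (N ^ kk)%N%:Z); (v_B1, B.-1%:Z); (v_K, K%:Z);
    (v_kk, kk%:Z); (v_B, B%:Z); (v_N, N%:Z)]) s.
Proof.
move=> sn sk; have n0 : (0 < n)%N by lia.
have N0 : (0 < N)%N by lia.
have kk0 : (0 < kk)%N by rewrite kkE.
have B0 : (0 < B)%N by rewrite BE.
have kkK : (kk <= K)%N by rewrite KE leq_pmull.
have L0 : (0 < L)%N by rewrite LE muln_gt0.
have lgN : (k * k * lg + (k + 8) <= N)%N by rewrite NE; lia.
have lg0 : (0 < lg)%N by rewrite lgE.
have lgle : (lg <= k * k * lg)%N by rewrite leq_pmull// muln_gt0 k_gt0.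
have kkle : (k * k <= k * k * lg)%N by rewrite leq_pmulr.
have H : holds [:: (v_n, n%:Z); (v_k, k%:Z)] s by [].
apply: wp_seq; apply: (wp_let bnd (v := n%:Z) H); [by rwenv H; ok|by rwenv H|].
move=> {H sn sk} {}s; rewrite /drop_vars /= => H.
apply: wp_seq; apply: (wp_call H).
  by apply: wp_log2 n0 _ _ _; rwenv H => //; lia.
move=> {H} {}s; rewrite -lgE => sb; rewrite /drop_vars /= => H.
apply: wp_seq; apply: (wp_let bnd (v := lg%:Z) (holds_cons sb H)); [by rewrite /= sb; ok|by []|].
move=> {H sb} {}s; rewrite /drop_vars /= => H.
apply: wp_seq; apply: (wp_let bnd (v := N%:Z) H).
  by rewrite /=; rwenv H; ok.
  by rewrite /=; rwenv H; rewrite NE; lia.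
move=> {H} {}s; rewrite /drop_vars /= => H.
apply: wp_seq; apply: (wp_let bnd (v := N%:Z) H); [by rwenv H; ok|by rwenv H|].
move=> {H} {}s; rewrite /drop_vars /= => H.
apply: wp_seq; apply: (wp_call H).
  by apply: wp_log2 N0 _ _ _; rwenv H => //; lia.
move=> {H} {}s; rewrite -BE => sb; rewrite /drop_vars /= => H.
apply: wp_seq; apply: (wp_let bnd (v := B%:Z) (holds_cons sb H)); [by rewrite /= sb; ok|by []|].
move=> {H sb} {}s; rewrite /drop_vars /= => H.
have kB : (k %/ B <= k)%N by exact: leq_div.
apply: wp_seq; apply: (wp_let bnd (v := kk%:Z) H).
  by rewrite /=; rwenv H; rewrite divz_nat; move: kB; generalize (k %/ B)%N => kB' ?; ok.
  by rewrite /=; rwenv H; rewrite divz_nat kkE -addn1 PoszD.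
move=> {H} {}s; rewrite /drop_vars /= => H.
apply: wp_seq; apply: (wp_let bnd (v := K%:Z) H).
  by rewrite /=; rwenv H; rewrite -PoszM -KE; ok.
  by rewrite /=; rwenv H; rewrite -PoszM -KE.
move=> {H} {}s; rewrite /drop_vars /= => H.
apply: wp_seq; apply: (wp_let bnd (v := B.-1%:Z) H).
  by rwenv H; ok.
  by rewrite /=; rwenv H; lia.
move=> {H} {}s; rewrite /drop_vars /= => H.
apply: wp_seq; apply: (wp_let bnd (v := N%:Z) H); [by rwenv H; ok|by rwenv H|].
move=> {H} {}s; rewrite /drop_vars /= => H.
apply: wp_seq; apply: (wp_let bnd (v := kk%:Z) H); [by rwenv H; ok|by rwenv H|].
move=> {H} {}s; rewrite /drop_vars /= => H.
apply: wp_seq; apply: (wp_call H).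
  by apply: (@wp_pow V bnd inp s N kk) => //; rwenv H => //; lia.
move=> {H} {}s sb; rewrite /drop_vars /= => H.
apply: wp_seq; apply: (wp_let bnd (v := (N ^ kk)%N%:Z) (holds_cons sb H)); [by rewrite /= sb; ok|by []|].
move=> {H sb} {}s; rewrite /drop_vars /= => H.
apply: wp_seq; apply: (wp_let bnd (v := kk%:Z) H); [by rwenv H; ok|by rwenv H|].
move=> {H} {}s; rewrite /drop_vars /= => H.
apply: wp_seq; apply: (wp_let bnd (v := kk%:Z) H); [by rwenv H; ok|by rwenv H|].
move=> {H} {}s; rewrite /drop_vars /= => H.
apply: wp_seq; apply: (wp_call H).
  by apply: (@wp_pow V bnd inp s kk kk) => //; rwenv H => //; lia.
move=> {H} {}s sb; rewrite /drop_vars /= => H.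
apply: wp_seq; apply: (wp_let bnd (v := (kk ^ kk)%N%:Z) (holds_cons sb H)); [by rewrite /= sb; ok|by []|].
move=> {H sb} {}s; rewrite /drop_vars /= => H.
apply: wp_seq; apply: (wp_call H).
  by apply: wp_fact; rwenv H.
move=> {H} {}s sb; rewrite /drop_vars /= => H.
have fV : (kk`! <= V)%N.
  suff h : (kk`! <= kk ^ kk)%N by lia.
  have fle i : (i <= kk)%N -> (i`! <= kk ^ i)%N.
    by elim: i => [//|i IH] h; rewrite factS expnS leq_mul// IH// ltnW.
  exact: fle.
have ruV : (rounds_unit kk <= V)%N.
  by apply: leq_trans LV; rewrite LE leq_pmulr.
have dV : (kk ^ kk %/ kk`! < V)%N by [].
apply: wp_seq; apply: (wp_let bnd (v := (rounds_unit kk)%:Z) (holds_cons sb H)).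
  by rewrite /= sb; rwenv H; rewrite divz_nat; move: dV; generalize (kk ^ kk %/ kk`!)%N => dd ?; ok.
  by rewrite /= sb; rwenv H; rewrite divz_nat /rounds_unit -addn1 PoszD.
move=> {H sb} {}s; rewrite /drop_vars /= => H.
have K1 : K%:Z + 1 = K.+1%:Z by lia.
apply: wp_seq; apply: (wp_let bnd (v := L%:Z) H).
  by rewrite /=; rwenv H; rewrite K1 -PoszM -LE; ok.
  by rewrite /=; rwenv H; rewrite K1 -PoszM -LE.
move=> {H} {}s; rewrite /drop_vars /= => H.
apply: wp_seq; apply: (wp_let bnd (v := N%:Z) H); [by rwenv H; ok|by rwenv H|].
move=> {H} {}s; rewrite /drop_vars /= => H.
apply: wp_seq; apply: (wp_let bnd (v := B.-1%:Z) H); [by rwenv H; ok|by rwenv H|].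
move=> {H} {}s; rewrite /drop_vars /= => H.
apply: wp_seq; apply: (wp_call H).
  by apply: (@wp_pow V bnd inp s N B.-1) => //; rwenv H => //; lia.
move=> {H} {}s sb; rewrite /drop_vars /= => H.
apply: wp_seq; apply: (wp_let bnd (v := (N ^ B.-1)%N%:Z) (holds_cons sb H)); [by rewrite /= sb; ok|by []|].
move=> {H sb} {}s; rewrite /drop_vars /= => H.
apply: wp_seq; apply: (wp_let bnd (v := L%:Z) H); [by rwenv H; ok|by rwenv H|].
move=> {H} {}s; rewrite /drop_vars /= => H.
apply: wp_seq; apply: (wp_let bnd (v := B%:Z) H); [by rwenv H; ok|by rwenv H|].
move=> {H} {}s; rewrite /drop_vars /= => H.
apply: wp_seq; apply: (wp_call H).
  by apply: (@wp_pow V bnd inp s L B) => //; rwenv H => //; lia.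
move=> {H} {}s sb; rewrite /drop_vars /= => H.
apply: (wp_let bnd (v := (L ^ B)%N%:Z) (holds_cons sb H)); [by rewrite /= sb; ok|by []|].
by move=> {H sb} {}s; rewrite /drop_vars /= => H; rwenv H; split.
Qed.

End SizesProgram.

(** * Correctness *)

Section Encoding.
Variable I : sched_instance.
Local Notation m := (machines I).
Local Notation n := (jobs I).

Definition word (i : nat) : int := (sched_encode I)`_i.

Lemma size_sched_encode : size (sched_encode I) = (4 + (n + n) + m * n)%N.
Proof.
rewrite /sched_encode !size_cat !size_map size_allpairs -!enumT !size_enum_ord /=.
by lia.
Qed.

Lemma word_m : word 0 = m%:Z. Proof. by []. Qed.
Lemma word_n : word 1 = n%:Z. Proof. by []. Qed.
Lemma word_k : word 2 = (target I)%:Z. Proof. by []. Qed.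
Lemma word_cmax : word 3 = cmax I. Proof. by []. Qed.

Lemma word_release (j : 'I_n) : in_release word j = release j.
Proof.
rewrite /in_release /word /sched_encode /= add0n nth_cat size_map size_enum_ord ltn_ord.
by rewrite (nth_map j) ?size_enum_ord// nth_ord_enum.
Qed.

Lemma word_deadline (j : 'I_n) : in_deadline word n j = deadline j.
Proof.
rewrite /in_deadline /word /sched_encode /= nth_cat size_map size_enum_ord.
rewrite ltnNge leq_addr /= addKn nth_cat size_map size_enum_ord ltn_ord.
by rewrite (nth_map j) ?size_enum_ord// nth_ord_enum.
Qed.

Lemma nth_allpairs_row (S T : Type) (f : S -> T -> int) (xs : seq S) (ys : seq T) x0 y0 i j :
  (i < size xs)%N -> (j < size ys)%N ->
  nth 0 [seq f x y | x <- xs, y <- ys] (i * size ys + j) = f (nth x0 xs i) (nth y0 ys j).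
Proof.
move=> ix jy; elim: xs i ix => [//|x xs IH] [|i] ix.
  by rewrite /= nth_cat size_map mul0n add0n jy (nth_map y0).
rewrite allpairs_cons nth_cat size_map mulSn -addnA ltnNge leq_addr /= addKn.
by rewrite IH.
Qed.

Lemma word_ptime (i : 'I_m) (j : 'I_n) : in_ptime word n i j = (ptime i j)%:Z.
Proof.
rewrite /in_ptime /word /sched_encode.
have -> : (4 + (n + n) + (i * n + j) = 4 + (n + (n + (i * n + j))))%N by lia.
rewrite /= add0n nth_cat size_map size_enum_ord.
rewrite ltnNge leq_addr /= addKn nth_cat size_map size_enum_ord.
rewrite ltnNge leq_addr /= addKn.
have := @nth_allpairs_row _ _ (fun (i : 'I_m) (j : 'I_n) => Posz (ptime i j))
  (enum 'I_m) (enum 'I_n) i j i j.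
rewrite !size_enum_ord !ltn_ord => -> //.
by rewrite !nth_ord_enum.
Qed.

Lemma in_ptime_ge0 i j : (j < n)%N -> 0 <= in_ptime word n i j.
Proof.
move=> jn; case: (ltnP i m) => im.
  by have := word_ptime (Ordinal im) (Ordinal jn) => /= ->.
(* Beyond the last machine the address lies past the end of the input, where cells hold 0. *)
rewrite /in_ptime /word nth_default// size_sched_encode.
have : (m * n <= i * n)%N by rewrite leq_mul2r im orbT.
by lia.
Qed.

Local Notation sz := (\sum_(z <- sched_encode I) bitlen z)%N.

Lemma word_bitlen i : (bitlen (word i) <= sz)%N.
Proof.
case: (ltnP i (size (sched_encode I))) => h.
  have := mem_nth 0 h; rewrite -/(word i) => w.
  by rewrite (perm_big _ (perm_to_rem w)) big_cons leq_addr.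
rewrite /word nth_default//.
by rewrite /sched_encode big_cons.
Qed.

Lemma word_bound i : - (2 ^ sz)%N%:Z <= word i <= (2 ^ sz)%N%:Z.
Proof.
have h : (`|word i| < 2 ^ sz)%N.
  apply: leq_trans (_ : 2 ^ bitlen (word i) <= _)%N.
    exact: trunc_log_ltn.
  by rewrite leq_exp2l// word_bitlen.
by lia.
Qed.

Lemma sched_size_ge : (4 + (n + n) + m * n <= sz)%N.
Proof.
rewrite -size_sched_encode -sum1_size; apply: leq_sum => z _.
exact: bitlen_gt0.
Qed.

End Encoding.

Lemma uniq_map_inj (S T : eqType) (f : S -> T) (s : seq S) :
  uniq [seq f x | x <- s] -> {in s &, injective f}.
Proof.
elim: s => [//|x s IH] /= /andP[fx us] a b; rewrite !inE.
move=> /orP[/eqP->|ha] /orP[/eqP->|hb] // e.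
- by rewrite e map_f in fx.
- by rewrite -e map_f in fx.
- exact: IH.
Qed.

Section Correctness.
Import mathcomp.boot.fintype mathcomp.boot.finset.
Variables (R : realType) (I : sched_instance).
Local Notation m := (machines I).
Local Notation n := (jobs I).
Local Notation k := (target I).
Local Notation inp := (word I).
Hypotheses (k_gt0 : (0 < k)%N) (kn : (k <= n)%N).
Local Notation N := (size_N n k).
Local Notation B := (size_B n k).
Local Notation kk := (size_kk n k).
Local Notation K := (size_K n k).
Local Notation L := (size_L n k).
Variables (low : int) (FT C : nat -> nat).
Hypothesis low_cm : low <= cmax I.
Hypothesis low_r : forall j, (j < n)%N -> low <= in_release inp j.
Hypothesis C0 : C 0%N = 0%N.
Hypothesis CS : forall S, (S < 2 ^ K)%N -> C S = (C (S %/ 2) + odd S)%N.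
Hypothesis FTk : forall i, (i < L * N)%N -> (FT i < kk)%N.
Hypothesis FTp : perfect_family N kk L FT.

Local Notation good := (good inp m n k (cmax I) N B kk L (2 ^ K) low FT C).

Let N_gt0 : (0 < N)%N. Proof. by have := size_N_ge n k; lia. Qed.

Let L_gt0 : (0 < L)%N. Proof. by rewrite muln_gt0. Qed.

Lemma good_sound q t1 t2 : good q t1 t2 -> sched_yes R I.
Proof.
move=> [S [t [ST ft kC]]].
have [s [v mk card _ _]] := feas_sound R (@word_release I) (@word_deadline I)
  (@word_ptime I) low_cm C0 CS ft (leqnn _) ST.
by exists s; split=> //; rewrite card.
Qed.

(** The schedule may select more jobs than the colouring can separate, so exactly [k] of them are
    kept. A small modulus makes their residues distinct, and [colour_exists] then yields boundaries
    and rows. *)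
Lemma good_complete : sched_yes R I -> exists q t1 t2,
  [/\ (q < N)%N, (t1 < N ^ B.-1)%N, (t2 < L ^ B)%N & good q t1 t2].
Proof.
move=> [s [v ks mk]].
pose sq := take k (enum (selected s)).
pose A := [set j in sq].
have usq : uniq sq by rewrite take_uniq// enum_uniq.
have ssq : size sq = k by rewrite size_takel// -cardE.
have As : A \subset selected s.
  by apply/subsetP => j; rewrite inE => /mem_take; rewrite mem_enum.
have eA : perm_eq (enum A) sq.
  by apply: uniq_perm; rewrite ?enum_uniq// => j; rewrite mem_enum inE.
pose J := [seq nat_of_ord j | j <- sq].
have uJ : uniq J by rewrite map_inj_uniq//; apply: val_inj.
have sJ : size J = k by rewrite size_map.
have Jn : {in J, forall x, (x < n)%N} by move=> x /mapP[j _ ->].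
have lgn : (n <= 2 ^ size_lg n)%N by rewrite ltnW// trunc_log_ltn.
have [||||q] := @modn_separates J n (size_lg n) uJ; rewrite ?sJ//.
move=> qlt uq; have qN : (q < N)%N by rewrite /size_N; lia.
have FTk' r y : (r < L)%N -> (y < N)%N -> (FT (r * N + y) < kk)%N.
  move=> rL yN; apply: FTk.
  have : (r.+1 * N <= L * N)%N by rewrite leq_mul2r rL orbT.
  by rewrite mulSn; lia.
have [||t1 [t2 [t1N t2L ucol]]] :=
  @colour_exists N B kk L FT J q isT isT N_gt0 FTp FTk' uq qN.
- by rewrite sJ; have /andP[] := size_K_bounds n k.
- exact: size_K_le.
exists q, t1, t2; split=> //.
pose col := colour N B kk L FT q t1 t2.
have ucol' : uniq [seq col j | j : 'I_n <- enum A].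
  rewrite (perm_uniq (perm_map _ eA)); move: ucol; rewrite /J -map_comp.
  by rewrite (eq_map (g := fun j : 'I_n => col j)).
have inj : {in A &, injective (fun j : 'I_n => col j)}.
  move=> a b aA bA; apply: (uniq_map_inj ucol'); by rewrite mem_enum.
have colour_lt_K j : (col j < K)%N.
  exact: colour_lt.
have colK : {in [seq col j | j : 'I_n <- enum A], forall c, (c < K)%N}.
  by move=> c /mapP[j _ ->]; exact: colour_lt_K.
have [t ft] := feas_complete (@word_release I) (@word_deadline I) (@word_ptime I)
  low_cm low_r v mk As inj.
exists (mask [seq col j | j : 'I_n <- enum A]), t; split=> //.
  exact: mask_lt.
by rewrite (popcount_mask C0 CS)// size_map (perm_size eA) ssq.
Qed.

End Correctness.

(** * Bounds on values and loops, and correctness of the complete program *)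

Section Solve.
Variables (R : realType) (I : sched_instance).
Local Notation m := (machines I).
Local Notation n := (jobs I).
Local Notation k := (target I).
Local Notation inp := (word I).
Local Notation sz := (\sum_(z <- sched_encode I) bitlen z)%N.
Local Notation N := (size_N n k).
Local Notation B := (size_B n k).
Local Notation kk := (size_kk n k).
Local Notation K := (size_K n k).
Local Notation L := (size_L n k).

(** The input numbers are at most [2 ^ sz]; [(2 * N + 1) * N] is the exponent bounding [L ^ B] and
    also covers [N ^ B.-1]; [4 * N] leaves room for products such as [L * N] and [N ^ kk * kk ^ kk],
    and 8 for numerical constants. *)
Definition value_bound : nat := (2 ^ (sz + ((2 * N + 1) * N) + 4 * N + 8))%N.

Definition loop_bound (x : nat) : nat :=
  (if Nat.eqb x v_i then n + N + B + kk
  else if Nat.eqb x v_l then K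
  else if Nat.eqb x v_l2 then kk
  else if Nat.eqb x v_u then N ^ kk
  else if Nat.eqb x v_c then kk
  else if Nat.eqb x v_y then N
  else if Nat.eqb x v_rho then L
  else if Nat.eqb x v_S then 2 ^ K
  else if Nat.eqb x v_j then n
  else if Nat.eqb x v_mi then m
  else if Nat.eqb x v_q then N
  else if Nat.eqb x v_t1 then N ^ B.-1
  else if Nat.eqb x v_t2 then L ^ B
  else 0)%N.

Definition decides (s : state) : Prop :=
  (sched_yes R I /\ s v_ans 0%N = 1) \/ (~ sched_yes R I /\ s v_ans 0%N = 0).

Local Notation V := value_bound.

Record value_bounds : Prop := ValueBounds {
  vb_n : (2 * n + 4 * N + 16 <= V)%N;
  vb_K : (K + B + 2 ^ K <= V)%N;
  vb_L : (L <= V)%N;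
  vb_NB : (N ^ B.-1 <= V)%N;
  vb_LB : (L ^ B <= V)%N;
  vb_N : (2 * (N + kk) + 2 <= V)%N;
  vb_NK : (N ^ kk * kk ^ kk + N ^ kk + 1 <= V)%N;
  vb_LN : (L * N + N + L + 2 <= V)%N;
  vb_TK : (2 * 2 ^ K + 4 <= V)%N;
  vb_T : (4 * 2 ^ sz + 8 <= V)%N;
  vb_in : (4 + (n + n) + m * n + n + m + 1 <= V)%N;
  vb_sum : (K + kk + B + k + 2 <= V)%N
}.

Hypotheses (k_gt0 : (0 < k)%N) (kn : (k <= n)%N).

Lemma value_boundsP : value_bounds.
Proof.
have n_gt0 : (0 < n)%N by lia.
have szge := sched_size_ge I.
have mle : (m <= m * n)%N by rewrite leq_pmulr.
set a := (2 ^ sz)%N; set b := (2 ^ N)%N; set c := (2 ^ ((2 * N + 1) * N))%N.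
have VE : V = (a * c * (b * b * b * b) * 256)%N.
  rewrite /value_bound /a /b /c; move: (size_N n k) => M.
  rewrite !expnD; congr (_ * _ * _ * _)%N.
  by rewrite expn0 muln1 !mulnA.
have sza : (sz < a)%N by apply: ltn_expl.
have Nb : (N < b)%N by apply: ltn_expl.
have c0 : (0 < c)%N by rewrite expn_gt0.
have N16 := size_N_ge n k.
have b1 : (16 <= b)%N by lia.
have a1 : (4 <= a)%N by lia.
have Va : (256 * a <= V)%N.
  rewrite VE mulnC leq_mul2r /= -mulnA leq_pmulr// !muln_gt0 c0 /=; lia.
have b2 : (b <= b * b)%N by rewrite leq_pmull//; lia.
have b3 : (b * b <= b * b * b)%N by rewrite leq_pmulr//; lia.
have b4 : (b * b * b <= b * b * b * b)%N by rewrite leq_pmulr//; lia.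
have Vb : (256 * (b * b * b * b) <= V)%N.
  by rewrite VE mulnC leq_mul2r /= leq_pmull// muln_gt0 c0; lia.
have Vc : (c <= V)%N.
  rewrite VE [(a * c)%N]mulnC -!mulnA leq_pmulr// !muln_gt0; lia.
have [KN KB] := (size_K_le n k, size_K_bounds n k).
have BN := size_B_double n k.
have kkK := size_kk_le n k.
have tK : (2 ^ K <= b)%N by rewrite leq_exp2l.
have LL : (L <= 2 * (b * b))%N.
  apply: leq_trans (size_L_le n k) _.
  by rewrite addn1 expnS leq_mul2l /= mulnC expnM expnS expn1.
have LN : (L * N <= 2 * (b * b * b))%N.
  by rewrite mulnA; apply: leq_mul => //; rewrite ltnW.
have NK := size_NK_lt n k; have kkkk := size_kkkk_lt n k.
have NKkk : (N ^ kk * kk ^ kk <= b * b)%N by apply: leq_mul; lia.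
have NB := size_NB_le n k; have LB := size_LB_le n k; rewrite -/c in LB.
have NBc : (N ^ B.-1 <= c)%N.
  by apply: leq_trans NB _; rewrite leq_exp2l//; nia.
move: sza Nb Va Vb Vc b1 a1 b2 b3 b4 tK LL LN NKkk NBc.
move: (b * b * b * b)%N (b * b * b)%N (b * b)%N => x4 x3 x2.
move=> *; split; lia.
Qed.

Lemma wp_solve s : s v_m 0%N = m%:Z -> s v_n 0%N = n%:Z -> s v_k 0%N = k%:Z ->
  s v_cm 0%N = cmax I -> wp V loop_bound inp prog_solve decides s.
Proof.
move=> sm sn sk scm.
have [vb_n vb_K vb_L vb_NB vb_LB vb_N vb_NK vb_LN vb_TK vb_T vb_in vb_sum] := value_boundsP.
have inpT := word_bound I.
have cmT := inpT 3%N; rewrite word_cmax in cmT.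
have kkK := size_kk_le n k.
have BK : (B <= K)%N by rewrite /size_K leq_pmulr.
have N_gt0 : (0 < N)%N by have := size_N_ge n k; lia.
have L_gt0 : (0 < L)%N by rewrite muln_gt0.
have NKlt := size_NK_lt n k; have kkkk := size_kkkk_lt n k.
apply: wp_seq; apply: wp_conseq.
  apply: (@wp_sizes V loop_bound inp n k (size_lg n) N B kk K L) => //.
move=> s1 ag1 [sLB [sNB [sL [sNK [sB1 [sK [skk [sB [sN _]]]]]]]]].
apply: wp_seq; apply: wp_conseq.
  by apply: (@wp_pow2 V loop_bound inp s1 K) => //; lia.
move=> s2 ag2 [sP2 sTK].
apply: wp_seq; apply: wp_conseq.
  by apply: (@wp_popcount V loop_bound inp s2 (2 ^ K)%N) => //; rewrite expn_gt0.
move=> s3 ag3 [C [sPC CB C0 CS]].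
apply: wp_seq; apply: wp_conseq.
  apply: (wp_low inpT cmT vb_T vb_in) => //; by rewrite ag3// ag2// ag1.
move=> s4 ag4 [low [slow low_cm lowT low_r]].
apply: wp_seq; apply: wp_conseq.
  apply: (@wp_greedy V loop_bound inp N kk (N ^ kk)%N L K.+1) => //.
  - by rewrite expnS; lia.
  - by lia.
  - by split; rewrite ag4// ag3// ag2.
move=> s5 ag5 [FT [sFT FTk FTp]].
apply: wp_seq; apply: wp_set => //=; [by rewrite /bounded; lia| |].
  by repeat split; rewrite /bounded; lia.
set s6 := upd _ _ _ _.
have X : search_ctx m n k (cmax I) N B kk K L (N ^ B.-1)%N (L ^ B)%N (2 ^ K)%N
    low FT C s6.
  split; rewrite /s6 /=; try solve [by rewrite ag5// ag4// ag3// ag2// ag1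
    | by rewrite ag5// ag4// ag3// ag2 | by rewrite ag5// ag4// ag3 | by rewrite ag5].
  - by [].
  - by move=> i hi /=; rewrite ag5//= ag4//=; apply: sPC.
  - by move=> i hi /=; rewrite ag5//= ag4//= ag3//=; apply: sP2.
apply: wp_conseq.
  by apply: (wp_search inpT cmT vb_T vb_in _ N_gt0 _ _ L_gt0 _ _ FTk CB low_cm
    lowT low_r (@in_ptime_ge0 I) vb_TK vb_LN vb_sum vb_NB vb_LB _ _ _ _ _ _ X).
move=> s7 ag7 [a01 a1 all].
have [yes|no] := pselect (sched_yes R I).
  left; split=> //.
  have [q [t1 [t2 [h1 h2 h3 g]]]] := good_complete k_gt0 kn low_cm low_r C0 CS FTk FTp yes.
  exact: (all q t1 t2).
right; split=> //; case: a01 => // /a1[q [t1 [t2 [_ g]]]].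
by case: no; apply: good_sound g.
Qed.

End Solve.

Section Main.
Variables (R : realType) (I : sched_instance).
Local Notation n := (jobs I).
Local Notation k := (target I).
Local Notation sz := (\sum_(z <- sched_encode I) bitlen z)%N.

(** For [k = 0] the answer is yes and for [k > n] it is no, both without a search; only the input
    numbers need to be bounded then. *)
Definition main_value : nat :=
  if (0 < k <= n)%N then value_bound I else (4 * 2 ^ sz + 8)%N.

Local Notation V := main_value.

Lemma main_value_ge : (4 * 2 ^ sz + 8 <= V)%N.
Proof.
rewrite /main_value; case: ifP => // /andP[k0 kn].
exact: vb_T (value_boundsP k0 kn).
Qed.

Definition main_bound (x : nat) : nat :=
  if (0 < k <= n)%N then loop_bound I x else 0%N.

Lemma wp_main s : wp V main_bound (word I) prog_main (decides R I) s.
Proof.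
have Vg := main_value_ge; have wb := word_bound I.
have V8 : (8 <= V)%N by lia.
have bw i : bounded V (word I i) by have := wb i; rewrite /bounded; lia.
apply: wp_seq; apply: wp_set => //=; [by repeat split; rewrite /bounded; lia|
  by repeat split => //; rewrite /bounded; lia|].
apply: wp_seq; apply: wp_set => //=; [by repeat split; rewrite /bounded; lia|
  by repeat split => //; rewrite /bounded; lia|].
apply: wp_seq; apply: wp_set => //=; [by repeat split; rewrite /bounded; lia|
  by repeat split => //; rewrite /bounded; lia|].
apply: wp_seq; apply: wp_set => //=; [by repeat split; rewrite /bounded; lia|
  by repeat split => //; rewrite /bounded; lia|].
have [b1 b2] := (bw 1%N, bw 2%N); rewrite word_n word_k in b1 b2.
rewrite word_m word_n word_k word_cmax.
apply: wp_if => /=.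
- by repeat split => //; rewrite /bounded; lia.
- move=> k0; apply: wp_if => /=.
  + by repeat split => //; move: b1 b2; rewrite /bounded; lia.
  + move=> kn.
    have mb : main_bound = loop_bound I.
      by apply: funext => x; rewrite /main_bound ifT//; lia.
    have mv : V = value_bound I by rewrite /main_value ifT//; lia.
    by rewrite mb mv; apply: wp_solve => //; lia.
  + move=> nk; apply: wp_set => //=.
    * by repeat split; rewrite /bounded; lia.
    * by repeat split; rewrite /bounded; lia.
    right; split=> // -[s' [_ ks _]].
    by have := leq_trans ks (max_card _); rewrite card_ord; lia.
- move=> k0; apply: wp_set => //=.
  + by repeat split; rewrite /bounded; lia.
  + by repeat split; rewrite /bounded; lia.
  left; split=> //; exists (fun=> None); split=> //; lia.
Qed.

End Main.

(** * Running time *)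

Section Cost.
Local Open Scope nat_scope.

(** [scost] is split into a factor depending only on the program text and a factor [cost_loops]
    built from the loop bounds. The successor of [bnd x] in the latter pays for a loop that is never
    entered. *)
Fixpoint cost_const (c : hprog) : nat :=
  match c with
  | HSkip => 1
  | HSet _ e1 e2 => ecost e1 + ecost e2 + 7
  | HSeq c1 c2 => cost_const c1 + cost_const c2
  | HIf e c1 c2 => ecost e + cost_const c1 + cost_const c2 + 1
  | HFor _ _ c1 => cost_const c1 + 80
  end.

Fixpoint cost_loops (bnd : nat -> nat) (c : hprog) : nat :=
  match c with
  | HSkip | HSet _ _ _ => 1
  | HSeq c1 c2 | HIf _ c1 c2 => cost_loops bnd c1 + cost_loops bnd c2
  | HFor x _ c1 => (bnd x).+1 * cost_loops bnd c1
  end.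

Lemma cost_loops_gt0 bnd c : 0 < cost_loops bnd c.
Proof. by elim: c => //= *; lia. Qed.

Lemma scost_le bnd c : scost bnd c <= cost_const c * cost_loops bnd c.
Proof.
elim: c => //=.
- by move=> *; rewrite muln1.
- move=> c1 h1 c2 h2; rewrite mulnDl !mulnDr; lia.
- move=> e c1 h1 c2 h2; have l1 := cost_loops_gt0 bnd c1.
  have : ecost e + 1 <= (ecost e + 1) * cost_loops bnd c1 by rewrite leq_pmulr.
  rewrite !mulnDl !mulnDr; lia.
- move=> x _ c h; have l := cost_loops_gt0 bnd c.
  have := leq_mul (leqnn (bnd x)) h.
  have : bnd x <= bnd x * cost_loops bnd c by rewrite leq_pmulr.
  set g := cost_loops bnd c in h l *; set k := cost_const c in h *.
  rewrite mulSn !mulnDl !mulnDr; nia.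
Qed.

Variables (bnd : nat -> nat) (Q U P S T1 T2 : nat).
Hypotheses (Q0 : 0 < Q) (U0 : 0 < U) (P0 : 0 < P) (S0 : 0 < S) (T10 : 0 < T1)
  (T20 : 0 < T2).
Hypotheses (hi : bnd v_i < Q) (hl : bnd v_l < Q) (hl2 : bnd v_l2 < Q)
  (hc : bnd v_c < Q) (hy : bnd v_y < Q) (hj : bnd v_j < Q) (hmi : bnd v_mi < Q)
  (hq : bnd v_q < Q) (hu : bnd v_u < U) (hrho : bnd v_rho < P) (hS : bnd v_S < S)
  (ht1 : bnd v_t1 < T1) (ht2 : bnd v_t2 < T2).

Local Notation cl := (cost_loops bnd).

Lemma loops_weight : cl prog_weight <= 20 * Q ^ 2.
Proof.
rewrite /=; have h : (bnd v_l2).+1 * 3 <= 3 * Q by lia.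
have h2 := leq_mul hl (leqnn ((1 + (1 + 1)) + (bnd v_l2).+1 * (1 + (1 + 1)))).
have Q2 : Q <= Q * Q by rewrite leq_pmulr.
rewrite !expnS expn0 muln1; nia.
Qed.

Lemma loops_phi : cl prog_phi <= 23 * (U * Q ^ 2).
Proof.
have w := loops_weight; have -> : cl prog_phi = 1 + (bnd v_u).+1 * (cl prog_weight + 1 + 1) by [].
have q1 : 0 < Q ^ 2 by rewrite expn_gt0 Q0.
have := leq_mul hu (_ : cl prog_weight + 1 + 1 <= 22 * Q ^ 2).
have : 1 <= U * Q ^ 2 by rewrite muln_gt0 U0 q1.
by move=> h1 /(_ ltac:(lia)) h2; lia.
Qed.

Lemma loops_choose : cl prog_choose <= 31 * (U * Q ^ 3).
Proof.
have w := loops_phi; 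
have -> : cl prog_choose =
    1 + (1 + ((bnd v_c).+1 * (1 + (cl prog_phi + (1 + 1 + 1))) + 1)) by [].
have x1 : 0 < U * Q ^ 2 by rewrite muln_gt0 U0 expn_gt0 Q0.
have := leq_mul hc (_ : 1 + (cl prog_phi + (1 + 1 + 1)) <= 27 * (U * Q ^ 2)).
have x3 : U * Q ^ 2 <= Q * (U * Q ^ 2) by rewrite leq_pmull.
have e : U * Q ^ 3 = Q * (U * Q ^ 2) by rewrite expnS mulnCA.
by move=> /(_ ltac:(lia)) h2; rewrite e; lia.
Qed.

Lemma loops_greedy : cl prog_greedy <= 60 * (P * U * Q ^ 4).
Proof.
have w := loops_choose; have v := loops_weight.
have e1 : U * Q ^ 4 = Q * (U * Q ^ 3) by rewrite expnS mulnCA.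
have q3 : 0 < Q ^ 3 by rewrite expn_gt0 Q0.
have x1 : 0 < U * Q ^ 3 by rewrite muln_gt0 U0.
have rd : cl prog_round <= 58 * (U * Q ^ 4).
  have -> : cl prog_round = (bnd v_y).+1 * 1 + ((bnd v_y).+1 * cl prog_choose +
      ((bnd v_y).+1 * 1 + (bnd v_u).+1 * (cl prog_weight + (1 + 1) + 1))) by [].
  have := leq_mul hy w.
  have := leq_mul hu (_ : cl prog_weight + (1 + 1) + 1 <= 23 * Q ^ 2).
  have q2 : 0 < Q ^ 2 by rewrite expn_gt0 Q0.
  move=> /(_ ltac:(lia)) h1 h2.
  have h3 : U * Q ^ 2 <= U * Q ^ 4 by rewrite leq_mul2l leq_pexp2l ?orbT.
  have h4 : Q <= U * Q ^ 4 by rewrite e1 leq_pmulr.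
  by rewrite e1 in h3 h4 *; lia.
have -> : cl prog_greedy = (bnd v_u).+1 * 1 + (bnd v_rho).+1 * cl prog_round by [].
have x4 : 0 < U * Q ^ 4 by rewrite muln_gt0 U0 expn_gt0 Q0.
have h1 := leq_mul hrho rd.
have h2 : U <= U * Q ^ 4 by rewrite leq_pmulr// expn_gt0 Q0.
have h3 : U * Q ^ 4 <= P * (U * Q ^ 4) by rewrite leq_pmull.
rewrite -mulnA; lia.
Qed.

Lemma loops_search : cl prog_search <= 50 * (T1 * T2 * S * Q ^ 3).
Proof.
have QQ : Q <= Q ^ 2 by rewrite expnS expn1 leq_pmulr.
have co : cl prog_colours <= 12 * Q ^ 2.
  rewrite /=; have h : (bnd v_l).+1 * 2 <= 2 * Q by lia.
  have := leq_mul hj (_ : 1 + (1 + ((bnd v_l).+1 * (1 + 1) + 1)) <= 5 * Q).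
  by move=> /(_ ltac:(lia)); rewrite mulnCA mulnn; lia.
have s2 : S * Q <= S * Q ^ 2 by rewrite leq_mul2l QQ orbT.
have s1 : S <= S * Q by rewrite leq_pmulr.
have dp : cl prog_dp <= 14 * (S * Q ^ 2).
  rewrite [cl prog_dp]/=.
  have h1 : (1 + 1) + (bnd v_j).+1 * (1 + (1 + 1 + (1 + (1 + 1 + 1 + 1))) + 1) <= 12 * Q by lia.
  have h2 := leq_mul hS h1; have h3 := leq_mul hmi h2.
  have e : Q * (S * (12 * Q)) = 12 * (S * Q ^ 2) by rewrite expnS expn1; ring.
  by rewrite e in h3; lia.
have ck : cl prog_check <= 3 * (S * Q ^ 2) by rewrite /=; lia.
have -> : cl prog_search = (bnd v_q).+1 * ((bnd v_t1).+1 * ((bnd v_t2).+1 *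
    (cl prog_colours + (cl prog_dp + cl prog_check)))) by [].
have sq : Q ^ 2 <= S * Q ^ 2 by rewrite leq_pmull.
have body : cl prog_colours + (cl prog_dp + cl prog_check) <= 50 * (S * Q ^ 2) by lia.
have h1 := leq_mul ht2 body; have h2 := leq_mul ht1 h1; have h3 := leq_mul hq h2.
apply: leq_trans h3 _.
by rewrite [X in _ <= X](_ : _ = Q * (T1 * (T2 * (50 * (S * Q ^ 2)))))//; rewrite expnS; ring.
Qed.

(** [Q] exceeds all polynomially bounded loops, [P] the rows of the family, [U] the tuples, [S] the
    colour sets, and [T1] and [T2] the choices of boundaries and of rows. The two summands stand for
    the greedy construction and the search. *)
Lemma loops_main : cl prog_main <= 300 * (Q ^ 4 * (P * U + T1 * T2 * S)).
Proof.
have g := loops_greedy; have s := loops_search.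
have Q1 : Q <= Q ^ 4 by rewrite expnS leq_pmulr// expn_gt0 Q0.
have Q3 : Q ^ 3 <= Q ^ 4 by rewrite leq_pexp2l.
have q4 : 0 < Q ^ 4 by rewrite expn_gt0 Q0.
have sz : cl prog_sizes <= 60 * Q by rewrite /=; lia.
have T12 : 0 < T1 * T2 by rewrite muln_gt0 T10.
have SS : S <= T1 * T2 * S by rewrite leq_pmull.
have p2 : cl prog_pow2 <= 4 * Q by rewrite /=; lia.
have pc : cl prog_popcount <= 2 * S by rewrite /=; lia.
have lo : cl prog_low <= 4 * Q by rewrite /=; lia.
have -> : cl prog_main = 1 + (1 + (1 + (1 + (cl prog_sizes + (cl prog_pow2 +
    (cl prog_popcount + (cl prog_low + (cl prog_greedy + (1 + cl prog_search))))) +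
    1 + 1)))) by [].
have PU : 0 < P * U by rewrite muln_gt0 P0.
have e1 : P * U * Q ^ 4 = Q ^ 4 * (P * U) by rewrite mulnC.
have e2 : T1 * T2 * S * Q ^ 3 <= Q ^ 4 * (T1 * T2 * S).
  by rewrite [X in _ <= X]mulnC leq_mul2l Q3 orbT.
have e3 : Q ^ 4 <= Q ^ 4 * (P * U) by rewrite leq_pmulr.
have e4 : T1 * T2 * S <= Q ^ 4 * (T1 * T2 * S) by rewrite leq_pmull.
rewrite e1 in g; rewrite mulnDr; lia.
Qed.

End Cost.

(** * Estimates for the exponential and the logarithm *)

Section Estimates.
Variable R : realType.
Local Notation e1 := (expR 1 : R).

(** From [exp (-1/2) >= 1 - 1/2] follows [exp (1/2) <= 2]. The crude value 4 is a power of two, so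
    that a factor [e ^ B] merges with the other powers of two. *)
Lemma expR1_le4 : e1 <= 4.
Proof.
have h : 1 / 2 <= expR (- (1 / 2)) :> R.
  by have := @expR_ge1Dx R (- (1 / 2)); lra.
have p : 0 < expR (1 / 2) :> R by exact: expR_gt0.
have e : expR (- (1 / 2)) * expR (1 / 2) = 1 :> R.
  by rewrite -expRD addNr expR0.
have -> : e1 = expR (1 / 2) * expR (1 / 2).
  by rewrite -expRD; congr expR; lra.
nra.
Qed.

(** The quotient [x ^ x / x!] is a single term of the series of [exp x], and the constant term 1
    pays for the successor in [rounds_unit]. This is the origin of the factor [e ^ k]. *)
Lemma rounds_unit_expR kk : (rounds_unit kk.+1)%:R <= expR kk.+1%:R :> R.
Proof.
have := @expR_ge1Dxn R kk.+1%:R kk (ler0n _ _); apply: le_trans.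
rewrite /rounds_unit -natr1 addrC lerD2l ler_pdivlMr ?ltr0n ?fact_gt0//.
by rewrite -natrX -natrM ler_nat leq_trunc_div.
Qed.

Lemma ln2_ge : 1 / 2 <= ln (2 : R).
Proof.
have p : expR (1 / 2 : R) <= 2.
  have h : 1 / 2 <= expR (- (1 / 2)) :> R.
    by have := @expR_ge1Dx R (- (1 / 2)); lra.
  have q : 0 < expR (1 / 2) :> R by exact: expR_gt0.
  have e : expR (- (1 / 2)) * expR (1 / 2) = 1 :> R by rewrite -expRD addNr expR0.
  nra.
by rewrite -[X in X <= _]expRK ler_ln// ?posrE ?expR_gt0//; lra.
Qed.

(** With [x] the binary logarithm rounded down, [x * ln 2 <= ln k], so [c * x ^ 2 * ln 2] is at most
    [c * (ln k) ^ 2 / ln 2]. The factor 2 on the right bounds [1 / ln 2]. *)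
Lemma pow2_log_square k c : (0 < k)%N ->
  (2 ^ (c * trunc_log 2 k ^ 2))%N%:R <= k%:R `^ ((2 * c)%N%:R * ln k%:R) :> R.
Proof.
move=> k0; set x := trunc_log 2 k.
have kR : 0 < k%:R :> R by rewrite ltr0n.
have xk : x%:R * ln 2 <= ln k%:R :> R.
  have h : (2 ^ x <= k)%N by exact: trunc_logP.
  rewrite -[X in X <= _]expRK expRM_natl lnK ?posrE; last by lra.
  by rewrite ler_ln ?posrE ?exprn_gt0// -natrX ler_nat.
have l2 := ln2_ge.
rewrite /powR gt_eqF// natrX -[2%:R](@lnK R) ?posrE; last by lra.
rewrite -expRM_natl ler_expR.
have x0 : 0 <= x%:R :> R by rewrite ler0n.
have c0 : 0 <= c%:R :> R by rewrite ler0n.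
rewrite !natrM -!mulrA [X in _ <= X]mulrCA; apply: ler_wpM2l => //.
have : (x%:R * ln 2) * (x%:R * ln 2) <= ln k%:R * ln k%:R :> R.
  by apply: ler_pM => //; apply: mulr_ge0 => //; lra.
set a : R := x%:R in x0 *; set l : R := ln 2 in l2 *; set m := ln k%:R.
by nra.
Qed.

(** Square the inequality [exp (ln k / 2) >= 1 + ln k / 2]. *)
Lemma ln_square_le k : (0 < k)%N -> ln k%:R * ln k%:R <= 4 * k%:R :> R.
Proof.
move=> k0; have kR : 0 < k%:R :> R by rewrite ltr0n.
have l0 : 0 <= ln k%:R :> R by rewrite ln_ge0// ler1n.
have := @expR_ge1Dx R (ln k%:R / 2).
have e : expR (ln k%:R / 2) * expR (ln k%:R / 2) = k%:R :> R.
  by rewrite -expRD -splitr lnK.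
by nra.
Qed.

End Estimates.

(** * Estimates for the modulus bound and the number of blocks *)

Section SizeEstimates.
Local Open Scope nat_scope.
Variables n k : nat.
Hypotheses (k_gt0 : 0 < k) (kn : k <= n).
Local Notation lg := (size_lg n).
Local Notation N := (size_N n k).
Local Notation B := (size_B n k).

Lemma size_N_le : N <= 20 * (k * k * lg).
Proof.
have k1 : k <= k * k by rewrite leq_pmulr.
have k2 : k * k <= k * k * lg by rewrite leq_pmulr.
by rewrite /size_N; lia.
Qed.

(** The factor 20 of [size_N_le] is below [2 ^ 5], and rounding the three logarithms up contributes
    the other 3. *)
Lemma size_B_le : B <= 2 * trunc_log 2 k + trunc_log 2 lg + 8.
Proof.
have h1 := @trunc_log_ltn 2 k isT; have h2 := @trunc_log_ltn 2 lg isT.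
set a := trunc_log 2 k in h1 *; set b := trunc_log 2 lg in h2 *.
suff h : N < 2 ^ (2 * a + b + 8).
  rewrite -(ltn_exp2l _ _ (isT : 1 < 2)); apply: leq_ltn_trans h.
  by rewrite /size_B /=; apply: trunc_logP => //; have := size_N_ge n k; lia.
apply: leq_ltn_trans size_N_le _.
have -> : 2 ^ (2 * a + b + 8) = 32 * (2 ^ a.+1 * 2 ^ a.+1 * 2 ^ b.+1).
  by rewrite -!expnD -(expnD 2 5); congr (2 ^ _); lia.
have : k * k * lg < 2 ^ a.+1 * 2 ^ a.+1 * 2 ^ b.+1.
  by apply: ltn_mul => //; apply: ltn_mul.
by lia.
Qed.

Lemma square_le_pow2 l : l ^ 2 <= 2 * 2 ^ l.
Proof.
case: l => [|[|[|l]]] //.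
suff h : (l.+3) ^ 2 <= 2 ^ l.+4 by rewrite -expnS.
by elim: l => [//|l IH]; rewrite expnS; apply: leq_trans (leq_mul (leqnn 2) IH); nia.
Qed.

(** With [a] and [b] the two logarithms, [(2 * a + b + 8) ^ 2] is at most
    [3 * (4 * a ^ 2 + b ^ 2 + 64)]. Multiplying by 6 gives 72, 18 and 1152, and
    [b ^ 2 <= 2 * 2 ^ b <= 2 * lg] turns 18 into [36 * lg]. Here the square of [log log n] becomes a
    multiple of [log n]. *)
Lemma size_B_square :
  6 * B ^ 2 <= 72 * trunc_log 2 k ^ 2 + 36 * lg + 1152.
Proof.
have h := size_B_le; have := square_le_pow2 (trunc_log 2 lg).
have : 2 ^ trunc_log 2 lg <= lg by exact: trunc_logP.
move: h; set a := trunc_log 2 k; set b := trunc_log 2 lg => h p1 p2.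
have : B ^ 2 <= (2 * a + b + 8) ^ 2 by rewrite leq_sqr.
have := (nat_Cauchy (2 * a) b).1; have := (nat_Cauchy (2 * a) 8).1.
have := (nat_Cauchy b 8).1; rewrite -!mulnn in p2 *.
by lia.
Qed.

Lemma size_lg_le : lg <= n.
Proof.
have n0 : 0 < n by lia.
have h := trunc_logP (isT : 1 < 2) n0.
by apply: leq_trans h; apply: ltn_expl.
Qed.

Lemma pow2_lg_le : 2 ^ lg <= 2 * n.
Proof.
have n0 : 0 < n by lia.
by rewrite /size_lg expnS leq_mul2l trunc_logP.
Qed.

End SizeEstimates.

(** * The running time as a function of k and n *)

Section TotalCost.
Variable R : realType.
Local Notation e1 := (expR 1 : R).

(** The constant is [2 * 72], with 72 from [size_B_square] and 2 from [pow2_log_square]. *)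
Definition exponent (k : nat) : R := 144%:R * ln k%:R.

Definition time_factor (k : nat) : R := (2 * e1) ^+ k * k%:R `^ exponent k.

Lemma time_factor_ge1 k : 1 <= time_factor k.
Proof.
have e1_ge1 : 1 <= e1 by rewrite -[X in X <= _]expR0 ler_expR.
have h : 1 <= (2 * e1) ^+ k by rewrite exprn_ege1//; lra.
rewrite /time_factor -[X in X <= _]mul1r; apply: ler_pM => //.
rewrite /powR /exponent; case: k {h} => [|k].
  (* At [k = 0] the convention [ln 0 = 0] makes the exponent 0, and the power is 1. *)
  by rewrite eqxx ln0// mulr0 eqxx.
rewrite pnatr_eq0 /= -[X in X <= _]expR0 ler_expR.
have : 0 <= ln k.+1%:R :> R by rewrite ln_ge0// ler1n.
by move=> l; rewrite !mulr_ge0.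
Qed.

Section Instance.
Variables n k : nat.
Hypotheses (k_gt0 : (0 < k)%N) (kn : (k <= n)%N).
Local Notation lg := (size_lg n).
Local Notation N := (size_N n k).
Local Notation B := (size_B n k).
Local Notation kk := (size_kk n k).
Local Notation K := (size_K n k).
Local Notation L := (size_L n k).
Local Notation X := ((2 * e1) ^+ k * (2 ^ (6 * B ^ 2))%N%:R).

Let e1_ge1 : 1 <= e1. Proof. by rewrite -[X in X <= _]expR0 ler_expR. Qed.

Let L_le : L%:R <= expR kk%:R * (2 ^ B)%N%:R :> R.
Proof.
rewrite /size_L natrM; apply: ler_pM => //; first exact: rounds_unit_expR.
by rewrite ler_nat; apply: leq_ltn_trans (size_K_le n k) (size_N_lt n k).
Qed.

Let TK_le : (2 ^ K <= 2 ^ k * 2 ^ B)%N.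
Proof. by rewrite -expnD leq_exp2l//; have /andP[] := size_K_bounds n k. Qed.

(** The boundaries cost [2 ^ (B * B)], the colour sets [2 ^ k * 2 ^ B], and the rows
    [e ^ k * 4 ^ B * 2 ^ (B * B)], where [4 ^ B] pays for [e ^ K] with [K <= k + B]. The exponent
    [2 * B ^ 2 + 3 * B] is at most [6 * B ^ 2]. *)
Lemma search_le : (N ^ B.-1 * L ^ B * 2 ^ K)%N%:R <= X.
Proof.
have LB : (L ^ B)%N%:R <= expR 1 ^+ k * (2 ^ (2 * B + B * B))%N%:R :> R.
  rewrite natrX; apply: le_trans (_ : (expR kk%:R * (2 ^ B)%N%:R) ^+ B <= _).
    by apply: lerXn2r; rewrite ?nnegrE// mulr_ge0// expR_ge0.
  rewrite exprMn -[expR kk%:R ^+ B]expRM_natl -natrX -expnM.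
  rewrite -[B%:R * kk%:R]natrM -/(size_K n k) expnD natrM mulrA; apply: ler_wpM2r => //.
  apply: le_trans (_ : expR (k + B)%N%:R <= _).
    by rewrite ler_expR ler_nat; have /andP[] := size_K_bounds n k.
  rewrite -[(k + B)%N%:R]mulr1 expRM_natl exprD; apply: ler_wpM2l.
    by rewrite exprn_ge0// expR_ge0.
  rewrite expnM natrX; apply: lerXn2r; rewrite ?nnegrE ?expR_ge0//.
  exact: expR1_le4.
have NB : (N ^ B.-1 <= 2 ^ (B * B))%N.
  rewrite expnM; apply: leq_trans (leq_exp2rW _ (ltnW (size_N_lt n k))) _.
  by rewrite leq_pexp2l ?expn_gt0// leq_pred.
have B1 : (B <= B ^ 2)%N by rewrite -mulnn leq_pmulr.
rewrite -mulnA natrM [(L ^ B * _)%N]mulnC natrM.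
apply: le_trans (_ : (2 ^ (B * B))%N%:R * ((2 ^ k * 2 ^ B)%N%:R *
   (expR 1 ^+ k * (2 ^ (2 * B + B * B))%N%:R)) <= _).
  by apply: ler_pM; rewrite ?ler_nat// ?mulr_ge0//; apply: ler_pM; rewrite ?ler_nat.
rewrite [X in X <= _](_ : _ = (2 * e1) ^+ k *
    (2 ^ (B * B + B + (2 * B + B * B)))%N%:R); last first.
  by rewrite exprMn !expnD !natrM !natrX; ring.
apply: ler_wpM2l; first by rewrite exprn_ge0// mulr_ge0// expR_ge0.
by rewrite ler_nat leq_exp2l// mulnn; lia.
Qed.

(** As [kk <= k + 1], a single family has [e ^ kk <= 4 * e ^ k], and its tuples number less than
    [2 ^ K]. *)
Lemma greedy_le : (L * N ^ kk)%N%:R <= 4%:R * X.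
Proof.
have NK : (N ^ kk <= 2 ^ k * 2 ^ B)%N.
  exact: leq_trans (ltnW (size_NK_lt n k)) TK_le.
have ekk : expR kk%:R <= 4%:R * e1 ^+ k.
  apply: le_trans (_ : expR (k.+1)%:R <= _).
    by rewrite ler_expR ler_nat /size_kk ltnS leq_div.
  rewrite -[k.+1%:R]mulr1 expRM_natl exprS; apply: ler_wpM2r.
    by rewrite exprn_ge0// expR_ge0.
  exact: expR1_le4.
have B1 : (B <= B ^ 2)%N by rewrite -mulnn leq_pmulr.
rewrite natrM; apply: le_trans (_ : (4%:R * e1 ^+ k * (2 ^ B)%N%:R) *
    (2 ^ k * 2 ^ B)%N%:R <= _).
  apply: ler_pM; rewrite ?ler_nat//; apply: le_trans L_le _.
  by apply: ler_wpM2r.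
rewrite [X in X <= _](_ : _ = 4%:R * ((2 * e1) ^+ k * (2 ^ (B + B))%N%:R)); last first.
  by rewrite exprMn !expnD !natrM !natrX; ring.
apply: ler_wpM2l => //; apply: ler_wpM2l.
  by rewrite exprn_ge0// mulr_ge0// expR_ge0.
by rewrite ler_nat leq_exp2l//; lia.
Qed.

(** Only the term [36 * lg] of [size_B_square] involves [n], and [2 ^ lg <= 2 * n] makes it
    polynomial. *)
Lemma cost_factor_le c : (1152 <= c)%N ->
  X <= time_factor k * (2 ^ c * (2 * n) ^ 36)%N%:R.
Proof.
move=> hc; rewrite /time_factor -mulrA; apply: ler_wpM2l.
  by rewrite exprn_ge0// mulr_ge0// expR_ge0.
apply: le_trans (_ : (2 ^ (72 * trunc_log 2 k ^ 2) *
    (2 ^ c * 2 ^ (36 * lg)))%N%:R <= _).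
  rewrite ler_nat -!expnD leq_exp2l//.
  apply: leq_trans (size_B_square _ _) _ => //.
  by rewrite -addnA leq_add2l addnC leq_add2r.
rewrite natrM; apply: ler_pM; rewrite ?ler0n//.
  by have := pow2_log_square R 72 k_gt0; rewrite -[(2 * 72)%N]/144%N.
rewrite ler_nat leq_mul2l mulnC expnM; apply/orP; right.
by apply: leq_exp2rW; exact: pow2_lg_le k_gt0 kn.
Qed.

End Instance.

End TotalCost.

Lemma bitlen_lt (z e : nat) : (0 < z)%N -> (z < 2 ^ e)%N -> (bitlen z <= e)%N.
Proof.
move=> z0 ze; rewrite /bitlen /= -(ltn_exp2l _ _ (isT : 1 < 2)%N).
by apply: leq_ltn_trans ze; exact: trunc_logP.
Qed.

(** * The running time in terms of the input size *)

Section RunningTime.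
Variable I : sched_instance.
Local Notation m := (machines I).
Local Notation n := (jobs I).
Local Notation k := (target I).
Local Notation sz := (\sum_(z <- sched_encode I) bitlen z)%N.
Local Notation N := (size_N n k).
Local Notation B := (size_B n k).
Local Notation kk := (size_kk n k).
Local Notation K := (size_K n k).
Local Notation L := (size_L n k).

Let sz_gt0 : (0 < sz)%N.
Proof. by have := sched_size_ge I; lia. Qed.

Let pow_ge d e : (d <= e)%N -> (sz ^ d <= sz ^ e)%N.
Proof. by move=> de; rewrite leq_pexp2l. Qed.

Let N_le : (0 < k <= n)%N -> (N <= 20 * sz ^ 3)%N.
Proof.
move=> /andP[k0 kn]; have h := sched_size_ge I.
apply: leq_trans (size_N_le k0 kn) _; rewrite leq_mul2l /= !expnSr mul1n.
have lgn := size_lg_le k0 kn.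
by apply: leq_mul; [apply: leq_mul|]; lia.
Qed.

(** In the main case the length is at most [sz + 2 * N ^ 2 + 5 * N + 15], and [N <= 20 * sz ^ 3]
    gives [1 + 800 + 100 + 15 = 916]. *)
Lemma bitlen_main : (bitlen (64 * main_value I + 64)%N <= 916 * sz ^ 6)%N.
Proof.
have h1 := pow_ge (isT : 1 <= 6)%N; have h3 := pow_ge (isT : 3 <= 6)%N.
have h0 := pow_ge (isT : 0 <= 6)%N; rewrite expn1 expn0 in h0 h1.
rewrite /main_value; case: ifP => [/N_le hN|_].
  have NN : (N * N <= 400 * sz ^ 6)%N.
    apply: leq_trans (leq_mul hN hN) _.
    by rewrite mulnACA -expnD.
  set w := (sz + (2 * N + 1) * N + 4 * N + 8)%N.
  rewrite /value_bound -/w; apply: leq_trans (_ : (w + 7 <= _)%N).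
    apply: bitlen_lt; first by rewrite addn_gt0 orbT.
    by have := ltn_expl w (isT : 1 < 2)%N; rewrite expnD; lia.
  rewrite /w mulnDl mul1n -mulnA.
  by move: (N * N)%N NN hN => N2; move: (sz ^ 6)%N h0 h1 h3 => X; lia.
apply: leq_trans (_ : (sz + 11 <= _)%N); last by move: (sz ^ 6)%N h0 h1 => X; lia.
apply: bitlen_lt; first by rewrite addn_gt0 orbT.
by have : (0 < 2 ^ sz)%N by [rewrite expn_gt0]; rewrite expnD; lia.
Qed.

Lemma loops_main_le (R : realType) c : (1152 <= c)%N ->
  (cost_loops (main_bound I) prog_main)%:R <= time_factor R k *
    (300 * ((83 * sz ^ 3) ^ 4 * (24 * (2 ^ c * (2 * sz) ^ 36))))%N%:R.
Proof.
move=> c1152; have tf1 := time_factor_ge1 R k; have szh := sched_size_ge I.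
have [/andP[k0 kn]|tr] := boolP (0 < k <= n)%N; last first.
  (* Without a search all loop bounds are 0, and every size parameter can be taken to be 1. *)
  have hb x : (main_bound I x < 1)%N by rewrite /main_bound (negbTE tr).
  have h := loops_main (isT : 0 < 1)%N (isT : 0 < 1)%N (isT : 0 < 1)%N
    (isT : 0 < 1)%N (isT : 0 < 1)%N (isT : 0 < 1)%N (hb _) (hb _) (hb _) (hb _)
    (hb _) (hb _) (hb _) (hb _) (hb _) (hb _) (hb _) (hb _) (hb _).
  rewrite -[X in X <= _]mul1r; apply: ler_pM => //; rewrite ler_nat.
  apply: leq_trans h _; rewrite leq_mul2l /= exp1n mul1n.
  have a1 : (0 < (83 * sz ^ 3) ^ 4)%N by rewrite expn_gt0 muln_gt0 expn_gt0 sz_gt0.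
  have a2 : (0 < 2 ^ c * (2 * sz) ^ 36)%N.
    by rewrite muln_gt0 !expn_gt0 muln_gt0 sz_gt0.
  by move: ((83 * sz ^ 3) ^ 4)%N (2 ^ c * _)%N a1 a2 => x y; nia.
have mb : main_bound I = loop_bound I.
  by apply: funext => x; rewrite /main_bound k0 kn.
have N0 : (0 < N)%N by have := size_N_ge n k; lia.
have L0 : (0 < L)%N by rewrite muln_gt0.
have mn : (m <= m * n)%N by rewrite leq_pmulr//; lia.
have b1 := size_K_le n k; have b2 := size_kk_le n k; have b3 := size_B_double n k.
(* Every polynomial loop runs fewer than [Q] times. Of the constant 83, the term [4 * N] accounts
   for 80. *)
set Q := (4 * N + n + m + 1)%N.
have hQ : (Q <= 83 * sz ^ 3)%N.
  have := N_le; rewrite k0 kn => /(_ isT) hN; have := pow_ge (isT : 1 <= 3)%N.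
  by rewrite /Q expn1; move: (sz ^ 3)%N hN => X; lia.
have dbl x : (0 < x)%N -> (x < 2 * x)%N by lia.
have NKp : (0 < N ^ kk)%N by rewrite expn_gt0 N0.
have NBp : (0 < N ^ B.-1)%N by rewrite expn_gt0 N0.
have LBp : (0 < L ^ B)%N by rewrite expn_gt0 L0.
have TKp : (0 < 2 ^ K)%N by rewrite expn_gt0.
have h : (cost_loops (loop_bound I) prog_main <= 300 * (Q ^ 4 * (2 * L * (2 * N ^ kk) +
    2 * N ^ B.-1 * (2 * L ^ B) * (2 * 2 ^ K))))%N.
  by apply: loops_main; rewrite ?muln_gt0 ?NKp ?NBp ?LBp ?TKp ?L0// /loop_bound /=;
    try exact: dbl; rewrite /Q; lia.
(* The strict bounds were obtained by doubling, hence the factors 4 and 8; with [greedy_le] and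
   [search_le] they give [4 * 4 + 8 = 24]. *)
rewrite mb; apply: le_trans (_ : (300 * ((83 * sz ^ 3) ^ 4 *
   (4 * (L * N ^ kk) + 8 * (N ^ B.-1 * L ^ B * 2 ^ K))))%N%:R <= _).
  rewrite ler_nat; apply: leq_trans h _; rewrite leq_mul2l /=.
  apply: leq_mul; first exact: leq_exp2rW.
  by move: (N ^ kk)%N (N ^ B.-1)%N (L ^ B)%N (2 ^ K)%N => x1 x2 x3 x4; lia.
have sh := search_le R k0 kn; have gr := greedy_le R k0 kn.
have cf := cost_factor_le R k0 kn c1152.
have n_sz : (2 ^ c * (2 * n) ^ 36 <= 2 ^ c * (2 * sz) ^ 36)%N.
  by rewrite leq_mul2l; apply/orP; right; apply: leq_exp2rW; lia.
have cf2 : (2 * expR 1) ^+ k * (2 ^ (6 * B ^ 2))%N%:R <=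
    time_factor R k * (2 ^ c * (2 * sz) ^ 36)%N%:R.
  apply: le_trans cf _; apply: ler_wpM2l; last by rewrite ler_nat.
  by lra.
set Y := (2 ^ c * (2 * sz) ^ 36)%N in cf2 *.
move: cf2 gr sh; set X := _ ^+ k * _ => cf2 gr sh.
set W := ((83 * sz ^ 3) ^ 4)%N.
have -> : time_factor R k * (300 * (W * (24 * Y)))%N%:R =
    300%:R * W%:R * (24%:R * (time_factor R k * Y%:R)) by rewrite !natrM; ring.
rewrite mulnA natrM [(300 * W)%N%:R]natrM; apply: ler_wpM2l.
  by rewrite mulr_ge0 ?ler0n.
by rewrite natrD [(4 * _)%N%:R]natrM [(8 * _)%N%:R]natrM; lra.
Qed.

End RunningTime.

Lemma monomial_bound (c1 c2 c3 c4 a1 a2 a3 e : nat) : exists A d, forall s,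
  (0 < s)%N ->
  (c1 * (c2 * ((a1 * s ^ 3) ^ 4 * (c3 * (c4 * (a2 * s) ^ 36)))) * (a3 * s ^ 6) ^ 2
     + e <= A * s ^ d)%N.
Proof.
exists (c1 * (c2 * (a1 ^ 4 * (c3 * (c4 * a2 ^ 36)))) * a3 ^ 2 + e)%N, (12 + 36 + 12)%N.
move=> s s0; rewrite mulnDl; apply: leq_add; last by rewrite leq_pmulr// expn_gt0 s0.
apply: eq_leq; rewrite (expnMn a1) (expnMn a2) (expnMn a3) -!expnM !(expnD s).
rewrite -[(3 * 4)%N]/12%N -[(6 * 2)%N]/12%N.
by move: (s ^ 12)%N (s ^ 36)%N (a1 ^ 4)%N (a2 ^ 36)%N (a3 ^ 2)%N => *; ring.
Qed.

(** Compiled code writes only to negative addresses, so the answer is finally copied to the output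
    cell 0. *)
Definition solver : prog :=
  Seq (compile prog_main) (Store (Const 0) (Fetch (Const (Negz v_ans)))).

Lemma solver_correct (R : realType) (I : sched_instance) : exists t M,
  [/\ exec solver (init (sched_encode I)) t M,
      (t <= scost (main_bound I) prog_main * bitlen (64 * main_value I + 64)%N ^ 2
        + 14)%N &
      (sched_yes R I /\ output M = 1) \/ (~ sched_yes R I /\ output M = 0)].
Proof.
have [ok dec] := wp_main R I (fun _ _ => 0).
have [t ex ht] := compile_exec (erefl : wfc prog_main) ok.
have init_hmem : init (sched_encode I) = hmem (word I) (fun _ _ => 0) by [].
set s := sem _ _ _ in ex dec.
set M := hmem _ s in ex.
have sans : M (Negz v_ans) = s v_ans 0%N by exact: mem_scalar.
eexists _, _; split.
- by rewrite init_hmem; apply: exec_seq ex _; exact: exec_store.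
(* The final copy has logarithmic cost 14, the answer being 0 or 1. *)
- rewrite leq_add//= sans.
  by case: dec => -[_ ->].
- rewrite /output /update eqxx /= sans; exact: dec.
Qed.

Lemma solver_time (R : realType) : exists q : {poly nat},
  solves_in_time solver (fun I : inst (sched_problem R) =>
    time_factor R (param I) * (q.[input_size I])%:R).
Proof.
(* The numeral is hidden so that [2 ^ c] stays symbolic. *)
have [c hc] : exists c, (1152 <= c)%N by exists 1152%N.
have [A [d hA]] := monomial_bound (cost_const prog_main) 300 24 (2 ^ c) 83 2 916 14.
exists (A%:P * 'X^d) => I; have [t [M [ex ht dec]]] := solver_correct R I.
exists t, M; split=> //; rewrite !hornerE natrXE /input_size /=.
have tf1 := time_factor_ge1 R (target I).
set sz := (\sum_(z <- _) _)%N.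
have sz0 : (0 < sz)%N by have := sched_size_ge I; rewrite -/sz; lia.
have lp := loops_main_le I R hc; have bl := bitlen_main I; rewrite -/sz in lp bl.
have hAs := hA sz sz0.
move: ht; set b := bitlen _ in bl *; move=> ht.
have b2 : (b ^ 2 <= (916 * sz ^ 6) ^ 2)%N by exact: leq_exp2rW.
have sc := scost_le (main_bound I) prog_main.
have ht2 : (t <= cost_const prog_main * cost_loops (main_bound I) prog_main *
    (916 * sz ^ 6) ^ 2 + 14)%N.
  by apply: leq_trans ht _; rewrite leq_add2r; apply: leq_mul.
move: (300 * _)%N lp hAs => Z lp hAs.
apply: le_trans (_ : time_factor R (target I) *
    (cost_const prog_main * Z * (916 * sz ^ 6) ^ 2 + 14)%N%:R <= _); last first.
  by apply: ler_wpM2l; [lra|rewrite ler_nat].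
apply: le_trans (_ : (cost_const prog_main * cost_loops (main_bound I) prog_main *
    (916 * sz ^ 6) ^ 2 + 14)%N%:R <= _); first by rewrite ler_nat.
move: {b2 ht ht2 hAs bl sc} ((916 * sz ^ 6) ^ 2)%N (cost_const prog_main)
  (cost_loops _ _) lp => Y C X lp.
rewrite !natrD mulrDr; apply: lerD.
  rewrite !natrM mulrA; apply: ler_wpM2r => //.
  by rewrite mulrCA; apply: ler_wpM2l.
by rewrite -[X in X <= _]mul1r; apply: ler_wpM2r.
Qed.

(** Provides the computable bound for fixed-parameter tractability. Cell 0, which holds the input,
    is counted down while cell [Negz 0] accumulates the power. *)
Lemma computable_expn (E : nat) : computable (fun x => E ^ x)%N.
Proof.
pose out := Fetch (Const (Negz 0)).
pose body := Seq (Store (Const (Negz 0)) (Mul out (Const E)))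
  (Store (Const 0) (Defs.Sub (Fetch (Const 0)) (Const 1))).
have loop x : forall M, M 0 = x%:Z -> exists t M', exec (While (Fetch (Const 0)) body) M t M' /\
    M' (Negz 0) = M (Negz 0) * (E ^ x)%N.
  elim: x => [|x IH] M M0.
    exists (eval_cost M (Fetch (Const 0))).+1, M; rewrite expn0 mulr1; split=> //.
    by apply: exec_while_false; rewrite /= M0.
  pose M1 := update M (Negz 0) (M (Negz 0) * E).
  pose M2 := update M1 0 (M1 0 - 1).
  have [|t [M' [ex e]]] := IH M2; first by rewrite /M2 /update eqxx /M1 /update /= M0; lia.
  eexists _, M'; split.
    apply: exec_while_true ex; first by rewrite /= M0.
    by apply: exec_seq; exact: exec_store.
  by rewrite e /M2 /M1 /update /= -mulrA -PoszM -expnS.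
exists (Seq (Store (Const (Negz 0)) (Const 1))
  (Seq (While (Fetch (Const 0)) body) (Store (Const 0) out))) => x.
have [//|t [M [ex e]]] := loop x (update (init [:: x%:Z]) (Negz 0) 1).
eexists _, _; split.
  apply: exec_seq; first exact: exec_store.
  by apply: exec_seq ex _; exact: exec_store.
by rewrite /output /update eqxx /= e /update eqxx mul1r.
Qed.

(** The factor [k ^ (144 * ln k)] is [exp (144 * (ln k) ^ 2)], at most [exp (576 * k)] by
    [ln_square_le], so a single exponential dominates. *)
Lemma time_factor_expn (R : realType) : exists E : nat, forall k,
  time_factor R k <= (E ^ k)%N%:R.
Proof.
pose y : R := 2 * expR 1 * expR 576.
have y0 : 0 <= y by rewrite mulr_ge0 ?expR_ge0 ?mulr_ge0 ?expR_ge0 ?ler0n.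
exists (Num.bound y) => k; rewrite natrX.
apply: le_trans (_ : y ^+ k <= _); last first.
  by apply: lerXn2r; rewrite ?nnegrE// ltW// archi_boundP.
rewrite /y exprMn /time_factor; apply: ler_wpM2l.
  by rewrite exprn_ge0// mulr_ge0// expR_ge0.
rewrite /powR /exponent; case: k => [|k].
  by rewrite eqxx ln0// mulr0 eqxx expr0.
rewrite pnatr_eq0 /= -expRM_natl ler_expR -mulrA.
by have := ln_square_le R (ltn0Sn k); lra.
Qed.
Local Open Scope classical_set_scope.

Theorem theorem17 (R : realType) :
  fixed_parameter_tractable R (sched_problem R) /\
  exists h : nat -> R,
    h =O_\oo (fun k : nat => ln (k%:R : R)) /\
    solvable_Ostar (sched_problem R)
      (fun k : nat => (2 * expR 1) ^+ k * k%:R `^ h k).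
Proof.
have [q qP] := solver_time R; split.
  have [E EP] := time_factor_expn R.
  exists (fun k => E ^ k)%N; split; first exact: computable_expn.
  exists solver, q => I; have [t [M [ex tq dec]]] := qP I.
  exists t, M; split=> //; apply: le_trans tq _.
  by apply: ler_wpM2r.
exists (exponent R); split; last by exists solver, q.
apply/eqOP; exists 144; split=> [|c /ltW c144]; first exact: num_real.
apply: nearW => k; rewrite /exponent normrM; apply: ler_wpM2r => //.
by rewrite ger0_norm.
Qed.
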